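(* Let $\mu$ be a continuous probability measure on $2^{\mathbb N}$ and $n\ge1$ an integer. Let $A$ be a real that is non-$\mu$-random of level $2n$, and let $B$ be r.e.a. $A$, say $B=W^A_e$, where $B$ is infinite, $0\in B$, and $\Phi^A_e(0)$ halts in one step without querying the oracle. Write $b_i=B(i)$. For each $i$ let $m_i=\min\{j>i:\Phi^A_e(j)\downarrow\}$ and define $$f(i)=\begin{cases}\min\{s:\forall j\le m_i\,(\Phi^A_e(j)\downarrow\Rightarrow \Phi^A_{e,s}(j)\downarrow)\}&\text{if } i\in B,\\ 1&\text{if } i\notin B.\end{cases}$$ Let $C$ be the real $b_0^{f(0)}\,0\,b_1^{f(1)}\,0\,b_2^{f(2)}\,0\cdots$ (the limit of the strings $C_i=b_0^{f(0)}0\,b_1^{f(1)}0\cdots 0\,b_i^{f(i)}$, where $b^k$ denotes $k$ copies of the bit $b$). Then $C$ is non-$\mu$-random of level $n$.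
   Context: $\Phi_e^A$ is the $e$-th oracle Turing machine with oracle $A$, $\Phi^A_{e,s}(j)\downarrow$ means it halts on input $j$ within $s$ steps, and $W^A_e=\operatorname{dom}(\Phi^A_e)$, identified with its characteristic sequence. $B$ is r.e.a. $A$ if $B=W^A_e$ for some $e$ and $A\le_T B$. $[\sigma]$ is the set of reals extending $\sigma$; $\log$ is binary; $F^{(n)}$ is the $n$-fold iterate. A set is $\mu$-c.e. if c.e. in every representation of $\mu$ (a real coding a fast-converging sequence of indices of measures from a fixed countable dense subset of the space of probability measures on $2^{\mathbb N}$). Continuous: all singletons have measure $0$. Dissipation function: $h(l)=\max\{n:\forall|\sigma|=l,\ \mu[\sigma]<2^{-n+1}\}$. For $n\ge1$, a level-$n$ Solovay test for $\mu$ is a $\mu$-c.e. sequence $T$ of finite strings with $\sum_{\sigma\in T}(h^{(n)}(|\sigma|))^{\log n}2^{-h^{(n)}(|\sigma|)}<\infty$; a real fails $T$ if it lies in $[\sigma]$ for infinitely many $\sigma\in T$; a real is non-$\mu$-random of level $n$ if it fails some level-$n$ Solovay test for $\mu$. *)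

(* Defs.v *)
From HB Require Import structures.
From mathcomp Require Import all_boot all_order all_algebra.
From mathcomp Require Import all_classical all_reals all_analysis.

Set Implicit Arguments.
Unset Strict Implicit.
Unset Printing Implicit Defensive.

Import Order.TTheory GRing.Theory Num.Theory.
Import numFieldNormedType.Exports.

Local Open Scope classical_set_scope.
Local Open Scope ring_scope.

(* Elements of 2^N; a set of natural numbers is identified with its
   characteristic sequence. *)
Definition real := nat -> bool.

(* Both are used only on sets that have such an element. *)
Definition least (P : set nat) : nat :=
  xget 0%N [set k | P k /\ forall m, P m -> (k <= m)%N].
Definition greatest (P : set nat) : nat :=
  xget 0%N [set k | P k /\ forall m, P m -> (m <= k)%N].

(** * Oracle Turing machines

   A machine has finitely many two-way infinite work tapes over a finite
   alphabet, and a read-only one-way infinite oracle tape on which the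
   characteristic sequence of the oracle is written.  The oracle cell under the
   oracle head influences the computation only through explicit query
   instructions.  Moving the oracle head and querying each cost one step, so
   that only oracle positions below s can be queried within s steps. *)

(* None: stay; Some false: move left; Some true: move right. *)
Definition move := option bool.

(* A state of type option 'I_q.+1 is None when the machine has halted.
   inl (yes, no): query the scanned oracle cell and enter state yes or no
     according to the answer;
   inr (p, w, d): enter state p, write and move on the work tapes as told by w,
     and move the oracle head by d. *)
Definition instr (q k a : nat) :=
  (option 'I_q.+1 * option 'I_q.+1
   + option 'I_q.+1 * {ffun 'I_k.+1 -> 'I_a.+2 * move} * move)%type.

(* otm_delta maps a non-halted state and the scanned work tape symbols to an
   instruction.  The initial state is ord0; symbol 0 is the blank. *)
Record otm := OTM {
  otm_states : nat;
  otm_tapes : nat;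
  otm_symbols : nat;
  otm_delta :
    {ffun 'I_otm_states.+1 * {ffun 'I_otm_tapes.+1 -> 'I_otm_symbols.+2} ->
          instr otm_states otm_tapes otm_symbols} }.

Definition otm_fam (t : nat * nat * nat) : countType :=
  {ffun 'I_t.1.1.+1 * {ffun 'I_t.1.2.+1 -> 'I_t.2.+2} -> instr t.1.1 t.1.2 t.2}.
Definition tag_of_otm (M : otm) : {t : nat * nat * nat & otm_fam t} :=
  @Tagged _ (otm_states M, otm_tapes M, otm_symbols M) otm_fam (otm_delta M).
Definition otm_of_tag (u : {t : nat * nat * nat & otm_fam t}) : otm :=
  OTM (tagged u).
Lemma tag_of_otmK : cancel tag_of_otm otm_of_tag. Proof. by case. Qed.
HB.instance Definition _ := Countable.copy otm (can_type tag_of_otmK).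

Definition default_otm : otm :=
  @OTM 0 0 0 [ffun=> inr (None, [ffun=> (ord0, None)], None)].

(* Every machine occurs in this numbering, by pickleK. *)
Definition machine (e : nat) : otm := odflt default_otm (unpickle e).

Section Run.
Variable M : otm.

Let sym := 'I_(otm_symbols M).+2.

(* (l, x, r): the head scans x, l lists the cells on its left starting from the
   closest one, r those on its right; all other cells are blank. *)
Definition tape := (seq sym * sym * seq sym)%type.

Definition write (x : sym) (t : tape) : tape := (t.1.1, x, t.2).

Definition tape_move (d : move) (t : tape) : tape :=
  let: (l, x, r) := t in
  match d with
  | None => t
  | Some false => (behead l, head ord0 l, x :: r)
  | Some true => (x :: l, head ord0 r, behead r)
  end.

Definition head_move (d : move) (p : nat) : nat :=
  match d with None => p | Some false => p.-1 | Some true => p.+1 end.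

Record config := Config {
  cfg_state : option 'I_(otm_states M).+1;
  cfg_tapes : 'I_(otm_tapes M).+1 -> tape;
  cfg_oracle : nat }.

Definition scanned (c : config) : {ffun 'I_(otm_tapes M).+1 -> sym} :=
  [ffun i => (cfg_tapes c i).1.2].

Definition cur_instr (c : config) :
    option (instr (otm_states M) (otm_tapes M) (otm_symbols M)) :=
  omap (fun p => otm_delta M (p, scanned c)) (cfg_state c).

Definition step (X : real) (c : config) : config :=
  match cur_instr c with
  | None => c
  | Some (inl (yes, no)) =>
      Config (if X (cfg_oracle c) then yes else no) (cfg_tapes c) (cfg_oracle c)
  | Some (inr (p, w, d)) =>
      Config p (fun i => tape_move (w i).2 (write (w i).1 (cfg_tapes c i)))
             (head_move d (cfg_oracle c))
  end.

(* Input j is a block of j ones on work tape 0, the head scanning the leftmost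
   one; the other work tapes are blank. *)
Definition init (j : nat) : config :=
  let one : sym := inord 1 in
  Config (Some ord0)
    (fun i => if (i == ord0) && (0 < j)%N then ([::], one, nseq j.-1 one)
              else ([::], ord0, [::])) 0.

Definition run (X : real) (j s : nat) : config := iter s (step X) (init j).

Definition is_query (c : config) : bool :=
  if cur_instr c is Some (inl _) then true else false.

(* The output of a halted computation is the number of ones on work tape 0. *)
Definition output (c : config) : nat :=
  let: (l, x, r) := cfg_tapes c ord0 in
  count (fun y : sym => val y == 1%N) (l ++ x :: r).

End Run.

Definition Phi_run (e : nat) (X : real) (j s : nat) : config (machine e) :=
  run (machine e) X j s.

Definition halts_within (e : nat) (X : real) (s j : nat) : bool :=
  cfg_state (Phi_run e X j s) == None.

Definition halts (e : nat) (X : real) (j : nat) : Prop :=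
  exists s, halts_within e X s j.

Definition makes_query (e : nat) (X : real) (j : nat) : Prop :=
  exists s, is_query (Phi_run e X j s).

Definition Phi_eq (e : nat) (X : real) (j y : nat) : Prop :=
  exists s, halts_within e X s j /\ output (Phi_run e X j s) = y.

Definition W (e : nat) (X : real) : set nat := [set j | halts e X j].

Definition turing_le (X Y : real) : Prop :=
  exists e, forall j, Phi_eq e Y j (X j).

Definition rea (B A : real) : Prop :=
  (exists e, [set j | B j] = W e A) /\ turing_le A B.

(* The number written 1 sigma in binary. *)
Definition string_code (s : seq bool) : nat :=
  foldl (fun k (b : bool) => (k.*2 + b)%N) 1%N s.

Definition ce_strings (X : real) (T : set (seq bool)) : Prop :=
  exists e, forall s, T s <-> W e X (string_code s).

(** * Probability measures on Cantor space and their representations *)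

Notation borel_cantor := (g_sigma_algebraType (@open cantor_space)).

Definition cylinder (s : seq bool) : set borel_cantor :=
  [set x | forall i, (i < size s)%N -> x i = nth false s i].

Definition continuous_measure (R : realType) (mu : probability borel_cantor R) :=
  forall x : borel_cantor, mu [set x] = 0%E.

(* The eventually zero real whose i-th entry is the i-th binary digit of k. *)
Definition dyadic_point (k : nat) : borel_cantor :=
  fun i : nat => odd (k %/ 2 ^ i).

(* The index q codes a list w of natural numbers; when sumn w > 0 the measure
   with index q gives the point dyadic_point k the mass w_k / sumn w.  These are
   exactly the measures with rational values on finitely many eventually zero
   reals. *)
Definition dense_weights (q : nat) : seq nat := CodeSeq.decode q.
Definition dense_index (q : nat) : bool := (0 < sumn (dense_weights q))%N.
Definition dense_measure (R : realType) (q : nat) (E : set borel_cantor) : \bar R :=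
  (\sum_(k < size (dense_weights q))
     ((nth 0%N (dense_weights q) k)%:R / (sumn (dense_weights q))%:R)%:E
       * \d_(dyadic_point k) E)%E.

Definition measure_dist (R : realType) (mu nu : set borel_cantor -> \bar R) : \bar R :=
  (\sum_(1 <= l <oo) ((2 ^- l)%:E *
     ((2^-1)%:E * \sum_(s : l.-tuple bool) `|mu (cylinder s) - nu (cylinder s)|)))%E.

Definition pair_code (i k : nat) : nat := (2 ^ i * k.*2.+1).-1.

Definition representation (R : realType) (mu : probability borel_cantor R)
    (X : real) : Prop :=
  exists q : nat -> nat,
    (forall i k, X (pair_code i k) = (k == q i)) /\
    (forall i, dense_index (q i) /\
       (measure_dist (@dense_measure R (q i)) mu <= (2 ^- i)%:E)%E).

Definition mu_ce (R : realType) (mu : probability borel_cantor R)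
    (T : set (seq bool)) : Prop :=
  forall X, representation mu X -> ce_strings X T.

(** * Solovay tests *)

Definition dissipation (R : realType) (mu : probability borel_cantor R)
    (l : nat) : nat :=
  greatest [set n | forall s : seq bool, size s = l ->
                      (mu (cylinder s) < (2 ^- n * 2)%:E)%E].

Definition log2 (R : realType) (x : R) : R := ln x / ln 2.

(* For n = 1 the exponent log n is 0, and powR 0 0 = 1. *)
Definition test_weight (R : realType) (mu : probability borel_cantor R)
    (n : nat) (s : seq bool) : R :=
  let d := iter n (dissipation mu) (size s) in
  powR d%:R (log2 n%:R) * 2 ^- d.

(* T is a set of strings: repetitions are not counted. *)
Definition solovay_test (R : realType) (mu : probability borel_cantor R)
    (n : nat) (T : set (seq bool)) : Prop :=
  mu_ce mu T /\ (\esum_(s in T) (test_weight mu n s)%:E < +oo)%E.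

Definition fails_test (X : real) (T : set (seq bool)) : Prop :=
  infinite_set (T `&` [set s | cylinder s X]).

Definition non_random (R : realType) (mu : probability borel_cantor R)
    (n : nat) (X : real) : Prop :=
  exists T, solovay_test mu n T /\ fails_test X T.

(** * The real C *)

Definition next_halting (e : nat) (A : real) (i : nat) : nat :=
  least [set j | (i < j)%N /\ halts e A j].

Definition settling (e : nat) (A B : real) (i : nat) : nat :=
  if B i then
    least [set s | forall j, (j <= next_halting e A i)%N ->
                     halts e A j -> halts_within e A s j]
  else 1%N.

Fixpoint C_string (e : nat) (A B : real) (i : nat) : seq bool :=
  let block k := nseq (settling e A B k) (B k) in
  if i is i'.+1 then C_string e A B i' ++ false :: block i else block 0%N.

(* C is the limit of the strings C_string e A B i, whose lengths tend to
   infinity. *)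
Definition is_limit_C (e : nat) (A B C : real) : Prop :=
  forall i, cylinder (C_string e A B i) C.

(* Main.v *)
(* Let T be a level-2n test failed by A, let h be the dissipation function, and let sigma in T be
   an initial segment of A of length l. Running the machine e for l steps with oracle sigma gives
   a set of candidates for the elements of B, hence a chain of candidates for the initial
   segments of C. Let i be the first element of B with f(i) > l. Below i the candidates are right,
   so that C extends E 1^l, where E is the candidate that ends just before the block of i; if no
   such i exists, then all the candidates in question are initial segments of C. With
   L = h^(n)(l), C therefore extends either the unique candidate of length L or one of the at most
   L strings E 1^l with |E| < L. The former has level-n weight about
   a^(log n) 2^-a, and the latter have total weight at most L^(1 + log n) 2^-L, where
   a = h^(n)(L) = h^(2n)(l) <= L; both are bounded by a multiple of the level-2n weight
   a^(1 + log n) 2^-a of sigma, as log(2n) = 1 + log n.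

   The function h is not computable from a representation of mu, so h(l) is replaced by every g
   such that mu[s] < 2^(1-g) for all s of length l and mu[s] > 2^(-1-g) for some of them. These
   conditions are open, hence enumerable from every representation and independent of it, and
   g is h(l) or h(l) - 1; iterating n times costs a factor of n + 1 in the number of strings and
   of 2^n in their weight.

   Enumerability is reduced to nondeterministic counter programs, for which the closure under
   conjunction, disjunction, existential quantification and reachability is immediate, and
   which a deterministic oracle machine simulates by trying all guesses. *)
Require Import Defs.
From HB Require Import structures.
From Stdlib Require Import Relation_Operators.
From mathcomp Require Import all_boot all_order all_algebra.
From mathcomp Require Import all_classical all_reals all_analysis.
From mathcomp Require Import finmap zify ring lra.

Set Implicit Arguments.
Unset Strict Implicit.
Unset Printing Implicit Defensive.

Import Order.TTheory GRing.Theory Num.Theory.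
Import numFieldNormedType.Exports.

Local Open Scope classical_set_scope.

(** The decoding rests on the choice of f: the exponent f(j) bounds the halting times of all
    elements of B up to the next element m_j. So if f(j) <= l for all elements j of B below some i
    in B, the largest such j has m_j = i, and l steps with the first l bits of A as oracle decide B
    up to i. If f(i) > l, this failure is itself visible in C as a run of l ones, which makes E 1^l
    so long that its weight is bounded in terms of l alone. Only not knowing where that run starts
    costs anything, and this is why the level is doubled. Two obstacles shape the rest. Tests are
    enumerated by concrete oracle machines, from every representation of mu: the given test has to
    be read off a machine and the new one turned back into a machine, so machines and counter
    programs must simulate each other. And x^c 2^-x is not monotone in x, so weights at different
    lengths can be compared only up to a constant. *)

Local Notation star R := (clos_refl_trans_1n _ R).

(** * Nondeterministic counter programs *)

Lemma star_trans T (R : T -> T -> Prop) x y z : star R x y -> star R y z -> star R x z.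
Proof.
by elim=> // a b c Rab _ IH /IH; apply: rt1n_trans.
Qed.

Lemma star_step T (R : T -> T -> Prop) x y : R x y -> star R x y.
Proof. by move=> Rxy; apply: rt1n_trans Rxy _; exact: rt1n_refl. Qed.

Lemma star_map T U (R : T -> T -> Prop) (Q : U -> U -> Prop) (f : T -> U) x y :
  (forall a b, R a b -> Q (f a) (f b)) -> star R x y -> star Q (f x) (f y).
Proof.
move=> RQ; elim=> [a|a b c /RQ Qab _]; first exact: rt1n_refl.
exact: rt1n_trans.
Qed.

(** Induction from the end of a run: acceptance is about reaching a final configuration, so the
    invariants used below say what remains to be done from a configuration and are pulled back along
    each step. *)
Lemma star_rev T (R : T -> T -> Prop) (I : T -> Prop) x y :
  I y -> (forall a b, R a b -> I b -> I a) -> star R x y -> I x.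
Proof. by move=> + IR st; elim: st => // a b c /IR Rab _ IH /IH. Qed.

Definition store := nat -> nat.

Definition upd (s : store) (r v : nat) : store := fun k => if k == r then v else s k.

Inductive act :=
  Skip | Inc of nat | Dec of nat | Zero of nat | InputOne | InputBlank | Query of bool.

Definition act_code (a : act) : nat * nat :=
  match a with
  | Skip => (0, 0) | Inc r => (1, r) | Dec r => (2, r) | Zero r => (3, r)
  | InputOne => (4, 0) | InputBlank => (5, 0) | Query b => (6, nat_of_bool b)
  end.
Definition act_decode (c : nat * nat) : act :=
  match c with
  | (0, _) => Skip | (1, r) => Inc r | (2, r) => Dec r | (3, r) => Zero r
  | (4, _) => InputOne | (5, _) => InputBlank | (_, b) => Query (b == 1)
  end.
Lemma act_codeK : cancel act_code act_decode. Proof. by case=> // -[]. Qed.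
HB.instance Definition _ := Equality.copy act (can_type act_codeK).

(* Register 0 is the position of the head on the input tape, whose cells 1, ..., j
   are ones for the input j; register 1 is the position of the oracle head. *)
Definition enabled (X : nat -> bool) (j : nat) (a : act) (s : store) : bool :=
  match a with
  | Skip | Inc _ => true
  | Dec r => 0 < s r
  | Zero r => s r == 0
  | InputOne => 0 < s 0 <= j
  | InputBlank => j < s 0
  | Query b => X (s 1) == b
  end.

Definition effect (a : act) (s : store) : store :=
  match a with
  | Inc r => upd s r (s r).+1
  | Dec r => upd s r (s r).-1
  | _ => s
  end.

Record nfa := Nfa {
  nfa_state :> finType;
  nfa_ini : nfa_state;
  nfa_fin : nfa_state;
  nfa_trans : seq (nfa_state * act * nfa_state) }.

Section Semantics.
Variables (X : nat -> bool) (j : nat).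

Definition nstep (N : nfa) (c d : N * store) : Prop :=
  exists a, [/\ (c.1, a, d.1) \in nfa_trans N, enabled X j a c.2 & d.2 = effect a c.2].

(** A program denotes a relation between an initial and a final store, so that sequencing, choice
    and iteration become composition, union and reflexive transitive closure. *)
Definition acc (N : nfa) (s t : store) : Prop :=
  star (@nstep N) (nfa_ini N, s) (nfa_fin N, t).

Definition nfa_act (a : act) : nfa := @Nfa bool false true [:: (false, a, true)].

Lemma acc_act a s t : acc (nfa_act a) s t <-> enabled X j a s /\ t = effect a s.
Proof.
split=> [|[en ->]]; last by apply: star_step; exists a; rewrite /= inE.
pose I (c : nfa_act a * store) := if c.1 then t = c.2 else enabled X j a c.2 /\ t = effect a c.2.
apply: (@star_rev _ _ I _ _) => //= -[q u] [q' u'] [b [/=]].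
by rewrite inE => /eqP[-> -> ->] en ->.
Qed.

Definition nfa_seq (N1 N2 : nfa) : nfa :=
  @Nfa (N1 + N2)%type (inl (nfa_ini N1)) (inr (nfa_fin N2))
    ((inl (nfa_fin N1), Skip, inr (nfa_ini N2)) ::
     [seq (inl x.1.1, x.1.2, inl x.2) | x <- nfa_trans N1] ++
     [seq (inr x.1.1, x.1.2, inr x.2) | x <- nfa_trans N2]).

Lemma acc_seq N1 N2 s t :
  acc (nfa_seq N1 N2) s t <-> exists u, acc N1 s u /\ acc N2 u t.
Proof.
split=> [|[u [acc1 acc2]]]; last first.
  pose f1 (c : N1 * store) : nfa_seq N1 N2 * store := (inl c.1, c.2).
  pose f2 (c : N2 * store) : nfa_seq N1 N2 * store := (inr c.1, c.2).
  apply: (star_trans (y := f1 (nfa_fin N1, u))).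
    apply: star_map acc1 => -[q v] [q' v'] [a [/= tr en ->]]; exists a; split=> //.
    by rewrite inE mem_cat; apply/or3P; apply: Or32; apply/mapP; exists (q, a, q').
  apply: rt1n_trans (f2 (nfa_ini N2, u)) _ _ _.
    by exists Skip; rewrite /= inE eqxx.
  apply: star_map acc2 => -[q v] [q' v'] [a [/= tr en ->]]; exists a; split=> //.
  by rewrite inE mem_cat; apply/or3P; apply: Or33; apply/mapP; exists (q, a, q').
(* What is left to do: inside [N1], finish it and then run all of [N2]; inside [N2], finish it. *)
pose I (c : nfa_seq N1 N2 * store) := match c.1 with
  | inl q => exists u, star (@nstep N1) (q, c.2) (nfa_fin N1, u) /\ acc N2 u t
  | inr q => star (@nstep N2) (q, c.2) (nfa_fin N2, t) end.
apply: (@star_rev _ _ I) => [|[q u] [q' u'] [a [/=]]]; first exact: rt1n_refl.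
rewrite inE mem_cat => /or3P[/eqP[-> -> ->] _ ->|/mapP[[[p b] p'] trp [-> -> ->]] en ->|
  /mapP[[[p b] p'] trp [-> -> ->]] en ->]; rewrite /I /=.
- by exists u; split=> //; apply: rt1n_refl.
- move=> [v [st ac]]; exists v; split=> //; apply: rt1n_trans st; by exists b.
- by move=> st; apply: rt1n_trans st; exists b.
Qed.

Definition nfa_choice (N1 N2 : nfa) : nfa :=
  @Nfa (bool + (N1 + N2))%type (inl false) (inl true)
    ([:: (inl false, Skip, inr (inl (nfa_ini N1))); (inl false, Skip, inr (inr (nfa_ini N2)));
         (inr (inl (nfa_fin N1)), Skip, inl true); (inr (inr (nfa_fin N2)), Skip, inl true)] ++
     [seq (inr (inl x.1.1), x.1.2, inr (inl x.2)) | x <- nfa_trans N1] ++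
     [seq (inr (inr x.1.1), x.1.2, inr (inr x.2)) | x <- nfa_trans N2]).

Lemma acc_choice N1 N2 s t :
  acc (nfa_choice N1 N2) s t <-> acc N1 s t \/ acc N2 s t.
Proof.
pose f1 (c : N1 * store) : nfa_choice N1 N2 * store := (inr (inl c.1), c.2).
pose f2 (c : N2 * store) : nfa_choice N1 N2 * store := (inr (inr c.1), c.2).
split=> [|[ac|ac]].
- pose I (c : nfa_choice N1 N2 * store) := match c.1 with
  | inl b => if b then c.2 = t else acc N1 c.2 t \/ acc N2 c.2 t
  | inr (inl q) => star (@nstep N1) (q, c.2) (nfa_fin N1, t)
  | inr (inr q) => star (@nstep N2) (q, c.2) (nfa_fin N2, t) end.
  apply: (@star_rev _ _ I) => [//|[q u] [q' u'] [a [/=]]].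
  rewrite !inE mem_cat.
  case/or4P => [/eqP[-> -> ->] _ ->|/eqP[-> -> ->] _ ->|/eqP[-> -> ->] _ ->|]; rewrite /I /=.
  + by left.
  + by right.
  + by move->; apply: rt1n_refl.
  case/or3P => [/eqP[-> -> ->] _ ->|/mapP[[[p b] p'] trp [-> -> ->]] en ->|
    /mapP[[[p b] p'] trp [-> -> ->]] en ->] /=; first by move->; apply: rt1n_refl.
  + by move=> st; apply: rt1n_trans st; exists b.
  + by move=> st; apply: rt1n_trans st; exists b.
- apply: rt1n_trans (f1 (nfa_ini N1, s)) _ _ _; first by exists Skip; rewrite /= !inE eqxx.
  apply: (star_trans (y := f1 (nfa_fin N1, t))); last first.
    by apply: star_step; exists Skip; rewrite /= !inE eqxx ?orbT.
  apply: star_map ac => -[q v] [q' v'] [a [/= tr en ->]]; exists a; split=> //.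
  rewrite mem_cat; apply/orP; right; rewrite mem_cat; apply/orP; left.
  by apply/mapP; exists (q, a, q').
- apply: rt1n_trans (f2 (nfa_ini N2, s)) _ _ _.
    by exists Skip; rewrite /= !inE eqxx ?orbT.
  apply: (star_trans (y := f2 (nfa_fin N2, t))); last first.
    by apply: star_step; exists Skip; rewrite /= !inE eqxx ?orbT.
  apply: star_map ac => -[q v] [q' v'] [a [/= tr en ->]]; exists a; split=> //.
  rewrite mem_cat; apply/orP; right; rewrite mem_cat; apply/orP; right.
  by apply/mapP; exists (q, a, q').
Qed.

(** The fresh state [None], both initial and final, separates the passes of [N] and permits none at
    all. *)
Definition nfa_star (N : nfa) : nfa :=
  @Nfa (option N) None None
    ((None, Skip, Some (nfa_ini N)) :: (Some (nfa_fin N), Skip, None) ::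
     [seq (Some x.1.1, x.1.2, Some x.2) | x <- nfa_trans N]).

Lemma acc_star N s t : acc (nfa_star N) s t <-> star (acc N) s t.
Proof.
split.
  pose I (c : nfa_star N * store) := match c.1 with
  | None => star (acc N) c.2 t
  | Some q => exists u, star (@nstep N) (q, c.2) (nfa_fin N, u) /\ star (acc N) u t end.
  apply: (@star_rev _ _ I) => [|[q u] [q' u'] [a [/=]]]; first exact: rt1n_refl.
  rewrite !inE => /or3P[/eqP[-> -> ->] _ ->|/eqP[-> -> ->] _ ->|/mapP[[[p b] p'] trp [-> ->
    ->]] en ->];
    rewrite /I /=.
  + by move=> [v [st1 st2]]; apply: rt1n_trans st2.
  + by move=> st; exists u; split=> //; apply: rt1n_refl.
  + by move=> [v [st1 st2]]; exists v; split=> //; apply: rt1n_trans st1; exists b.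
elim=> [u|u v w ac _]; first exact: rt1n_refl.
apply: star_trans.
pose f (c : N * store) : nfa_star N * store := (Some c.1, c.2).
apply: rt1n_trans (f (nfa_ini N, u)) _ _ _; first by exists Skip; rewrite /= !inE eqxx.
apply: (star_trans (y := f (nfa_fin N, v))); last first.
  by apply: star_step; exists Skip; rewrite /= !inE eqxx ?orbT.
apply: star_map ac => -[q x] [q' x'] [a [/= tr en ->]]; exists a; split=> //.
by rewrite !inE; apply/or3P; apply: Or33; apply/mapP; exists (q, a, q').
Qed.

End Semantics.

Lemma updE s r v k : upd s r v k = if k == r then v else s k.
Proof. by []. Qed.

Lemma upd_id s r : upd s r (s r) = s.
Proof. by apply: funext => k; rewrite updE; case: eqP => // ->. Qed.

Lemma updK s r v w : upd (upd s r v) r w = upd s r w.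
Proof. by apply: funext => k; rewrite !updE; case: eqP. Qed.

Definition clean n (s : store) := forall r, n <= r -> s r = 0.

Lemma cleanS n m s : n <= m -> clean n s -> clean m s.
Proof. by move=> nm cl r mr; apply: cl; apply: leq_trans mr. Qed.

Lemma clean_upd n s r v : clean n s -> r < n -> clean n (upd s r v).
Proof. by move=> cl rn k nk; rewrite updE cl //; case: eqP => // kr; lia. Qed.

Section Programs.
Variable X : nat -> bool.

(* The registers from n on are scratch space, empty when the program starts. *)
Definition program n (R : store -> store -> Prop) :=
  exists N, forall j s t, clean n s -> (acc X j N s t <-> R s t).

Lemma program_ext n R R' :
  (forall s t, clean n s -> (R s t <-> R' s t)) -> program n R -> program n R'.
Proof. by move=> RR' [N NP]; exists N => j s t cl; rewrite NP // RR'. Qed.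

Lemma program_sub n m R : n <= m -> program m R -> program n R.
Proof. by move=> nm [N NP]; exists N => j s t cl; apply: NP; apply: cleanS cl. Qed.

Definition preserves n (R : store -> store -> Prop) :=
  forall s t, clean n s -> R s t -> clean n t.

Lemma program_seq n R1 R2 : program n R1 -> preserves n R1 -> program n R2 ->
  program n (fun s t => exists u, R1 s u /\ R2 u t).
Proof.
move=> [N1 NP1] pr [N2 NP2]; exists (nfa_seq N1 N2) => j s t cl; rewrite acc_seq.
split=> -[u [h1 h2]]; exists u.
  have h1' := iffLR (NP1 j s u cl) h1.
  by split=> //; apply: iffLR (NP2 j u t (pr _ _ cl h1')) h2.
by split; [apply/NP1 | apply/NP2 => //; apply: pr h1].
Qed.

Lemma program_choice n R1 R2 : program n R1 -> program n R2 -> program n (fun s t =>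
  R1 s t \/ R2 s t).
Proof.
move=> [N1 NP1] [N2 NP2]; exists (nfa_choice N1 N2) => j s t cl.
by rewrite acc_choice NP1 // NP2.
Qed.

Lemma preserves_star n R : preserves n R -> preserves n (fun s t => star R s t).
Proof. by move=> pr s t cl st; elim: st cl => // a b c /pr Rab _ IH /Rab/IH. Qed.

Lemma program_star n R : program n R -> preserves n R -> program n (fun s t => star R s t).
Proof.
move=> [N NP] pr; exists (nfa_star N) => j s t cl; rewrite acc_star.
split=> st; elim: st cl => [u|u v w h _ IH] cl; try exact: rt1n_refl.
  by have /NP h' := h; apply: rt1n_trans (h' cl) (IH _); apply: pr (h' cl).
by apply: rt1n_trans (IH _); [apply/NP | apply: pr h].
Qed.

Lemma program_inc n r : program n (fun s t => t = upd s r (s r).+1).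
Proof. by exists (nfa_act (Inc r)) => j s t _; rewrite acc_act /=; split=> [[]|]. Qed.

Lemma program_dec n r : program n (fun s t => 0 < s r /\ t = upd s r (s r).-1).
Proof. by exists (nfa_act (Dec r)) => j s t _; rewrite acc_act. Qed.

(** A test may guess and count in scratch registers but has to restore the store, so tests can be
    chained as conjuncts and used inside loops. *)
Definition test n (P : store -> Prop) := program n (fun s t => P s /\ t = s).

Lemma preserves_test n P : preserves n (fun s t => P s /\ t = s).
Proof. by move=> s t cl [_ ->]. Qed.

Lemma test_ext n P Q : (forall s, clean n s -> (P s <-> Q s)) -> test n P -> test n Q.
Proof. by move=> PQ; apply: program_ext => s t cl; rewrite PQ. Qed.

Lemma test_zero n r : test n (fun s => s r = 0).
Proof.
exists (nfa_act (Zero r)) => j s t _; rewrite acc_act /=.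
by split=> -[/eqP ? ->].
Qed.

Lemma test_query1 n b : test n (fun s => X (s 1) = b).
Proof.
exists (nfa_act (Query b)) => j s t _; rewrite acc_act /=.
by split=> -[/eqP ? ->].
Qed.

Lemma test_true n : test n (fun=> True).
Proof. by exists (nfa_act Skip) => j s t _; rewrite acc_act; split=> -[]. Qed.

Lemma test_and n P Q : test n P -> test n Q -> test n (fun s => P s /\ Q s).
Proof.
move=> hP hQ; apply: program_ext (program_seq hP (@preserves_test _ _) hQ) => s t _.
by split=> [[u [[? ->] [? ->]]]|[[? ?] ->]] //; exists s.
Qed.

Lemma test_or n P Q : test n P -> test n Q -> test n (fun s => P s \/ Q s).
Proof.
move=> hP hQ; apply: program_ext (program_choice hP hQ) => s t _.
by split=> [[[? ->]|[? ->]]|[[?|?] ->]]; auto.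
Qed.

Lemma preserves_havoc n r : r < n -> preserves n (fun s t => exists v, t = upd s r v).
Proof. by move=> rn s t cl [v ->]; apply: clean_upd. Qed.

(** Unbounded guessing is an iterated choice between incrementing and decrementing: every value is
    reached by emptying the register and then counting up. *)
Lemma program_havoc n r : r < n -> program n (fun s t => exists v, t = upd s r v).
Proof.
move=> rn; pose R s t := t = upd s r (s r).+1 \/ 0 < s r /\ t = upd s r (s r).-1.
have pr : preserves n R by move=> s t cl [->|[_ ->]]; apply: clean_upd.
apply: program_ext (program_star (program_choice (program_inc n r) (program_dec n r)) pr) => s t _;
  split.
  elim=> [u|u v w [->|[_ ->]] _ [x ->]]; first by exists (u r); rewrite upd_id.
    by exists x; rewrite updK.
  by exists x; rewrite updK.
have down : star R s (upd s r 0).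
  move: (upd_id s r); move: {1}(s r) => k; elim: k s => [|k IH] s.
    by move=> {1}<-; exact: rt1n_refl.
  move=> E; apply: (@rt1n_trans _ _ _ (upd s r k)).
    by right; rewrite -E !updE eqxx /= updK.
  by rewrite -[upd s r 0](updK _ _ k); apply: IH; rewrite updK.
move=> [v ->]; apply: star_trans down _; elim: v => [|v IH]; first exact: rt1n_refl.
apply: star_trans IH _; apply: star_step; left.
by rewrite updE eqxx updK.
Qed.

Lemma program_clear n r : r < n -> program n (fun s t => t = upd s r 0).
Proof.
move=> rn; apply: program_ext (program_seq (program_havoc rn) (preserves_havoc rn) (test_zero n r))
  => s t _.
split=> [[u [[v ->]]]|->]; first by rewrite updE eqxx => -[-> ->].
by exists (upd s r 0); split; [exists 0 | rewrite updE eqxx].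
Qed.

(** The witness is guessed in the first scratch register [n]; clearing it afterwards restores the
    store because that register was empty at the start. *)
Lemma test_ex n P : test n.+1 P -> test n (fun s => exists v, P (upd s n v)).
Proof.
move=> hP; have hn := ltnSn n.
have h := program_seq (program_havoc hn) (preserves_havoc hn)
  (program_seq hP (@preserves_test _ _) (program_clear hn)).
apply: program_ext (program_sub (leqnSn n) h) => s t cl; split.
  move=> [u [[v ->] [w [[Pu ->] ->]]]]; split; first by exists v.
  by rewrite updK -[in RHS](upd_id s n) cl.
move=> [[v Pv] ->]; exists (upd s n v); split; first by exists v.
by exists (upd s n v); split=> //; rewrite updK -[in LHS](upd_id s n) cl.
Qed.

Section EqTest.
Variables (n i j : nat).
Hypotheses (ltin : i < n) (ltjn : j < n) (neij : i != j).

Let nein : (i == n) = false. Proof. lia. Qed.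
Let nejn : (j == n) = false. Proof. lia. Qed.
Let neni : (n == i) = false. Proof. lia. Qed.
Let nenj : (n == j) = false. Proof. lia. Qed.
Let neji : (j == i) = false. Proof. lia. Qed.

Let set3 s a b c := upd (upd (upd s i a) j b) n c.

Let set3E s a b c : (set3 s a b c i = a) * (set3 s a b c j = b) * (set3 s a b c n = c).
Proof.
by rewrite /set3 !updE !eqxx (negbTE neij) nein nejn.
Qed.

Let set3_set3 s a b c a' b' c' : set3 (set3 s a b c) a' b' c' = set3 s a' b' c'.
Proof. by apply: funext => k; rewrite /set3 !updE; do !case: eqP. Qed.

Let set3_id s : set3 s (s i) (s j) (s n) = s.
Proof. by apply: funext => k; rewrite /set3 !updE; do !case: eqP => [->|]. Qed.

Let clean_set3 s a b c : clean n.+1 s -> clean n.+1 (set3 s a b c).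
Proof. by move=> cl; do ?(apply: clean_upd; last by lia). Qed.

Let down s t := 0 < s i /\ 0 < s j /\ t = set3 s (s i).-1 (s j).-1 (s n).+1.
Let up s t := 0 < s n /\ t = set3 s (s i).+1 (s j).+1 (s n).-1.

Let presdown : preserves n.+1 down.
Proof. by move=> s t cl [_ [_ ->]]; apply: clean_set3. Qed.
Let presup : preserves n.+1 up.
Proof. by move=> s t cl [_ ->]; apply: clean_set3. Qed.

Let prgdown : program n.+1 down.
Proof.
have h : program n.+1 (fun s t => exists u, (0 < s i /\ u = upd s i (s i).-1) /\
  exists v, (0 < u j /\ v = upd u j (u j).-1) /\ t = upd v n (v n).+1).
  apply: program_seq (program_dec _ _) _ _; first by move=> s t cl [_ ->]; apply: clean_upd => //;
    lia.
  apply: program_seq (program_dec _ _) _ (program_inc _ _).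
  by move=> s t cl [_ ->]; apply: clean_upd => //; lia.
apply: program_ext h => s t cl; split.
  move=> [u [[si ->] [v [[]]]]]; rewrite updE neji => sj -> ->.
  by rewrite /down; split=> //; split=> //; rewrite ?updE ?neji ?nenj ?neni.
move=> [si [sj ->]]; exists (upd s i (s i).-1); split=> //.
by eexists; split; [split; [rewrite updE neji|reflexivity]|rewrite ?updE ?neji ?nenj ?neni].
Qed.

Let prgup : program n.+1 up.
Proof.
have h : program n.+1 (fun s t => exists u, u = upd s i (s i).+1 /\
  exists v, v = upd u j (u j).+1 /\ (0 < v n /\ t = upd v n (v n).-1)).
  apply: program_seq (program_inc _ _) _ _; first by move=> s t cl ->; apply: clean_upd => //; lia.
  apply: program_seq (program_inc _ _) _ (program_dec _ _).
  by move=> s t cl ->; apply: clean_upd => //; lia.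
apply: program_ext h => s t cl; split.
  by move=> [u [-> [v [-> []]]]]; rewrite !updE neji nenj neni => sn ->.
move=> [sn ->]; eexists; split; first reflexivity.
by eexists; split; [reflexivity|rewrite !updE neji nenj neni].
Qed.

Let star_down s t : star down s t ->
  [/\ s i + s n = t i + t n, s j + s n = t j + t n & t = set3 s (t i) (t j) (t n)].
Proof.
elim=> [u|u v w [ui [uj ->]] _ []]; first by rewrite set3_id.
by rewrite !set3E set3_set3 => e1 e2 ->; rewrite !set3E; split=> //; lia.
Qed.

Let star_up s t : star up s t ->
  [/\ s i + s n = t i + t n, s j + s n = t j + t n & t = set3 s (t i) (t j) (t n)].
Proof.
elim=> [u|u v w [un ->] _ []]; first by rewrite set3_id.
by rewrite !set3E set3_set3 => e1 e2 ->; rewrite !set3E; split=> //; lia.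
Qed.

(** Both registers are counted down in step while register [n] counts the rounds, both are tested
    for zero, and [up] restores them. The loops may stop anywhere; the zero tests discard the runs
    that stopped at the wrong place. *)
Lemma test_eq_neq : test n (fun s => s i = s j).
Proof.
have h := program_seq (program_star prgdown presdown) (preserves_star presdown)
  (program_seq (test_zero n.+1 i) (@preserves_test _ _) (program_seq (test_zero n.+1 j)
    (@preserves_test _ _)
  (program_seq (program_star prgup presup) (preserves_star presup) (test_zero n.+1 n)))).
apply: program_ext (program_sub (leqnSn n) h) => s t cl; split.
  move=> [u [/star_down[e1 e2 eu] [_ [[ui ->] [_ [[uj ->] [v [/star_up[e3 e4 ev] [vn ->]]]]]]]]].
  split; first by lia.
  have sn : s n = 0 by apply: cl.
  rewrite ev vn eu set3_set3 -[RHS]set3_id sn; congr set3; lia.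
move=> [sij ->].
have sn : s n = 0 by apply: cl.
have sE : set3 s (s i) (s i) 0 = s by rewrite -sn {2}sij set3_id.
exists (set3 s 0 0 (s i)); split.
  suff d k c : star down (set3 s k k c) (set3 s 0 0 (k + c)).
    by move: (d (s i) 0); rewrite addn0 sE.
  elim: k c => [|k IH] c; first exact: rt1n_refl.
  rewrite addSnnS; apply: rt1n_trans (IH c.+1).
  by split; [|split]; rewrite ?set3E // set3_set3.
exists (set3 s 0 0 (s i)); split; first by rewrite set3E.
exists (set3 s 0 0 (s i)); split; first by rewrite set3E.
exists s; split; last by split=> //.
suff d k c : star up (set3 s c c k) (set3 s (k + c) (k + c) 0).
  by move: (d (s i) 0); rewrite addn0 sE.
elim: k c => [|k IH] c; first exact: rt1n_refl.
rewrite addSnnS; apply: rt1n_trans (IH c.+1).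
by split; rewrite ?set3E // set3_set3.
Qed.

End EqTest.

Lemma test_eq n i j : i < n -> j < n -> test n (fun s => s i = s j).
Proof.
move=> ltin ltjn; case: (eqVneq i j) => [->|]; last exact: test_eq_neq.
by apply: test_ext (test_true n).
Qed.

Lemma test_succ n i j : i < n -> j < n -> test n (fun s => s j = (s i).+1).
Proof.
move=> ltin ltjn; have hn := ltnSn n.
have cli : preserves n.+1 (fun s t => t = upd s n (s n).+1).
  by move=> s t cl ->; apply: clean_upd.
have h : program n.+1 (fun s t => exists u, (exists v, u = upd s n v) /\ 
  exists v : store, (u n = u i /\ v = u) /\ exists w : store, w = upd v n (v n).+1 /\
  exists x : store, (w n = w j /\ x = w) /\ t = upd x n 0).
  apply: program_seq (program_havoc hn) (preserves_havoc hn) _.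
  refine (program_seq (test_eq (n:=n.+1) hn (ltnW ltin)) (@preserves_test _ _) _).
  apply: program_seq (program_inc _ _) cli _.
  exact: program_seq (test_eq (n:=n.+1) hn (ltnW ltjn)) (@preserves_test _ _) (program_clear hn).
have nni : (i == n) = false by lia.
have nnj : (j == n) = false by lia.
apply: program_ext (program_sub (leqnSn n) h) => s t cl; split.
  move=> [u [[v ->] [_ [[e1 ->] [w [-> [x [[e2 ->] ->]]]]]]]].
  move: e1 e2; rewrite !updE !eqxx nni nnj => -> <-; split=> //.
  by rewrite !updK -[RHS](upd_id s n) cl.
move=> [e ->]; exists (upd s n (s i)); split; first by exists (s i).
exists (upd s n (s i)); split; first by rewrite !updE eqxx nni.
exists (upd s n (s i).+1); rewrite !updE eqxx updK; split=> //.
exists (upd s n (s i).+1); rewrite ?updE ?eqxx nnj updK; split=> //.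
by rewrite -[LHS](upd_id s n) cl.
Qed.

Definition set_block (s : store) (r : nat) (x : nat * nat * nat) : store :=
  upd (upd (upd s r x.1.1) r.+1 x.1.2) r.+2 x.2.

Lemma set_blockE s r x k : set_block s r x k =
  if k == r then x.1.1 else if k == r.+1 then x.1.2 else if k == r.+2 then x.2 else s k.
Proof. by rewrite /set_block !updE; do !case: eqP; lia. Qed.

Lemma set_blockK s r x y : set_block (set_block s r x) r y = set_block s r y.
Proof. by apply: funext => k; rewrite !set_blockE; do !case: eqP. Qed.

Lemma clean_block n s r x : clean n s -> r.+2 < n -> clean n (set_block s r x).
Proof. by move=> cl rn; do !(apply: clean_upd; last by lia). Qed.

Lemma program_block n r : r.+2 < n -> program n (fun s t => exists x, t = set_block s r x).
Proof.
move=> rn.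
have r0 : r < n by lia. have r1 : r.+1 < n by lia.
have h := program_seq (program_havoc r0) (preserves_havoc r0)
  (program_seq (program_havoc r1) (preserves_havoc r1) (program_havoc rn)).
apply: program_ext h => s t cl; split.
  by move=> [u [[x ->] [v [[y ->] [z ->]]]]]; exists (x, y, z).
move=> [[[x y] z] ->]; eexists; split; first by exists x.
by eexists; split; [exists y | exists z].
Qed.

Lemma preserves_block n r : r.+2 < n -> preserves n (fun s t => exists x, t = set_block s r x).
Proof. by move=> rn s t cl [x ->]; apply: clean_block. Qed.

Lemma set_block0 n s r : clean n s -> n <= r -> set_block s r (0, 0, 0) = s.
Proof.
move=> cl nr; apply: funext => k; rewrite set_blockE /=.
by do !case: eqP => [->|_] //; rewrite cl //; lia.
Qed.

Lemma program_clear_block n r : r.+2 < n -> program n (fun s t => t = set_block s r (0, 0, 0)).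
Proof.
move=> rn; have h := program_seq (program_block rn) (preserves_block rn)
  (test_and (test_zero n r) (test_and (test_zero n r.+1) (test_zero n r.+2))).
apply: program_ext h => s t cl; split.
  move=> [u [[x ->]]]; rewrite !set_blockE !eqxx !ifF; try lia.
  by move=> [[x1 [x2 x3]] ->]; case: x x1 x2 x3 => -[x y] z /= -> -> ->.
move=> ->; exists (set_block s r (0, 0, 0)); split; first by exists (0,0,0).
by rewrite !set_blockE /=; do !case: eqP => [_|?]; split=> //; lia.
Qed.

(* Reachability under a relation between triples of numbers; the triples are held in the
   registers n, n+1, n+2, and a candidate successor is guessed in n+3, n+4, n+5. *)
Lemma test_reach n (P0 P1 Q : store -> Prop) :
  test n.+3 P0 -> test (n + 6) Q -> test n.+3 P1 ->
  test n (fun s => exists x y, [/\ P0 (set_block s n x),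
    star (fun x y => Q (set_block (set_block s n x) n.+3 y)) x y & P1 (set_block s n y)]).
Proof.
move=> h0 hQ h1.
pose R s t := exists y, Q (set_block s n.+3 y) /\ t = set_block s n y.
have pR : preserves n.+3 R by move=> s t cl [y [_ ->]]; apply: clean_block.
have hR : program n.+3 R.
  have l3 : n.+3.+2 < n + 6 by lia.
  have l0 : n.+2 < n + 6 by lia.
  have l1 : n < n + 6 by lia. have l2 : n.+1 < n + 6 by lia.
  have l4 : n.+3 < n + 6 by lia. have l5 : n.+4 < n + 6 by lia.
  (* One round of the loop: guess a successor, check [Q], copy the successor over the current triple
     by guessing and comparing, and clear the candidate block. *)
  have := program_seq (program_block l3) (preserves_block l3) (program_seq hQ (@preserves_test _ _)
   (program_seq (program_block l0) (preserves_block l0) (program_seq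
   (test_and (test_eq l1 l4) (test_and (test_eq l2 l5) (test_eq l0 l3)))
   (@preserves_test _ _) (program_clear_block l3)))).
  have l : n.+3 <= n + 6 by lia.
  move=> h; apply: program_ext (program_sub l h) => s t cl; split.
    move=> [u [[y ->] [_ [[Qy ->] [w [[z ->] [v [[e ->] ->]]]]]]]].
    exists y; split=> //; rewrite (_ : z = y); last first.
      move: e; rewrite !set_blockE !eqxx !ifF; try lia.
      by case: z y {Qy} => -[? ?] ? -[[? ?] ?] /= [-> [-> ->]].
    apply: funext => k; rewrite !set_blockE; do !case: eqP => ?; try lia.
    - by rewrite cl //; lia.
    - by rewrite cl //; lia.
    - by rewrite cl //; lia.
  move=> [y [Qy ->]]; eexists; split; first by exists y.
  eexists; split; first by split; [exact: Qy|reflexivity].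
  eexists; split; first by exists y.
  eexists; split.
    split; last reflexivity.
    by rewrite !set_blockE !eqxx !ifF; lia.
  apply: funext => k; rewrite !set_blockE; do !case: eqP => ?; try lia.
  - by rewrite cl //; lia.
  - by rewrite cl //; lia.
  - by rewrite cl //; lia.
have l0 : n.+2 < n.+3 by [].
have h := program_seq (program_block l0) (preserves_block l0) (program_seq h0 (@preserves_test _ _)
  (program_seq (program_star hR pR) (preserves_star pR) (program_seq h1 (@preserves_test _ _)
  (program_clear_block l0)))).
have l : n <= n.+3 by lia.
apply: program_ext (program_sub l h) => s t cl; split.
  move=> [_ [[x ->] [_ [[Px ->] [u [st [_ [[Pu ->] ->]]]]]]]].
  suff [y ey sty] : exists2 y, u = set_block s n y &
      star (fun x y => Q (set_block (set_block s n x) n.+3 y)) x y.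
    split; last by rewrite ey set_blockK (set_block0 cl).
    by exists x, y; split=> //; rewrite -ey.
  move: (erefl (set_block s n x)) st; move: {1 3}(set_block s n x) => v ev st.
  elim: st x {Px} ev => {Pu u v h} [v|v w u [y [Qy ->]] _ IH] x ev.
    by exists x => //; exact: rt1n_refl.
  have [|y' -> st] := IH y; first by rewrite ev set_blockK.
  by exists y' => //; apply: rt1n_trans st; rewrite -ev.
move=> [[x [y [Px st Py]]] ->].
exists (set_block s n x); split; first by exists x.
exists (set_block s n x); split=> //.
exists (set_block s n y); split; last first.
  by exists (set_block s n y); split=> //; rewrite set_blockK (set_block0 cl).
elim: st {Px Py} => [z|a b c Qab _]; first exact: rt1n_refl.
apply: rt1n_trans; exists b; split=> //; by rewrite set_blockK.
Qed.

End Programs.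

(** * Pairing and definable predicates *)

Definition cpair (a b : nat) : nat := 'C((a + b).+1, 2) + a.

(** [cpair] is the Cantor pairing, a triangular number plus an offset. This recurrence and
    [cpair_wrap] list all pairs in the order of their codes, along each antidiagonal and then to the
    start of the next, so that successor steps alone generate the graph. *)
Lemma cpair_incr a b : cpair a.+1 b = (cpair a b.+1).+1.
Proof. by rewrite /cpair addnS addSnnS. Qed.

Lemma cpair_wrap a : cpair 0 a.+1 = (cpair a 0).+1.
Proof. by rewrite /cpair add0n !addn0 binS bin1 addnS. Qed.

(** The code lies between two consecutive triangular numbers, which determines the antidiagonal
    [a + b]. *)
Lemma cpair_inj a b a' b' : cpair a b = cpair a' b' -> a = a' /\ b = b'.
Proof.
have bound x y : 'C((x + y).+1, 2) <= cpair x y < 'C((x + y).+2, 2).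
  by rewrite /cpair leq_addr [X in _ < X]binS bin1 ltn_add2l ltnS leq_addr.
move=> e; have := bound a b; have := bound a' b'; rewrite e => /andP[l1 l2] /andP[l3 l4].
have ss : a + b = a' + b'.
  case: (ltngtP (a + b) (a' + b')) => // lt.
    by have := leq_bin2l 2 (lt : (a + b).+2 <= (a' + b').+1); lia.
  by have := leq_bin2l 2 (lt : (a' + b').+2 <= (a + b).+1); lia.
by move: e; rewrite /cpair ss; lia.
Qed.

Section Relations.
Variable X : nat -> bool.
Local Notation test := (test X).

(** Only register 1 can be queried: its value is saved in scratch register [n], the content of [i]
    is loaded by guessing and comparing, and the old value is put back in the same way. *)
Lemma test_query n i b : 1 < n -> i < n -> test n (fun s => X (s i) = b).
Proof.
move=> lt1n; case: (eqVneq i 1) => [->|ni1] ltin; first exact: test_query1.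
have hn := ltnSn n; have l1 : 1 < n.+1 by lia.
have ln1 := test_eq X hn l1; have l1i := test_eq X l1 (ltnW ltin).
have pt := @preserves_test n.+1.
have h := program_seq (program_havoc X hn) (preserves_havoc hn) (program_seq ln1 (pt _)
  (program_seq (program_havoc X l1) (preserves_havoc l1) (program_seq l1i (pt _)
  (program_seq (test_query1 X n.+1 b) (pt _) (program_seq (program_havoc X l1) (preserves_havoc l1)
  (program_seq ln1 (pt _) (program_clear X hn))))))).
have n1 : (1 == n) = false by lia. have nn1 : (n == 1) = false by lia.
have ni : (i == n) = false by lia.
apply: program_ext (program_sub (leqnSn n) h) => s t cl; split.
  move=> [_ [[v ->] [_ [[e1 ->] [_ [[w ->] [_ [[e2 ->] [_ [[e3 ->] [_ [[x ->] [_ [[e4 ->]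
    ->]]]]]]]]]]]]]].
  move: e1 e2 e3 e4; rewrite !updE !eqxx n1 nn1 ni (negbTE ni1) => -> -> e <-; split=> //.
  apply: funext => k; rewrite !updE; case: eqP => [->|_]; first by rewrite cl.
  by case: eqP => [->|].
move=> [e ->]; eexists; split; first by exists (s 1).
eexists; split; first by split; [rewrite !updE eqxx n1|reflexivity].
eexists; split; first by exists (s i).
eexists; split; first by split; [rewrite !updE eqxx (negbTE ni1) ni|reflexivity].
eexists; split; first by split; [rewrite !updE eqxx|reflexivity].
eexists; split; first by exists (s 1).
eexists; split; first by split; [rewrite !updE !eqxx nn1|reflexivity].
apply: funext => k; rewrite !updE; case: eqP => [->|_]; first by rewrite cl.
by case: eqP => [->|].
Qed.

(** A triple (a, b, c) is reachable from (0, 0, 0) under the walk through the antidiagonals exactly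
    when c is the code of (a, b); this walk is why loops carry three numbers. *)
Lemma test_cpair n i j k : i < n -> j < n -> k < n -> test n (fun s => s k = cpair (s i) (s j)).
Proof.
move=> li lj lk.
have lt m : m < 6 -> n + m < n + 6 by lia.
have lt3 m : m < 3 -> n + m < n.+3 by lia.
have [li3 lj3 lk3] : [/\ i < n.+3, j < n.+3 & k < n.+3] by split; lia.
have h := test_reach
  (test_and (test_zero X n.+3 n) (test_and (test_zero X n.+3 n.+1) (test_zero X n.+3 n.+2)))
  (test_and (test_succ X (lt 2 isT) (lt 5 isT))
    (test_or (test_and (test_succ X (lt 4 isT) (lt 1 isT)) (test_succ X (lt 0 isT) (lt 3 isT)))
       (test_and (test_zero X (n + 6) (n + 1)) (test_and (test_zero X (n + 6) (n + 3)) (test_succ X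
         (lt 0 isT) (lt 4 isT))))))
  (test_and (test_eq X (lt3 0 isT) li3) (test_and (test_eq X (lt3 1 isT) lj3) (test_eq X (lt3 2
    isT) lk3))).
pose R (x y : nat * nat * nat) := y.2 = x.2.+1 /\
  (x.1.2 = y.1.2.+1 /\ y.1.1 = x.1.1.+1 \/ x.1.2 = 0 /\ y.1.1 = 0 /\ y.1.2 = x.1.1.+1).
apply: test_ext h => s cl.
rewrite !addn0 !addnS !addn0.
have B0 t r x : set_block t r x r = x.1.1 by rewrite set_blockE eqxx.
have B1 t r x : set_block t r x r.+1 = x.1.2 by rewrite set_blockE; do ![case: eqP; try lia].
have B2 t r x : set_block t r x r.+2 = x.2 by rewrite set_blockE; do ![case: eqP; try lia].
have Bf t r x m : (m < r) || (r.+2 < m) -> set_block t r x m = t m.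
  by rewrite set_blockE; do ![case: eqP; try lia].
split=> [[x [y [[+ []]]]]|e]; rewrite ?B0 ?B1 ?B2.
  move=> x1 x2 x3 st; rewrite !Bf; try lia.
  have {}st : star R x y.
    apply: (star_map (f := id)) st => a b.
    by rewrite /R !B0 !B1 !B2 !(Bf _ n.+3) ?B0 ?B1 ?B2; lia.
  have -> : y.2 = cpair y.1.1 y.1.2; last by move=> [-> [-> ->]].
  have : x.2 = cpair x.1.1 x.1.2 by rewrite x1 x2 x3.
  elim: st {x1 x2 x3} => // a b c [e1 ab] _ IH e; apply: IH; rewrite e1 e.
  case: ab => [[-> ->]|[-> [-> ->]]]; first by rewrite cpair_incr.
  by rewrite cpair_wrap.
exists (0, 0, 0), (s i, s j, s k); rewrite ?B0 ?B1 ?B2 !Bf; try lia.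
split=> //; suff st : star R (0, 0, 0) (s i, s j, s k).
  apply: (star_map (f := id)) st => a b.
  by rewrite /R !B0 !B1 !B2 !(Bf _ n.+3) ?B0 ?B1 ?B2; lia.
rewrite e; move: (s i) (s j) => {e} a b.
move: {2}(cpair a b) (erefl (cpair a b)) => z; elim: z a b => [|z IH] a b e.
  have [-> ->] : a = 0 /\ b = 0.
    by apply: cpair_inj; rewrite e.
  exact: rt1n_refl.
have [[a' b'] e' Rab] : exists2 x, z = cpair x.1 x.2 & R (x, z) (a, b, z.+1).
  case: a e => [|a] e; last first.
    by exists (a, b.+1); [move: e; rewrite cpair_incr => -[] | split=> //; left].
  case: b e => [//|b] e; exists (b, 0); first by move: e; rewrite cpair_wrap => -[].
  by split=> //; right.
by rewrite e; apply: star_trans (star_step Rab); rewrite e'; apply: IH.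
Qed.

(* Predicates on environments; the polymorphism in the registers [idx] holding the
   variables makes substitution immediate. *)
Definition definable k (P : seq nat -> Prop) :=
  forall n idx, size idx = k -> all (fun i => 1 < i < n) idx -> 1 < n ->
    test n (fun s => P [seq s i | i <- idx]).

Definition isvar k (a : seq nat -> nat) := exists2 i, i < k & a =1 nth 0 ^~ i.

Lemma isvarP k a n idx : isvar k a -> size idx = k -> all (fun i => 1 < i < n) idx ->
  exists2 i, 1 < i < n & forall s : store, a [seq s i | i <- idx] = s i.
Proof.
move=> [i ltik aE] si /allP al; exists (nth 0 idx i).
  by apply: al; apply: mem_nth; rewrite si.
by move=> s; rewrite aE (nth_map 0) // si.
Qed.

Lemma definable_ext k P Q : (forall e, P e <-> Q e) -> definable k P -> definable k Q.
Proof. by move=> PQ h n idx si al l1; apply: test_ext (h n idx si al l1) => s _; apply: PQ. Qed.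

Lemma definable_and k P Q : definable k P -> definable k Q -> definable k (fun e => P e /\ Q e).
Proof. by move=> hP hQ n idx si al l1; apply: test_and; [apply: hP|apply: hQ]. Qed.

Lemma definable_or k P Q : definable k P -> definable k Q -> definable k (fun e => P e \/ Q e).
Proof. by move=> hP hQ n idx si al l1; apply: test_or; [apply: hP|apply: hQ]. Qed.

Lemma definable_true k : definable k (fun=> True).
Proof. by move=> n idx _ _ _; apply: test_true. Qed.

Lemma map_upd s n v idx : all (fun i => 1 < i < n) idx ->
  [seq upd s n v i | i <- idx] = [seq s i | i <- idx].
Proof. by move=> /allP al; apply/eq_in_map => i /al; rewrite updE; case: eqP => //; lia. Qed.

Lemma definable_ex k (P : seq nat -> nat -> Prop) : definable k.+1 (fun e =>
  P (behead e) (head 0 e)) ->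
  definable k (fun e => exists v, P e v).
Proof.
move=> h n idx si al l1.
have al' : all (fun i => 1 < i < n.+1) (n :: idx).
  by rewrite /= l1 ltnSn; apply: sub_all al => i; lia.
have := h n.+1 (n :: idx) (congr1 S si) al' (ltnW l1).
move/test_ex; apply: test_ext => s _; split=> -[v Pv]; exists v; move: Pv;
  by rewrite /= updE eqxx map_upd.
Qed.

Lemma definable_zero k a : isvar k a -> definable k (fun e => a e = 0).
Proof.
move=> va n idx si al l1; have [i li aE] := isvarP va si al.
by apply: test_ext (test_zero X n i) => s _; rewrite aE.
Qed.

Lemma definable_query k a b : isvar k a -> definable k (fun e => X (a e) = b).
Proof.
move=> va n idx si al l1; have [i li aE] := isvarP va si al.
by apply: test_ext (@test_query n i b _ _) => // [s _|]; [rewrite aE | lia].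
Qed.

Lemma definable_succ k a b : isvar k a -> isvar k b -> definable k (fun e => b e = (a e).+1).
Proof.
move=> va vb n idx si al l1; have [i li aE] := isvarP va si al.
have [j lj bE] := isvarP vb si al.
by apply: test_ext (@test_succ X n i j _ _) => [s _||]; [rewrite aE bE | lia | lia].
Qed.

Lemma definable_cpair k a b c : isvar k a -> isvar k b -> isvar k c ->
  definable k (fun e => c e = cpair (a e) (b e)).
Proof.
move=> va vb vc n idx si al l1; have [i li aE] := isvarP va si al.
have [j lj bE] := isvarP vb si al; have [m lm cE] := isvarP vc si al.
by apply: test_ext (@test_cpair n i j m _ _ _) => [s _|||]; [rewrite aE bE cE | lia | lia | lia].
Qed.

(** The loop of [test_reach] works on triples; here only the first components matter and the other
    two are arbitrary. *)
Lemma definable_reach k a b (R : seq nat -> nat -> nat -> Prop) : isvar k a -> isvar k b ->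
  definable k.+2 (fun e => R (behead (behead e)) (head 0 (behead e)) (head 0 e)) ->
  definable k (fun e => star (R e) (a e) (b e)).
Proof.
move=> va vb hR n idx si al l1; have [i li aE] := isvarP va si al.
have [j lj bE] := isvarP vb si al.
have al' : all (fun i => 1 < i < n + 6) (n + 3 :: n :: idx).
  apply/andP; split; first by lia.
  apply/andP; split; first by lia.
  by apply: sub_all al => m; lia.
have l6 : 1 < n + 6 by lia.
have hr := hR (n + 6) (n + 3 :: n :: idx) (congr1 (fun m => m.+2) si) al' l6.
have l0 : n < n.+3 by lia. have l3i : i < n.+3 by lia. have l3j : j < n.+3 by lia.
have h := test_reach (test_eq X l0 l3i) hr (test_eq X l0 l3j).
apply: test_ext h => s cl.
have B0 t r x : set_block t r x r = x.1.1 by rewrite set_blockE eqxx.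
have Bf t r x m : (m < r) || (r.+2 < m) -> set_block t r x m = t m.
  by rewrite set_blockE; do ![case: eqP; try lia].
have Bm t r x : n <= r -> [seq set_block t r x i | i <- idx] = [seq t i | i <- idx].
  by move=> lr; apply/eq_in_map => m /(allP al) lm; rewrite Bf //; lia.
split=> [[x [y [+ st +]]]|st].
  rewrite !B0 !Bf; try lia; rewrite aE bE => <- <-.
  apply: (star_map (f := fun x => x.1.1)) st => u v.
  by rewrite /= !addn3 !Bm; try lia; rewrite !B0 (Bf _ n.+3); try lia; rewrite B0.
exists (s i, 0, 0), (s j, 0, 0); rewrite !B0 !Bf; try lia; split=> //.
rewrite aE bE in st.
apply: (star_map (f := fun x : nat => (x, 0, 0))) st => u v.
by rewrite /= !addn3 !Bm; try lia; rewrite !B0 (Bf _ n.+3); try lia; rewrite B0.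
Qed.

Definition definable1 (p : nat -> Prop) := definable 1 (fun e => p (head 0 e)).

Lemma definable_subst k p a : definable1 p -> isvar k a -> definable k (fun e => p (a e)).
Proof.
move=> hp va n idx si al l1; have [i li aE] := isvarP va si al.
have al1 : all (fun i => 1 < i < n) [:: i] by rewrite /= li.
by apply: test_ext (hp n [:: i] erefl al1 l1) => s _; rewrite aE.
Qed.

End Relations.

(** * Simulation of counter programs by oracle machines *)

(** The input is on a tape and not in a register, so its value is guessed as [v] in register 2 and
    verified: the input head is placed at [v], which must be a one unless [v = 0], and then at
    [v + 1], which must be blank. *)
Lemma definable1_nfa X p : definable1 X p -> exists N : nfa, forall j, (exists t, acc X j N (fun=>
  0) t) <-> p j.
Proof.
move=> hp.
have l0 : 0 < 3 by []. have l2 : 2 < 3 by [].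
have hp3 := hp 3 [:: 2] erefl isT isT.
have [Np hNp] := hp3.
have [N2 hN2] := program_havoc X l2.
have [NZ hNZ] := test_zero X 3 2.
have [NE hNE] := program_seq (program_havoc X l0) (preserves_havoc l0) (test_eq X l0 l2).
have [NS hNS] := program_seq (program_havoc X l0) (preserves_havoc l0) (test_succ X l2 l0).
exists (nfa_seq N2 (nfa_seq (nfa_choice NZ (nfa_seq NE (nfa_act InputOne)))
  (nfa_seq NS (nfa_seq (nfa_act InputBlank) Np)))) => j.
have cl0 : clean 3 (fun=> 0) by [].
split.
  move=> [t]; rewrite acc_seq => -[_ [/hN2-/(_ cl0)[v ->]]].
  have cl1 : clean 3 (upd (fun=> 0) 2 v) by apply: clean_upd.
  rewrite acc_seq => -[s1 [/acc_choice h1]].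
  have {h1} [cl2 e2 vj] : [/\ clean 3 s1, s1 2 = v & v <= j].
    case: h1 => [/hNZ-/(_ cl1)[]|]; first by rewrite updE eqxx => v0 ->; split=> //; rewrite v0.
    rewrite acc_seq => -[u [/hNE-/(_ cl1)[_ [[x ->] []]]]].
    rewrite !updE !eqxx /= => -> ->; rewrite acc_act /= => -[+ ->].
    rewrite !updE /= => /andP[_ vj]; split=> //.
    by apply: clean_upd.
  rewrite acc_seq => -[s2 [/hNS-/(_ cl2)[_ [[x ->] []]]]].
  rewrite !updE /= e2 => -> ->; rewrite acc_seq => -[s3 []].
  rewrite acc_act /= updE /= => -[vj' ->] /hNp[]; first by apply: clean_upd.
  by rewrite /= updE /= e2 (_ : v = j) //; lia.
move=> pj; exists (upd (upd (fun=> 0) 2 j) 0 j.+1).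
rewrite acc_seq; exists (upd (fun=> 0) 2 j).
have cl1 : clean 3 (upd (fun=> 0) 2 j) by apply: clean_upd.
split; first by apply/hN2 => //; exists j.
have S s : clean 3 s -> s 2 = j -> acc X j (nfa_seq NS (nfa_seq (nfa_act InputBlank) Np)) s
    (upd s 0 j.+1).
  move=> cl sj; rewrite acc_seq; exists (upd s 0 j.+1); split.
    by apply/hNS => //; exists (upd s 0 j.+1); split; [exists j.+1 | rewrite !updE /= sj].
  rewrite acc_seq; exists (upd s 0 j.+1); split; first by rewrite acc_act /= updE /=.
  by apply/hNp; [apply: clean_upd | rewrite /= updE /= sj].
rewrite acc_seq; case: (posnP j) => [j0|jp].
  exists (upd (fun=> 0) 2 j); split; last exact: S.
  by rewrite acc_choice; left; apply/hNZ => //; rewrite updE /= j0.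
exists (upd (upd (fun=> 0) 2 j) 0 j); split; last first.
  by rewrite -[X in acc _ _ _ _ X](updK _ 0 j); apply: S => //; apply: clean_upd.
rewrite acc_choice; right; rewrite acc_seq; exists (upd (upd (fun=> 0) 2 j) 0 j); split.
  by apply/hNE => //; exists (upd (upd (fun=> 0) 2 j) 0 j); split; [exists j|].
by rewrite acc_act /= !updE /= jp leqnn.
Qed.

Definition act_reg (a : act) : nat :=
  match a with Inc r | Dec r | Zero r => r | _ => 0 end.

Definition querying (a : act) : bool := if a is Query _ then true else false.

(** [RewRun] and [RewInc] rewind all heads before a replay and before passing to the next guess.
    [Adv] exists because a query instruction moves no head, so that the guess tape has to be
    advanced by an extra step. *)
Variant ctl (Q : Type) := Mark | RewRun | RewInc | Incr | Run of Q | Adv of Q.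
Arguments Mark {Q}. Arguments RewRun {Q}. Arguments RewInc {Q}. Arguments Incr {Q}.

Section CtlFin.
Variable Q : finType.
Definition ctl_code (c : ctl Q) : 'I_4 + (bool * Q) :=
  match c with
  | Mark => inl (inord 0) | RewRun => inl (inord 1) | RewInc => inl (inord 2)
  | Incr => inl (inord 3) | Run q => inr (false, q) | Adv q => inr (true, q)
  end.
Definition ctl_decode (c : 'I_4 + (bool * Q)) : ctl Q :=
  match c with
  | inl i => match val i with 0 => Mark | 1 => RewRun | 2 => RewInc | _ => Incr end
  | inr (b, q) => if b then Adv q else Run q
  end.
Lemma ctl_codeK : cancel ctl_code ctl_decode.
Proof. by case=> //=; rewrite inordK. Qed.
HB.instance Definition _ := Finite.copy (ctl Q) (can_type ctl_codeK).
End CtlFin.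

Section TapeContents.
Variable M : otm.

(* The head of [t] is at position [p] of the tape whose contents are [z]; nothing is
   known about the cells at negative positions. *)
Definition tape_at (t : tape M) (z : nat -> nat) (p : nat) :=
  [/\ t.1.2 = z p :> nat, forall i, i < p -> nth ord0 t.1.1 i = z (p - i.+1) :> nat &
      forall i, nth ord0 t.2 i = z (p + i.+1) :> nat].

Lemma tape_at_right t z p : tape_at t z p -> tape_at (tape_move (Some true) t) z p.+1.
Proof.
case: t => [[l x] r] [/= e el er]; split=> /=.
- by rewrite -nth0 er addn1.
- by case=> [|i] ip /=; [rewrite subn1|rewrite el].
- by move=> i; rewrite nth_behead er addnS.
Qed.

Lemma tape_at_left t z p : tape_at t z p.+1 -> tape_at (tape_move (Some false) t) z p.
Proof.
case: t => [[l x] r] [/= e el er]; split=> /=.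
- by rewrite -nth0 el // subn1.
- by move=> i ip; rewrite nth_behead el.
- by case=> [|i] /=; rewrite ?e ?er; congr z; lia.
Qed.

Lemma tape_at_write t z p x : tape_at t z p -> tape_at (write x t) (upd z p x) p.
Proof.
case: t => [[l y] r] [/= e el er]; split=> /= [|i ip|i].
- by rewrite updE eqxx.
- by rewrite updE el //; case: eqP => //; lia.
- by rewrite updE er; case: eqP => //; lia.
Qed.

End TapeContents.

#[local] Arguments tape_move : simpl never.
#[local] Arguments write : simpl never.

Section Determinize.
Variable N : nfa.

(** Tapes 0 to [K] - 1 belong to the registers and the last tape, of index [K], holds the guess; [K]
    is at least 2, so that registers 0 and 1 always have a tape. The letters are 0 to [b], where [b]
    names no transition: the alphabet is nonempty even if there are no transitions. *)
Let b := size (nfa_trans N).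
Let K := (\max_(x <- nfa_trans N) act_reg x.1.2).+2.
Let ns := b.+2.
Let st := #|{: ctl N}|.
Let sym := 'I_ns.+2.

(** [None] gets the code [ord0], the initial state fixed by the machine model. *)
Definition st_code (c : option (ctl N)) : 'I_st.+1 :=
  if c is Some c' then lift ord0 (enum_rank c') else ord0.
Definition st_decode (i : 'I_st.+1) : option (ctl N) :=
  omap enum_val (unlift ord0 i).

Lemma st_codeK : cancel st_code st_decode.
Proof.
by case=> [c|]; rewrite /st_decode /st_code ?liftK ?unlift_none //= enum_rankK.
Qed.

Definition st_to (c : ctl N) : option 'I_st.+1 := Some (st_code (Some c)).

(* Symbol 2 marks the origin of every tape; symbol a+3 stands for the letter a. *)
Let mk : sym := inord 2.
Let vec := {ffun 'I_K.+1 -> sym}.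

Definition keep (v : vec) (m : 'I_K.+1 -> move) : {ffun 'I_K.+1 -> sym * move} :=
  [ffun i => (v i, m i)].

Definition adv (dir : option (nat * bool)) (i : 'I_K.+1) : move :=
  if i == ord_max then Some true
  else if dir is Some (r, d) then if i == r :> nat then Some d else None else None.

Definition act_dir (a : act) : option (nat * bool) :=
  match a with Inc r => Some (r, true) | Dec r => Some (r, false) | _ => None end.

(** A register is zero exactly when its head scans the origin mark 2, and the ones of the input lie
    on the tape of register 0. A query is left to the query instruction, which branches on the
    answer. *)
Definition enabled_sym (a : act) (v : vec) : bool :=
  match a with
  | Skip | Inc _ => true
  | Dec r => val (v (inord r)) != 2
  | Zero r => val (v (inord r)) == 2
  | InputOne => val (v ord0) == 1
  | InputBlank => val (v ord0) == 0
  | Query _ => true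
  end.

Let x0 : N * act * N := (nfa_ini N, Skip, nfa_ini N).

(* The last tape runs through all words over the alphabet of transitions, in an odometer
   fashion; each word is a guess of an accepting run, which is replayed until a transition
   is not enabled, and then all heads are rewound. *)
Definition det_delta (pv : 'I_st.+1 * vec) : instr st K ns :=
  let: (p, v) := pv in
  let stop := fun=> None in
  let fail : instr st K ns := inr (st_to RewInc, keep v stop, None) in
  let rew next self : instr st K ns :=
    if [forall i, val (v i) == 2] then inr (st_to next, keep v (adv None), None)
    else inr (st_to self, keep v (fun i => if val (v i) == 2 then None else Some false),
              if val (v (inord 1)) == 2 then None else Some false) in
  match st_decode p with
  (* The input starts under the head of tape 0; the step to the left puts the origin mark in front
     of it, so that the ones occupy the cells 1 to j. *)
  | None => inr (st_to Mark, keep v (fun i => if i == ord0 then Some false else None), None)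
  | Some Mark => inr (st_to RewRun, [ffun=> (mk, None)], None)
  | Some RewRun => rew (Run (nfa_ini N)) RewRun
  | Some RewInc => rew Incr RewInc
  | Some Incr =>
      let x := val (v ord_max) in
      (* The last letter becomes 0 and carries to the right; a blank, for which x < 3, becomes the
         letter 0 and lengthens the word. *)
      if x == b + 3 then
        inr (st_to Incr, [ffun i => (if i == ord_max then inord 3 else v i, adv None i)], None)
      else
        inr (st_to RewRun,
          [ffun i => (if i == ord_max then inord (if x < 3 then 3 else x.+1) else v i, None)],
          None)
  | Some (Run q) =>
      if q == nfa_fin N then inr (None, keep v stop, None) else
      let x := val (v ord_max) in
      let: (q1, a, q2) := nth x0 (nfa_trans N) (x - 3) in
      if [&& 3 <= x < b + 3, q1 == q & enabled_sym a v] then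
        if a is Query c then
          if c then inl (st_to (Adv q2), st_to RewInc) else inl (st_to RewInc, st_to (Adv q2))
        else
          inr (st_to (Run q2), keep v (adv (act_dir a)),
               if act_dir a is Some (1, d) then Some d else None)
      else fail
  | Some (Adv q) => inr (st_to (Run q), keep v (adv None), None)
  end.

Definition det_otm : otm := @OTM st K ns [ffun pv => det_delta pv].

Section Correctness.
Variables (X : real) (j : nat).

Definition cont (w : seq nat) (i : 'I_K.+1) (p : nat) : nat :=
  if p is p'.+1 then
    if i == ord_max then if p' < size w then nth 0 w p' + 3 else 0
    else if i == ord0 then nat_of_bool (p' < j) else 0
  else 2.

Definition pos (s : store) (g : nat) (i : 'I_K.+1) : nat := if i == ord_max then g else s i.

(** A register is represented by the position of its head, never by tape contents; [g] is the
    position on the guess tape. *)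
Definition repr (cfg : config det_otm) (c : ctl N) (s : store) (g : nat) (w : seq nat) :=
  [/\ cfg_state cfg = st_to c, forall i, tape_at (cfg_tapes cfg i) (cont w i) (pos s g i) &
      cfg_oracle cfg = s 1].

Lemma repr_scanned cfg c s g w i : repr cfg c s g w ->
  val (scanned cfg i) = cont w i (pos s g i).
Proof. by move=> [_ /(_ i)[+ _ _] _]; rewrite ffunE. Qed.

Lemma step_move (cfg : config det_otm) c q f d : cfg_state cfg = st_to c ->
  det_delta (st_code (Some c), scanned cfg) = inr (q, f, d) ->
  step X cfg = @Config det_otm q (fun i =>
    @tape_move det_otm (f i).2 (@write det_otm (f i).1 (cfg_tapes cfg i)))
                      (head_move d (cfg_oracle cfg)).
Proof. by move=> e h; rewrite /step /cur_instr e /= ffunE h. Qed.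

Lemma write_scanned (cfg : config det_otm) i : @write det_otm (scanned cfg i) (cfg_tapes cfg i) =
  cfg_tapes cfg i.
Proof. by rewrite ffunE /write; case: (cfg_tapes cfg i) => -[]. Qed.

Lemma tape_move_None (t : tape det_otm) : tape_move None t = t.
Proof. by case: t => -[]. Qed.

Lemma tape_at_move t z p d : tape_at t z p -> (d = Some false -> 0 < p) ->
  tape_at (@tape_move det_otm d t) z (head_move d p).
Proof.
case: d => [[]|] tz; [|move/(_ erefl)|]; rewrite /head_move //.
- by move=> _; apply: tape_at_right.
- by case: p tz => // p tz _; apply: tape_at_left.
- by case: t tz => -[].
Qed.

Lemma step_keep cfg c s g w c' m d s' g' : repr cfg c s g w ->
  det_delta (st_code (Some c), scanned cfg) = inr (st_to c', keep (scanned cfg) m, d) ->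
  (forall i, m i = Some false -> 0 < pos s g i) ->
  (forall i, pos s' g' i = head_move (m i) (pos s g i)) ->
  head_move d (s 1) = s' 1 ->
  repr (step X cfg) c' s' g' w.
Proof.
move=> [e ta o] h mp ps os; rewrite (step_move e h); split=> //=; last by rewrite o.
move=> i; rewrite ffunE /= write_scanned ps; apply: tape_at_move => //.
exact: mp.
Qed.

Lemma cont_eq2 w i p : (cont w i p == 2) = (p == 0).
Proof.
case: p => [|p] //=; case: ifP => _; first by case: ifP => // _; lia.
by case: ifP => // _; case: (p < j).
Qed.

Lemma tape_neq r : r < K -> (inord r : 'I_K.+1) != ord_max /\ (inord r : 'I_K.+1) = r :> nat.
Proof.
by move=> rK; rewrite -val_eqE /= inordK; [split=> //; lia | lia].
Qed.

Lemma ord0_max : (ord0 : 'I_K.+1) == ord_max = false.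
Proof. by []. Qed.

Let one_lt : 1 < K. Proof. by []. Qed.

Lemma pos_reg s g r : r < K -> pos s g (inord r) = s r.
Proof. by move=> /tape_neq[nm e]; rewrite /pos (negbTE nm) e. Qed.

Lemma repr_all0 cfg c s g w : repr cfg c s g w ->
  [forall i, val (scanned cfg i) == 2] = [forall i, pos s g i == 0].
Proof. by move=> h; apply: eq_forallb => i; rewrite (repr_scanned i h) cont_eq2. Qed.

(** All heads move left together, those at the mark waiting for the others; [m] bounds the distance.
    The oracle tape carries no mark, so the oracle head is steered by the tape of register 1, whose
    head is at the same position. The last move puts the guess head on the first letter, at position
    1. *)
Lemma rewind c next w :
  (forall v, det_delta (st_code (Some c), v) =
    if [forall i, val (v i) == 2] then inr (st_to next, keep v (adv None), None)
    else inr (st_to c, keep v (fun i => if val (v i) == 2 then None else Some false),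
              if val (v (inord 1)) == 2 then None else Some false)) ->
  forall m cfg s g, repr cfg c s g w -> (forall i, pos s g i <= m) ->
  exists n, repr (iter n.+1 (step X) cfg) next (fun=> 0) 1 w.
Proof.
move=> hd m cfg s g; elim: m cfg s g => [|m IH] cfg s g h pm.
all: case E : [forall i, pos s g i == 0]; [exists 0|].
- apply: (step_keep h); first by rewrite hd (repr_all0 h) E.
  + by move=> i; rewrite /adv; case: ifP.
  + move=> i; rewrite (eqP (forallP E i)) /pos /adv; by case: ifP.
  + by rewrite -(pos_reg s g one_lt) (eqP (forallP E _)).
- by move/negbT/forallPn: E => [i]; rewrite -leqn0 pm.
- apply: (step_keep h); first by rewrite hd (repr_all0 h) E.
  + by move=> i; rewrite /adv; case: ifP.
  + move=> i; rewrite (eqP (forallP E i)) /pos /adv; by case: ifP.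
  + by rewrite -(pos_reg s g one_lt) (eqP (forallP E _)).
have [||n hn] := IH (step X cfg) (fun r => (s r).-1) g.-1; last by exists n.+1; rewrite iterSr.
  apply: (step_keep h); first by rewrite hd (repr_all0 h) E.
  + by move=> i; cbv beta; rewrite (repr_scanned i h) cont_eq2; case: posnP.
  + move=> i; cbv beta; rewrite (repr_scanned i h) cont_eq2.
    rewrite -[LHS]/(if i == ord_max then _ else _) (_ : (if _ then _ else _) = (pos s g i).-1).
      by case: posnP => [->|].
    by rewrite /pos; case: ifP.
  + by rewrite (repr_scanned _ h) cont_eq2 pos_reg //; case: posnP => [->|].
move=> i; rewrite (_ : pos _ _ _ = (pos s g i).-1); first by have := pm i; lia.
by rewrite /pos; case: ifP.
Qed.

(** Bijective numeration in base [b] + 1, least significant letter first ([word_val] is the value),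
    so that the iterates from the empty word run through all words. *)
Fixpoint succ_word (w : seq nat) : seq nat :=
  if w is a :: w' then if a == b then 0 :: succ_word w' else a.+1 :: w' else [:: 0].

Lemma cont_nth w i p : i != ord_max -> cont w i p = cont [::] i p.
Proof. by move=> /negbTE im; case: p => //= p; rewrite im. Qed.

Lemma tape_at_ext t z z' p : z =1 z' -> @tape_at det_otm t z p -> tape_at t z' p.
Proof. by move=> zz [h1 h2 h3]; split=> [|i /h2|i]; rewrite -zz. Qed.

(** [w1] is the part in which the carry has already been done and [w2] the part still to be
    incremented, with the head on its first cell. *)
Lemma increment w1 w2 cfg s : repr cfg Incr s (size w1).+1 (w1 ++ w2) ->
  all (fun a => a <= b) w2 ->
  exists n s' g', repr (iter n.+1 (step X) cfg) RewRun s' g' (w1 ++ succ_word w2).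
Proof.
elim: w2 w1 cfg => [|a w2 IH] w1 cfg h.
  move=> _; exists 0, s, (size w1).+1.
  have vx : val (scanned cfg ord_max) = 0.
    by rewrite (repr_scanned _ h) /cont /pos eqxx cats0 ltnn.
  have [e ta o] := h.
  have hd : det_delta (st_code (Some Incr), scanned cfg) = inr (st_to RewRun, [ffun i =>
    (if i == ord_max then inord 3 else scanned cfg i, None)], None).
    by rewrite /det_delta st_codeK vx addn3.
  rewrite /= (step_move e hd).
  split=> //= i; rewrite ffunE /=; case: eqP => [->|/eqP im].
    apply: tape_at_ext (tape_at_write _ (ta _)) => -[|p]; rewrite updE ?/pos /cont ?eqxx // eqSS.
    rewrite cats0 size_cat /= nth_cat inordK // addn1 ltnS.
    by case: ltngtP => // ->; rewrite subnn.
  rewrite write_scanned tape_move_None; apply: tape_at_ext (ta i) => p.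
  by rewrite cont_nth // [RHS]cont_nth.
case/andP=> ab aw2.
have vx : val (scanned cfg ord_max) = a + 3.
  rewrite (repr_scanned _ h) /cont /pos eqxx size_cat /= nth_cat ltnn subnn ifT //; lia.
have [e ta o] := h.
case: (eqVneq a b) => [ab'|ab'].
  have [|//|n [s' [g' hn]]] := IH (rcons w1 0) (step X cfg).
    have hd : det_delta (st_code (Some Incr), scanned cfg) = inr (st_to Incr, [ffun i =>
      (if i == ord_max then inord 3 else scanned cfg i, adv None i)], None).
      by rewrite /det_delta st_codeK vx ab' eqxx.
    rewrite (step_move e hd).
    split=> //= i; rewrite ffunE /=; case: (eqVneq i ord_max) => [->|im].
      rewrite /adv eqxx /pos eqxx size_rcons; apply: tape_at_right.
      have := ta ord_max; rewrite /pos eqxx => ta'.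
      apply: tape_at_ext (tape_at_write _ ta') => -[|p]; rewrite updE ?/pos /cont ?eqxx // eqSS.
      rewrite cat_rcons !size_cat /= !nth_cat inordK //.
      by case: (ltngtP p (size w1)) => // [lt|->]; [rewrite -(subnSK lt)|rewrite subnn ifT //; lia].
    have := ta i; rewrite /adv /pos (negbTE im) write_scanned tape_move_None => tai.
    by apply: tape_at_ext tai => p; rewrite cont_nth // [RHS]cont_nth.
  by exists n.+1, s', g'; rewrite iterSr /= ab' eqxx -cat_rcons.
have hd : det_delta (st_code (Some Incr), scanned cfg) = inr (st_to RewRun, [ffun i =>
  (if i == ord_max then inord (a + 3).+1 else scanned cfg i, None)], None).
  by rewrite /det_delta st_codeK vx eqn_add2r (negbTE ab') ltnNge leq_addl.
exists 0, s, (size w1).+1; rewrite /= (negbTE ab') (step_move e hd).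
split=> //= i; rewrite ffunE /=; case: eqP => [->|/eqP im].
  apply: tape_at_ext (tape_at_write _ (ta _)) => -[|p]; rewrite updE ?/pos /cont ?eqxx // eqSS.
  rewrite !size_cat /= !nth_cat inordK; last by rewrite /ns; lia.
  by case: (ltngtP p (size w1)) => // [lt|->]; [rewrite -(subnSK lt)|rewrite subnn ifT //; lia].
rewrite write_scanned tape_move_None; apply: tape_at_ext (ta i) => p.
by rewrite cont_nth // [RHS]cont_nth.
Qed.

Lemma act_reg_lt q1 a q2 : (q1, a, q2) \in nfa_trans N -> act_reg a < K.
Proof.
move=> tr; rewrite /K ltnS; apply: leqW.
exact: (@leq_bigmax_seq _ _ xpredT (fun x : N * act * N => act_reg x.1.2) _ tr isT).
Qed.

Lemma enabled_symE cfg c s g w a : repr cfg c s g w -> act_reg a < K ->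
  ~~ querying a -> enabled_sym a (scanned cfg) = enabled X j a s.
Proof.
move=> h; case: a => //= [r|r||] rK _.
- by rewrite (repr_scanned _ h) cont_eq2 pos_reg // lt0n.
- by rewrite (repr_scanned _ h) cont_eq2 pos_reg.
- rewrite (repr_scanned _ h) /pos ord0_max /=; case: (s 0) => [|p] //=.
  by rewrite ?ord0_max; case: ltnP.
- rewrite (repr_scanned _ h) /pos ord0_max /=; case: (s 0) => [|p] //=.
  by rewrite ?ord0_max ltnS; case: ltnP.
Qed.

Lemma repr_effect cfg q2 a q s g w : repr cfg (Run q) s g.+1 w -> act_reg a < K ->
  enabled X j a s ->
  det_delta (st_code (Some (Run q)), scanned cfg) =
    inr (st_to (Run q2), keep (scanned cfg) (adv (act_dir a)),
         if act_dir a is Some (1, d) then Some d else None) ->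
  repr (step X cfg) (Run q2) (effect a s) g.+2 w.
Proof.
move=> h aK en hd; apply: (step_keep h hd).
- move=> i; rewrite /adv /pos; case: ifP => // im.
  by case: a aK en {hd} => //= r _ en; case: eqP => // ->.
- move=> i; rewrite /adv /pos; case: ifP => // im.
  by case: a aK en {hd} => //= r _ en; rewrite updE; case: eqP => // ->.
- by case: a aK en {hd} => //= -[|[|r]].
Qed.

(** Replay of a guess: the letters are indices of transitions, and success is declared as soon as
    the final state is reached, whatever letters remain. *)
Fixpoint exec (q : N) (s : store) (w : seq nat) : bool :=
  (q == nfa_fin N) ||
  if w is a :: w' then
    let: (q1, c, q2) := nth x0 (nfa_trans N) a in
    [&& a < b, q1 == q, enabled X j c s & exec q2 (effect c s) w']
  else false.

Lemma repr_fail cfg q s g w : repr cfg (Run q) s g w ->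
  det_delta (st_code (Some (Run q)), scanned cfg) =
    inr (st_to RewInc, keep (scanned cfg) (fun=> None), None) ->
  repr (step X cfg) RewInc s g w.
Proof. by move=> h hd; apply: (step_keep h hd). Qed.

Lemma step_query (cfg : config det_otm) c yes no : cfg_state cfg = st_to c ->
  det_delta (st_code (Some c), scanned cfg) = inl (yes, no) ->
  step X cfg = @Config det_otm (if X (cfg_oracle cfg) then yes else no)
                 (cfg_tapes cfg) (cfg_oracle cfg).
Proof. by move=> e h; rewrite /step /cur_instr e /= ffunE h. Qed.

(** [u] is the part of the guess not yet read. After a failure the head positions are left
    unspecified, since the rewinding that follows works from any positions. *)
Lemma execution u w q s g cfg : drop g w = u -> repr cfg (Run q) s g.+1 w ->
  if exec q s u then exists n, cfg_state (iter n (step X) cfg) = None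
  else exists n s' g', repr (iter n.+1 (step X) cfg) RewInc s' g' w.
Proof.
elim: u q s g cfg => [|a u IH] q s g cfg dr h.
all: have [e ta o] := h; rewrite /=.
all: have vx : val (scanned cfg ord_max) = (if g < size w then nth 0 w g + 3 else 0)
  by rewrite (repr_scanned _ h) /pos eqxx /= eqxx.
all: case: (eqVneq q (nfa_fin N)) => [qf|qf] /=.
- exists 1; rewrite /= (step_move (q := None) (f := keep (scanned cfg) (fun=> None)) (d :=
  None) e) //.
  by rewrite /det_delta st_codeK qf eqxx.
- have gw : size w <= g.
    by have := size_drop g w; rewrite dr /=; lia.
  exists 0, s, g.+1; apply: repr_fail h _.
  rewrite /det_delta st_codeK (negbTE qf) vx ltnNge gw /=.
  by case: (nth _ _ _) => -[].
- exists 1; rewrite /= (step_move (q := None) (f := keep (scanned cfg) (fun=> None)) (d :=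
  None) e) //.
  by rewrite /det_delta st_codeK qf eqxx.
have gw : g < size w.
  by have := size_drop g w; rewrite dr /=; lia.
have ga : nth 0 w g = a.
  by have := nth_drop g 0 w 0; rewrite dr addn0 => <-.
have dr' : drop g.+1 w = u.
  by have := dr; rewrite (drop_nth 0 gw) => -[].
rewrite gw ga in vx.
have hd : det_delta (st_code (Some (Run q)), scanned cfg) =
  let: (q1, a, q2) := nth x0 (nfa_trans N) a in
      if [&& nth 0 w g < b, q1 == q & enabled_sym a (scanned cfg)] then
        if a is Query c then
          if c then inl (st_to (Adv q2), st_to RewInc) else inl (st_to RewInc, st_to (Adv q2))
        else
          inr (st_to (Run q2), keep (scanned cfg) (adv (act_dir a)),
               if act_dir a is Some (1, d) then Some d else None)
      else inr (st_to RewInc, keep (scanned cfg) (fun=> None), None).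
  by rewrite /det_delta st_codeK (negbTE qf) vx addnK leq_addl ltn_add2r ga.
rewrite ga in hd; case tr : (nth x0 (nfa_trans N) a) hd => [[q1 c] q2].
case: (ltnP a b) => ab hd; last first.
  by exists 0, s, g.+1; apply: repr_fail h _; rewrite hd.
have cK : act_reg c < K by apply: (@act_reg_lt q1 _ q2); rewrite -tr mem_nth.
case: (eqVneq q1 q) hd => [q1q|q1q] hd; last first.
  by exists 0, s, g.+1; apply: repr_fail h _; rewrite hd.
have esE := enabled_symE h cK.
have [[d cd]|cq] : (exists d, c = Query d) \/ ~~ querying c.
    by case: (c); auto; move=> d; left; exists d.
- have {}hd : det_delta (st_code (Some (Run q)), scanned cfg) =
    inl (if d then (st_to (Adv q2), st_to RewInc) else (st_to RewInc, st_to (Adv q2))).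
    by rewrite hd cd /=; case: (d).
  have st1 : step X cfg = @Config det_otm (st_to (if X (s 1) == d then Adv q2 else RewInc))
                 (cfg_tapes cfg) (s 1).
    case: d hd {cd} => hd; rewrite (step_query e hd) o; by case: (X _).
  rewrite cd /=; case Xd : (X (s 1) == d) st1 => st1 /=; last first.
    by exists 0, s, g.+1; rewrite /= st1; split.
  have h2 : repr (step X cfg) (Adv q2) s g.+1 w by rewrite st1; split.
  have h3 : repr (iter 2 (step X) cfg) (Run q2) s g.+2 w.
    apply: (step_keep (m := adv None) (d := None) h2).
    + by rewrite /det_delta st_codeK.
    + by move=> i; rewrite /adv; case: ifP.
    + by move=> i; rewrite /adv /pos; case: ifP.
    + by [].
  have := IH _ _ _ _ dr' h3; case: ifP => _ [n hn].
    by exists (n + 2); rewrite iterD.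
  by exists (n + 2); move: hn; rewrite -iterD addSn.
rewrite (esE cq) in hd; case en : (enabled X j c s) hd => hd /=; last first.
  by exists 0, s, g.+1; apply: repr_fail h _; rewrite hd.
have {}hd : det_delta (st_code (Some (Run q)), scanned cfg) =
    inr (st_to (Run q2), keep (scanned cfg) (adv (act_dir c)),
         if act_dir c is Some (1, d) then Some d else None).
  by rewrite hd; case: (c) cq.
have h2 := repr_effect h cK en hd.
have := IH _ _ _ _ dr' h2; case: ifP => _ [n hn].
  by exists n.+1; rewrite iterSr.
by exists n.+1; move: hn; rewrite -iterSr.
Qed.

Lemma exec_acc q s w : exec q s w -> exists t, star (@nstep X j N) (q, s) (nfa_fin N, t).
Proof.
elim: w q s => [|a w IH] q s /=; first by rewrite orbF => /eqP->; exists s; exact: rt1n_refl.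
case/orP => [/eqP->|]; first by exists s; exact: rt1n_refl.
case tr : (nth _ _ _) => [[q1 c] q2] /and4P[ab /eqP<- en /IH[t tr']].
exists t; apply: rt1n_trans tr'; exists c; split=> //=.
by rewrite -tr mem_nth.
Qed.

Lemma acc_exec q s t : star (@nstep X j N) (q, s) (nfa_fin N, t) ->
  exists2 w, all (fun a => a <= b) w & exec q s w.
Proof.
pose I (c : N * store) := exists2 w, all (fun a => a <= b) w & exec c.1 c.2 w.
apply: (@star_rev _ _ I) => [|[q1 s1] [q2 s2] [c [/= tr en ->]] [w ww ex]].
  by exists [::]; rewrite //= eqxx.
have lt : index (q1, c, q2) (nfa_trans N) < b by rewrite index_mem.
exists (index (q1, c, q2) (nfa_trans N) :: w); first by rewrite /= ww andbT ltnW.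
by rewrite /= nth_index // lt eqxx en ex orbT.
Qed.

Lemma all_succ_word w : all (fun a => a <= b) w -> all (fun a => a <= b) (succ_word w).
Proof.
by elim: w => //= a w IH /andP[ab aw]; case: eqVneq => [_|ne] /=; rewrite ?IH // aw andbT; lia.
Qed.

Fixpoint word_val (w : seq nat) : nat := if w is a :: w' then a.+1 + b.+1 * word_val w' else 0.

Lemma word_val_succ w : word_val (succ_word w) = (word_val w).+1.
Proof.
elim: w => [|a w IH] /=; first by rewrite muln0.
by case: eqVneq => [->|_] //=; rewrite IH; lia.
Qed.

Lemma pred_word w : all (fun a => a <= b) w -> w != [::] ->
  exists2 w', all (fun a => a <= b) w' & succ_word w' = w.
Proof.
elim: w => [//|a w IH] /andP[ab aw] _; case: a ab => [_|a ab]; last first.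
  by exists (a :: w); rewrite /= ?aw ?andbT ?(ltnW ab) //; case: eqP => //; lia.
have [->|wn] := eqVneq w [::]; first by exists [::].
by have [w' aw' <-] := IH aw wn; exists (b :: w'); rewrite /= ?leqnn ?eqxx.
Qed.

Lemma succ_word_onto w : all (fun a => a <= b) w -> exists k, iter k succ_word [::] = w.
Proof.
move: {2}(word_val w) (leqnn (word_val w)) => m; elim: m w => [|m IH] w wm aw.
  by case: w wm aw => // _ _; exists 0.
have [->|wn] := eqVneq w [::]; first by exists 0.
have [w' aw' e] := pred_word aw wn.
have [|k ek] := IH w' _ aw'; first by move: wm; rewrite -e word_val_succ.
by exists k.+1; rewrite /= ek.
Qed.

Let c0 : config det_otm := init det_otm j.

Lemma start_phase : exists n, repr (iter n (step X) c0) (Run (nfa_ini N)) (fun=> 0) 1 [::].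
Proof.
have om : (ord0 : 'I_K.+1) == ord_max = false by [].
have e0 : cfg_state c0 = Some ord0 by [].
have hd0 : det_delta (ord0, scanned c0) =
  inr (st_to Mark, keep (scanned c0) (fun i => if i == ord0 then Some false else None), None).
  by rewrite /det_delta (st_codeK None).
pose c1 : config det_otm := step X c0.
have c1E : c1 = @Config det_otm (st_to Mark) (fun i =>
    tape_move (if i == ord0 then Some false else None) (cfg_tapes c0 i)) 0.
  rewrite /c1 /step /cur_instr e0 /= ffunE hd0; congr Config; apply: funext => i.
  by rewrite ffunE /= write_scanned.
have hd1 : det_delta (st_code (Some Mark), scanned c1) = inr (st_to RewRun, [ffun=> (mk, None)],
  None).
  by rewrite /det_delta st_codeK.
have r2 : repr (step X c1) RewRun (fun=> 0) 0 [::].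
  rewrite (step_move _ hd1); last by rewrite c1E.
  split=> //=; last by rewrite c1E.
  move=> i; rewrite ffunE /= tape_move_None c1E /= /pos if_same.
  split=> /=; first by rewrite /mk inordK.
    by [].
  move=> p; rewrite ?add0n /= /c0 /init /=.
  case: (eqVneq i ord_max) => [->|im] /=.
    by rewrite ?om /= nth_nil.
  case: (eqVneq i ord0) => [_|i0] /=; last by rewrite nth_nil.
  case: (posnP j) => [->|jp] /=; first by case: p => //= p; rewrite nth_nil.
  case: p => [|p] /=; first by rewrite inordK // jp.
  rewrite nth_nseq -ltnS prednK // ; case: ltnP => //; by rewrite inordK.
have [||n hn] := @rewind RewRun (Run (nfa_ini N)) [::] _ 0 _ _ _ r2 _.
- by move=> v; rewrite /det_delta st_codeK.
- by move=> i; rewrite /pos if_same.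
by exists (n.+1 + 2); rewrite iterD.
Qed.

Lemma cycle cfg w : all (fun a => a <= b) w -> ~~ exec (nfa_ini N) (fun=> 0) w ->
  repr cfg (Run (nfa_ini N)) (fun=> 0) 1 w ->
  exists n, repr (iter n.+1 (step X) cfg) (Run (nfa_ini N)) (fun=> 0) 1 (succ_word w).
Proof.
move=> aw ex h.
have := execution (drop0 w) h; rewrite (negbTE ex) => -[n1 [s1 [g1 h1]]].
(* The sum is a crude bound on all head positions. *)
have [||n2 h2] := @rewind RewInc Incr w _ (g1 + \sum_(i < K.+1) s1 i) _ _ _ h1 _.
- by move=> v; rewrite /det_delta st_codeK.
- move=> i; rewrite /pos; case: ifP => _; first exact: leq_addr.
  by rewrite (bigD1 i) //= addnCA leq_addr.
have [n3 [s3 [g3 h3]]] := @increment [::] w _ _ h2 aw.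
have [||n4 h4] := @rewind RewRun (Run (nfa_ini N)) (succ_word w) _ (g3 + \sum_(i < K.+1) s3 i) _ _
  _ h3 _.
- by move=> v; rewrite /det_delta st_codeK.
- move=> i; rewrite /pos; case: ifP => _; first exact: leq_addr.
  by rewrite (bigD1 i) //= addnCA leq_addr.
by exists (n4 + (n3.+1 + (n2.+1 + n1.+1))); rewrite -addSn !iterD.
Qed.

Lemma halted_iter (cfg : config det_otm) n m : cfg_state (iter n (step X) cfg) = None -> n <= m ->
  cfg_state (iter m (step X) cfg) = None.
Proof.
move=> hn nm; rewrite -(subnK nm); elim: (m - n) => //= k IH.
by rewrite /step /cur_instr IH.
Qed.

(** If no guess succeeds, the machine completes any given number of cycles, each taking at least one
    step, and so never halts; otherwise it reaches the first successful guess, whose replay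
    halts. *)
Lemma det_otm_halts : (exists s, cfg_state (run det_otm X j s) = None) <->
  exists t, acc X j N (fun=> 0) t.
Proof.
have [n0 h0] := start_phase.
have cyc k : (forall i, i < k -> ~~ exec (nfa_ini N) (fun=> 0) (iter i succ_word [::])) ->
   exists2 n, k <= n & repr (iter n (step X) c0) (Run (nfa_ini N)) (fun=>
     0) 1 (iter k succ_word [::]).
  elim: k => [|k IH] ex; first by exists n0.
  have [n kn hn] := IH (fun i ik => ex i (ltnW ik)).
  have aw : all (fun a => a <= b) (iter k succ_word [::]).
    by elim: (k) => //= i; apply: all_succ_word.
  have [m hm] := cycle aw (ex k (ltnSn k)) hn.
  by exists (m.+1 + n); [lia | rewrite iterD].
split=> [[s hs]|[t /acc_exec[w aw ex]]].
  case: (pselect (exists i, exec (nfa_ini N) (fun=> 0) (iter i succ_word [::]))) => [[i]|nex].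
    by by case/exec_acc => t tr; exists t.
  have [i _|n sn [e _ _]] := cyc s; first by apply/negP => ex; apply: nex; exists i.
  by move: (halted_iter hs sn); rewrite e.
have [k ek] := succ_word_onto aw.
have exk : exists i, exec (nfa_ini N) (fun=> 0) (iter i succ_word [::]) by exists k; rewrite ek.
have [i exi mini] := ex_minnP exk.
have [|n _ hn] := cyc i; first by move=> i' lt; apply/negP => /mini; lia.
by have := execution (drop0 _) hn; rewrite exi => -[m hm]; exists (m + n); rewrite /run iterD.
Qed.

End Correctness.
End Determinize.

Lemma definable1_halts X p : definable1 X p -> exists e, forall j, halts e X j <-> p j.
Proof.
move=> /definable1_nfa[N hN]; exists (choice.pickle (det_otm N)) => j; rewrite -hN -det_otm_halts.
rewrite /halts /halts_within /Phi_run /machine choice.pickleK /=.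
by split=> -[s hs]; exists s; apply/eqP.
Qed.

(** * Enumerable predicates and computable functions *)

Ltac definable_var :=
  eexists; [|let e := fresh in intro e; rewrite -?nth0 ?nth_behead; reflexivity]; done.

Ltac definable_tac := repeat (cbv beta; first
  [ match goal with H : definable1 _ _ |- _ =>
      let H' := fresh in
      pose proof (fun k a => @definable_subst _ k _ a H) as H'; cbv beta in H'; eapply H';
        clear H' end
  | apply: definable_true | apply: definable_and | apply: definable_ex | apply: definable_cpair |
    apply: definable_succ
  | apply: definable_zero | apply: definable_reach
  | definable_var ]).

Section Const.
Variable X : nat -> bool.

Lemma definable_const k a c : isvar k a -> definable X k (fun e => a e = c).
Proof.
elim: c k a => [|c IH] k a va; first exact: definable_zero.
apply: (@definable_ext X k (fun e => exists v, v = c /\ a e = v.+1)).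
  by move=> e; split=> [[v [-> ->]]|->] //; exists c.
case: va => i ik aE; apply: definable_ex; apply: definable_and; first by apply: IH; definable_var.
apply: definable_succ; first by definable_var.
by exists i.+1 => // e; rewrite aE nth_behead.
Qed.

Lemma definable1_false : definable1 X (fun=> False).
Proof.
apply: (@definable_ext X 1 (fun e => head 0 e = (head 0 e).+1)); first by move=> e; split=> //; lia.
by apply: definable_succ; definable_var.
Qed.

Lemma definable1_mem (s : seq nat) : definable1 X (fun n => n \in s).
Proof.
elim: s => [|c s IH]; first by apply: definable_ext definable1_false.
apply: (@definable_ext X 1 (fun e => head 0 e = c \/ head 0 e \in s)).
  by move=> e; rewrite inE; split=> [[->|->]|/orP[/eqP|]]; rewrite ?eqxx ?orbT; auto.
by apply: definable_or; [apply: definable_const; definable_var | exact: IH].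
Qed.

End Const.

(** [code_re] makes the range of the coding enumerable from every oracle, so that a quantifier over
    the type becomes a quantifier over numbers; no decoding function is asked for. *)
Class enc (A : Type) := Enc {
  code : A -> nat;
  code_inj : injective code;
  code_re : forall X, definable1 X (fun n => exists a, code a = n) }.

#[local] Instance enc_nat : enc nat.
Proof.
apply: (@Enc nat id) => // X.
apply: (@definable_ext X 1 (fun=> True)); last exact: definable_true.
by move=> e; split=> // _; exists (head 0 e).
Defined.

Definition enc_fin (T : finType) : enc T.
Proof.
apply: (@Enc T (fun x => enum_rank x)) => [x y /val_inj/enum_rank_inj//|X].
apply: definable_ext (@definable1_mem X [seq (enum_rank x : nat) | x <- enum T]) => e.
split=> [/mapP[x _ ->]|[x <-]]; first by exists x.
by apply: map_f; rewrite mem_enum.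
Defined.

#[local] Instance enc_bool : enc bool := enc_fin bool.

Lemma definable1_code_prod A B (encA : enc A) (encB : enc B) X :
  definable1 X (fun n => exists a : A * B, cpair (code a.1) (code a.2) = n).
Proof.
have hA := @code_re A encA X; have hB := @code_re B encB X.
apply: (@definable_ext X 1 (fun e => exists x, exists y, (exists a : A, code a = x) /\
   (exists b : B, code b = y) /\ head 0 e = cpair x y)); last by definable_tac.
move=> e; split=> [[_ [_ [[a <-] [[b <-] ->]]]]|[[a b] <-]]; first by exists (a, b).
by exists (code a), (code b); split; [exists a | split; [exists b|]].
Qed.

#[local] Instance enc_prod A B (encA : enc A) (encB : enc B) : enc (A * B).
Proof.
apply: (@Enc _ (fun ab => cpair (code ab.1) (code ab.2))) => [[a b] [a' b'] /= e|X].
  by have [e1 e2] := cpair_inj e; rewrite (code_inj e1) (code_inj e2).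
exact: definable1_code_prod.
Defined.

Fixpoint code_seq A (encA : enc A) (s : seq A) : nat :=
  if s is x :: s' then (cpair (code x) (code_seq encA s')).+1 else 0.

(** A number codes a list exactly when peeling off heads leads down to 0, which is a reachability
    statement. *)
Lemma definable1_code_seq A (encA : enc A) X : definable1 X (fun n => exists s,
  code_seq encA s = n).
Proof.
have hA := @code_re A encA X.
pose R (n y : nat) := exists x, (exists a : A, @code A encA a = x) /\ exists m, m = cpair x y /\
  n = m.+1.
apply: (@definable_ext X 1 (fun e => exists z, z = 0 /\ star R (head 0 e) z)); last first.
  by rewrite /R; definable_tac.
move=> e; move: (head 0 e) => n {e}; split=> [[z [z0 st]]|[s <-]].
  move: z0; elim: st => [x -> |x y w [_ [[a <-] [m [-> ->]]]] _ IH /IH[s <-]].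
    by exists [::].
  by exists (a :: s).
exists 0; split=> //; elim: s => [|a s IH] /=; first exact: rt1n_refl.
apply: rt1n_trans IH; exists (code a); split; first by exists a.
by eexists; split; first reflexivity.
Qed.

#[local] Instance enc_seq A (encA : enc A) : enc (seq A).
Proof.
apply: (@Enc _ (code_seq encA)) => [s t|]; last exact: definable1_code_seq.
by elim: s t => [|x s IH] [|y t] //= [/cpair_inj[e /IH->]]; rewrite (code_inj e).
Defined.

Section Layer.
Variable X : nat -> bool.

Definition enumerable A {encA : enc A} (P : A -> Prop) :=
  definable1 X (fun n => exists a, code a = n /\ P a).

(* For a total function an enumerable graph amounts to computability. *)
Definition computable A B {encA : enc A} {encB : enc B} (f : A -> B) :=
  enumerable (fun ab : A * B => ab.2 = f ab.1).

Section Closure.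
Context A B C S (encA : enc A) (encB : enc B) (encC : enc C) (encS : enc S).

Lemma enumerable_ext (P Q : A -> Prop) : (forall a, P a <-> Q a) -> enumerable P -> enumerable Q.
Proof.
by move=> PQ; apply: definable_ext => e; split=> -[a [ea /PQ Pa]]; exists a.
Qed.

Lemma enumerable_and (P Q : A -> Prop) : enumerable P -> enumerable Q -> enumerable (fun a =>
  P a /\ Q a).
Proof.
move=> hP hQ; apply: definable_ext (definable_and hP hQ) => e; split=>
  [[[a [<- Pa]] [b [/(@code_inj A encA)-> Qb]]]|].
  by exists a.
by move=> [a [ea [Pa Qa]]]; split; exists a.
Qed.

Lemma enumerable_or (P Q : A -> Prop) : enumerable P -> enumerable Q -> enumerable (fun a =>
  P a \/ Q a).
Proof.
move=> hP hQ; apply: definable_ext (definable_or hP hQ) => e; split=> [[[a [<- Pa]]|[a [<- Qa]]]|].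
- by exists a; auto.
- by exists a; auto.
- by move=> [a [ea [Pa|Qa]]]; [left|right]; exists a.
Qed.

Lemma enumerable_true : enumerable (fun _ : A => True).
Proof.
by apply: definable_ext (@code_re A encA X) => e; split=> [[a <-]|[a [<- _]]]; exists a.
Qed.

Lemma enumerable_false : enumerable (fun _ : A => False).
Proof. by apply: definable_ext (definable1_false X) => e; split=> // -[a []]. Qed.

Lemma enumerable_ex (P : A -> B -> Prop) : enumerable (fun ab : A * B => P ab.1 ab.2) ->
  enumerable (fun a => exists b, P a b).
Proof.
rewrite /enumerable; set p := (X in definable1 _ X -> _) => h.
have hA := @code_re A encA X.
apply: (@definable_ext X 1 (fun e => exists y, exists m, m = cpair (head 0 e) y /\ p m)).
  move=> e; split.
    move=> [y [_ [-> [[a b] [/= /cpair_inj[<- _] Pab]]]]]; exists a; split=> //.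
    by exists b.
  move=> [a [<- [b Pab]]]; exists (code b); eexists; split; first reflexivity.
  by exists (a, b).
by definable_tac.
Qed.

Lemma enumerable_comp (P : B -> Prop) (f : A -> B) : computable f -> enumerable P ->
  enumerable (fun a => P (f a)).
Proof.
rewrite /computable /enumerable; set g := (X in definable1 _ X -> _); set p := (X in _ ->
  definable1 _ X -> _) => hf hP.
apply: (@definable_ext X 1 (fun e => exists y, exists m, m = cpair (head 0 e) y /\ g m /\ p y)).
  move=> e; split.
    move=> [y [_ [-> [[[a b] [/= /cpair_inj[<- <-] ->]] [c [/(@code_inj B encB)-> Pc]]]]]].
    by exists a.
  move=> [a [<- Pa]]; exists (code (f a)); eexists; split; first reflexivity.
  by split; [exists (a, f a) | exists (f a)].
by definable_tac.
Qed.

Lemma computable_fst : computable (@fst A B).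
Proof.
have hA := @code_re A encA X; have hB := @code_re B encB X.
apply: (@definable_ext X 1 (fun e => exists x, exists y, exists p, (exists a : A, code a = x) /\
   (exists b : B, code b = y) /\ p = cpair x y /\ head 0 e = cpair p x)); last by definable_tac.
move=> e; split.
  by move=> [_ [_ [_ [[a <-] [[b <-] [-> ->]]]]]]; exists ((a, b), a).
move=> [[[a b] a'] [<- /= ->]]; exists (code a), (code b); eexists.
by split; [exists a | split; [exists b | split; first reflexivity]].
Qed.

Lemma computable_snd : computable (@snd A B).
Proof.
have hA := @code_re A encA X; have hB := @code_re B encB X.
apply: (@definable_ext X 1 (fun e => exists x, exists y, exists p, (exists a : A, code a = x) /\
   (exists b : B, code b = y) /\ p = cpair x y /\ head 0 e = cpair p y)); last by definable_tac.
move=> e; split.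
  by move=> [_ [_ [_ [[a <-] [[b <-] [-> ->]]]]]]; exists ((a, b), b).
move=> [[[a b] a'] [<- /= ->]]; exists (code a), (code b); eexists.
by split; [exists a | split; [exists b | split; first reflexivity]].
Qed.

Lemma computable_pair (f : A -> B) (g : A -> C) : computable f -> computable g ->
  computable (fun a => (f a, g a)).
Proof.
rewrite /computable /enumerable; set pf := (X in definable1 _ X -> _); set pg := (X in _ ->
  definable1 _ X -> _) => hf hg.
apply: (@definable_ext X 1 (fun e => exists x, exists y, exists z, exists yz, exists xy, exists xz,
  head 0 e = cpair x yz /\ yz = cpair y z /\ xy = cpair x y /\ xz = cpair x z /\ pf xy /\ pg xz)).
  move=> e; split.
    move=> [x [y [z [_ [xy [xz [-> [-> [exy [exz [[[a b] [/= e1 e2]] [[a' c] [/= e3 e4]]]]]]]]]]]]].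
    move: e1 e3; rewrite exy exz e2 e4 => /cpair_inj[<- <-] /cpair_inj[/(@code_inj A encA)-> <-].
    by exists (a, (f a, g a)).
  move=> [[a bc] [<- /= ->]]; exists (code a), (code (f a)), (code (g a)).
  do 3!eexists; do 4!(split; first reflexivity).
  by split; [exists (a, f a) | exists (a, g a)].
by definable_tac.
Qed.

Lemma computable_comp (g : B -> C) (f : A -> B) : computable g -> computable f ->
  computable (fun a => g (f a)).
Proof.
rewrite /computable /enumerable; set pg := (X in definable1 _ X -> _); set pf := (X in _ ->
  definable1 _ X -> _) => hg hf.
apply: (@definable_ext X 1 (fun e => exists x, exists y, exists z, exists xy, exists yz,
  head 0 e = cpair x z /\ xy = cpair x y /\ yz = cpair y z /\ pf xy /\ pg yz)).
  move=> e; split.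
    move=> [x [y [z [xy [yz [-> [exy [eyz [[[a b] [/= e1 e2]] [[b' c] [/= e3 e4]]]]]]]]]]].
    move: e1 e3; rewrite exy eyz e2 e4 => /cpair_inj[<- <-] /cpair_inj[/(@code_inj B encB)-> <-].
    by exists (a, g (f a)).
  move=> [[a c] [<- /= ->]]; exists (code a), (code (f a)), (code (g (f a))).
  do 2!eexists; do 3!(split; first reflexivity).
  by split; [exists (a, f a) | exists (f a, g (f a))].
by definable_tac.
Qed.

Lemma computable_id : computable (fun a : A => a).
Proof.
have hA := @code_re A encA X.
apply: (@definable_ext X 1 (fun e => exists x, (exists a : A, code a = x) /\ head 0 e = cpair x x)).
  move=> e; split=> [[_ [[a <-] ->]]|[[a b] [<- /= ->]]]; first by exists (a, a).
  by exists (code a); split; first by exists a.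
by definable_tac.
Qed.

Lemma computable_const (b : B) : computable (fun _ : A => b).
Proof.
have hA := @code_re A encA X.
apply: (@definable_ext X 1 (fun e => exists x, exists y, y = code b /\ (exists a : A,
  code a = x) /\ 
   head 0 e = cpair x y)).
  move=> e; split=> [[_ [_ [-> [[a <-] ->]]]]|[[a b'] [<- /= ->]]]; first by exists (a, b).
  by exists (code a), (code b); split=> //; split; first by exists a.
apply: definable_ex; apply: definable_ex; apply: definable_and; first by apply: definable_const;
  definable_var.
by definable_tac.
Qed.

(** The steps are taken between codes; since the relation on codes only links codes of elements,
    runs on codes lift to runs on elements. *)
Lemma enumerable_star (R : A -> S -> S -> Prop) : enumerable (fun q : A * (S * S) =>
  R q.1 q.2.1 q.2.2) ->
  enumerable (fun q : A * (S * S) => star (R q.1) q.2.1 q.2.2).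
Proof.
rewrite /enumerable; set p := (X in definable1 _ X -> _) => hR.
have hA := @code_re A encA X; have hS := @code_re S encS X.
apply: (@definable_ext X 1 (fun e => exists x, exists y, exists z, exists yz,
  head 0 e = cpair x yz /\ yz = cpair y z /\ (exists a : A, code a = x) /\ (exists a, code a = y) /\
  (exists a, code a = z) /\ star (fun u v => exists uv, exists m, uv = cpair u v /\
    m = cpair x uv /\ p m) y z)).
  move=> e; split.
    move=> [_ [_ [_ [_ [-> [-> [[a <-] [[s <-] [[t <-] st]]]]]]]]].
    exists (a, (s, t)); split=> //=.
    move: st; set Q := (X in star X) => st.
    have gen u v : star Q u v -> forall s t, code s = u -> code t = v -> star (R a) s t; last first.
      exact: gen st _ _ erefl erefl.
    move=> {}st; elim: st => [{}u {}s {}t <- /(@code_inj S encS)->|u1 u2 u3];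
      first exact: rt1n_refl.
    move=> [_ [_ [-> [-> [[a' [s1 s2]] [/= + R12]]]]]] _ IH {}s {}t es et; move: es.
    move=> es /cpair_inj[/(@code_inj A encA) ea /cpair_inj[es1 es2]].
    have ? : s1 = s by apply: code_inj; rewrite es1.
    by subst s1 a'; apply: rt1n_trans R12 _; apply: IH; rewrite // es2.
  move=> [[a [s t]] [<- /= st]].
  exists (code a), (code s), (code t); eexists; do 2!(split; first reflexivity).
  split; first by exists a. split; first by exists s. split; first by exists t.
  apply: (star_map (f := code)) st => u v Ruv.
  by do 2!eexists; do 2!(split; first reflexivity); exists (a, (u, v)).
by definable_tac.
Qed.

End Closure.
End Layer.

Arguments enumerable X {A encA} P.
Arguments computable X {A B encA encB} f.

(** * Computable functions on coded data *)

Section Basic.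
Context {X : nat -> bool}.
Context {A B C D : Type} {encA : enc A} {encB : enc B} {encC : enc C} {encD : enc D}.
Local Notation enumerable := (enumerable X).
Local Notation computable := (computable X).

Lemma computable_ext (f g : A -> B) : f =1 g -> computable f -> computable g.
Proof. by move=> fg; apply: enumerable_ext => -[a b] /=; rewrite fg. Qed.

Lemma computable_proj1 (f : A -> B * C) : computable f -> computable (fun a => (f a).1).
Proof. exact: computable_comp (computable_fst _ _ _). Qed.

Lemma computable_proj2 (f : A -> B * C) : computable f -> computable (fun a => (f a).2).
Proof. exact: computable_comp (computable_snd _ _ _). Qed.

Lemma computable2 (f : A -> B -> C) (g : D -> A) (h : D -> B) :
  computable (fun ab => f ab.1 ab.2) -> computable g -> computable h -> computable (fun d =>
    f (g d) (h d)).
Proof. by move=> hf hg hh; have := computable_comp hf (computable_pair hg hh). Qed.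

Lemma enumerable_eq (f g : A -> B) : computable f -> computable g -> enumerable (fun a =>
  f a = g a).
Proof.
move=> hf hg; have := enumerable_ex (P := fun a b => b = f a /\ b = g a) (enumerable_and hf hg).
by apply: enumerable_ext => a; split=> [[b [<- <-]]|<-] //; exists (f a).
Qed.

Lemma computable_succ (f : A -> nat) : computable f -> computable (fun a => (f a).+1).
Proof.
apply: computable_comp.
apply: (@definable_ext X 1 (fun e => exists x, exists y, y = x.+1 /\ head 0 e = cpair x y)).
  move=> e; split=> [[x [_ [-> ->]]]|[[x y] [<- /= ->]]]; first by exists (x, x.+1).
  by exists x, x.+1.
by definable_tac.
Qed.

Lemma enumerable_query b (f : A -> nat) : computable f -> enumerable (fun a => X (f a) = b).
Proof.
move=> hf; apply: (enumerable_comp (P := fun n => X n = b) hf).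
apply: (@definable_ext X 1 (fun e => X (head 0 e) = b)).
  by move=> e; split=> [h|[a [<-]]] //; exists (head 0 e).
by apply: definable_query; definable_var.
Qed.

Lemma computable_cons (f : A -> B) (g : A -> seq B) : computable f -> computable g ->
  computable (fun a => f a :: g a).
Proof.
move=> hf hg.
have h : computable (fun xs : B * seq B => xs.1 :: xs.2);
  last exact: computable_comp h (computable_pair hf hg).
have hB := @code_re B encB X; have hs := definable1_code_seq encB X.
apply: (@definable_ext X 1 (fun e => exists x, exists y, exists p, exists z, (exists b : B,
  code b = x) /\
   (exists s : seq B, code_seq encB s = y) /\ p = cpair x y /\ z = p.+1 /\ head 0 e = cpair p z)).
  move=> e; split.
    by move=> [_ [_ [_ [_ [[b <-] [[s <-] [-> [-> ->]]]]]]]]; exists ((b, s), b :: s).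
  move=> [[[b s] t] [<- /= ->]]; exists (code b), (code s); do 2!eexists.
  by split; [exists b | split; [exists s | do 2!(split; first reflexivity)]].
by definable_tac.
Qed.

Lemma enumerable_fin_ex (T : finType) (P : T -> A -> Prop) : (forall t, enumerable (P t)) ->
  enumerable (fun a => exists t, P t a).
Proof.
move=> h; have : enumerable (fun a => exists2 t, t \in enum T & P t a).
  elim: (enum T) => [|t s IH]; first by apply: enumerable_ext (enumerable_false X encA) => a;
    split=> // -[].
  apply: enumerable_ext (enumerable_or (h t) IH) => a; split=> [[Pt|[u us Pu]]|[u]].
  - by exists t; rewrite ?mem_head.
  - by exists u; rewrite ?inE ?us ?orbT.
  - by rewrite inE => /orP[/eqP->|us Pu]; auto; right; exists u.
by apply: enumerable_ext => a; split=> [[t _ Pt]|[t Pt]]; exists t; rewrite ?mem_enum.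
Qed.

Lemma enumerable_fin_all (T : finType) (P : T -> A -> Prop) : (forall t, enumerable (P t)) ->
  enumerable (fun a => forall t, P t a).
Proof.
move=> h; have : enumerable (fun a => forall t, t \in enum T -> P t a).
  elim: (enum T) => [|t s IH]; first by apply: enumerable_ext (enumerable_true X encA) => a; split.
  apply: enumerable_ext (enumerable_and (h t) IH) => a; split=> [[Pt Ps] u|H].
  - by rewrite inE => /orP[/eqP->|/Ps].
  - by split=> [|u us]; apply: H; rewrite inE ?eqxx ?us ?orbT.
by apply: enumerable_ext => a; split=> H t; [apply: H; rewrite mem_enum | move=> _; apply: H].
Qed.

(** Nothing is decided uniformly: by excluded middle the set is everything or empty. Hence arbitrary
    information about a finite type can be built into a program. *)
Lemma enumerable_prop (P : Prop) : enumerable (fun _ : A => P).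
Proof.
case: (pselect P) => p; first by apply: enumerable_ext (enumerable_true X encA).
by apply: enumerable_ext (enumerable_false X encA).
Qed.

End Basic.

Section Fin.
Context {X : nat -> bool} {A B : Type} {encA : enc A} {encB : enc B}.
Variable T : finType.
#[local] Existing Instance enc_fin.
Local Notation enumerable := (enumerable X).
Local Notation computable := (computable X).

Lemma enumerable_fin (P : T -> Prop) : enumerable P.
Proof.
have h : enumerable (fun t : T => exists u, t = u /\ P u).
  by apply: enumerable_fin_ex => u; apply: enumerable_and;
    [apply: enumerable_eq (computable_id _ _) (computable_const _ _ _ _) | apply: enumerable_prop].
by apply: enumerable_ext h => t; split=> [[u [-> //]]|]; exists t.
Qed.

Lemma computable_fin_case (key : A -> T) (f : T -> A -> B) : computable key -> (forall t,
  computable (f t)) ->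
  computable (fun a => f (key a) a).
Proof.
move=> hk hf.
have h : enumerable (fun ab : A * B => exists t, key ab.1 = t /\ ab.2 = f t ab.1).
  apply: enumerable_fin_ex => t; apply: enumerable_and (hf t).
  exact: enumerable_eq (computable_comp hk (computable_fst _ _ _)) (computable_const _ _ _ _).
by apply: enumerable_ext h => ab; split=> [[t [-> //]]|]; exists (key ab.1).
Qed.

Lemma computable_fin (f : A -> T) : (forall t, enumerable (fun a => f a = t)) -> computable f.
Proof.
move=> hf.
have h : enumerable (fun ab : A * T => exists t, ab.2 = t /\ f ab.1 = t).
  apply: enumerable_fin_ex => t; apply: enumerable_and.
    exact: enumerable_eq (computable_snd _ _ _) (computable_const _ _ _ _).
  exact: (enumerable_comp (P := fun a => f a = t) (computable_fst _ _ _) (hf t)).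
by apply: enumerable_ext h => ab; split=> [[t [-> //]]|->]; exists (f ab.1).
Qed.

End Fin.

Ltac computable_step := first
  [ eassumption | eapply computable_id | eapply computable_const | eapply computable_pair | eapply
    computable_proj1
  | eapply computable_proj2 | eapply computable_succ | eapply computable_cons
  | match goal with H : computable _ _ |- _ =>
    first [eapply (computable2 H) | eapply (computable_comp H)] end ].
Ltac computable_tac := repeat (cbv beta; computable_step).

Arguments computable_id X {A encA}.
Arguments computable_const X {A B encA encB} b.
(** The graph is reachability from (0, g a) under the step that counts rounds while applying [f a];
    the counter singles out round [n a]. *)
Lemma computable_iter X A B {encA : enc A} {encB : enc B} (n : A -> nat) (f : A -> B ->
  B) (g : A -> B) :
  computable X n -> computable X (fun ab => f ab.1 ab.2) -> computable X g ->
  computable X (fun a => iter (n a) (f a) (g a)).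
Proof.
move=> hn hf hg.
have h : enumerable X (fun q : A * ((nat * B) * (nat * B)) => 
   star (fun s t : nat * B => t = (s.1.+1, f q.1 s.2)) q.2.1 q.2.2).
  apply: (enumerable_star (R := fun a (s t : nat * B) => t = (s.1.+1, f a s.2))).
  by apply: enumerable_eq; computable_tac.
have h2 : computable X (fun ab : A * B => (ab.1, ((0, g ab.1), (n ab.1, ab.2)))) by computable_tac.
apply: enumerable_ext (enumerable_comp h2 h) => -[a b] /=; split.
  have gen s t : star (fun s t : nat * B => t = (s.1.+1, f a s.2)) s t ->
      s.1 <= t.1 /\ t.2 = iter (t.1 - s.1) (f a) s.2.
    elim=> [x|x y z -> _ [/= l1 ->]]; first by rewrite subnn leqnn.
    by split; [exact: ltnW|rewrite -(subnSK l1) iterSr].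
  by move=> /gen[_]; rewrite subn0.
move=> ->; elim: (n a) => [|k IH]; first exact: rt1n_refl.
by apply: star_trans IH _; apply: star_step.
Qed.

Lemma computable_foldl X A B C {encA : enc A} {encB : enc B} {encC : enc C} (s : A ->
  seq C) (f : A -> B -> C -> B) (g : A -> B) :
  computable X s -> computable X (fun abc : A * (B * C) => f abc.1 abc.2.1 abc.2.2) ->
    computable X g ->
  computable X (fun a => foldl (f a) (g a) (s a)).
Proof.
move=> hs hf hg; pose R a (s t : seq C * B) := exists c, s.1 = c :: t.1 /\ t.2 = f a s.2 c.
have h : enumerable X (fun q : A * ((seq C * B) * (seq C * B)) => star (R q.1) q.2.1 q.2.2).
  apply: enumerable_star.
  apply: enumerable_ex; apply: enumerable_and; apply: enumerable_eq; computable_tac.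
  have hh : computable X (fun ab : A * (seq C * B * (seq C * B)) * C => (ab.1.1, (ab.1.2.1.2,
    ab.2))) by computable_tac.
  exact: computable_comp hf hh.
have h2 : computable X (fun ab : A * B => (ab.1, ((s ab.1, g ab.1), ([::] : seq C,
  ab.2)))) by computable_tac.
apply: enumerable_ext (enumerable_comp h2 h) => -[a b] /=; split.
  have gen u t : star (R a) u t -> t.1 = [::] -> t.2 = foldl (f a) u.2 u.1.
    elim=> [x ->//|x y z [c [-> e2]] _ IH /IH->] /=; by rewrite e2.
  by move=> /gen; apply.
move=> ->; elim: (s a) (g a) => [|c u IH] v; first exact: rt1n_refl.
by apply: rt1n_trans (IH _); exists c.
Qed.

Lemma computable_bool X A {encA : enc A} (f : A -> bool) : enumerable X (fun a => f a) ->
  enumerable X (fun a => ~ f a) -> computable X f.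
Proof.
move=> ht hf; apply: computable_fin => -[]; first exact: ht.
by apply: enumerable_ext hf => a; case: (f a); split.
Qed.

Lemma enumerable_bool X A {encA : enc A} (f : A -> bool) : computable X f -> enumerable X (fun a =>
  f a).
Proof. by move=> hf; apply: (enumerable_eq hf (computable_const _ true)). Qed.

Lemma computable_if X A B {encA : enc A} {encB : enc B} (c : A -> bool) (f g : A ->
  B) : computable X c -> computable X f -> computable X g ->
  computable X (fun a => if c a then f a else g a).
Proof.
by move=> hc hf hg; apply: (computable_fin_case (T := bool) (f := fun b a =>
  if b then f a else g a)) => // -[].
Qed.

Lemma computable_and X A {encA : enc A} (f g : A -> bool) : computable X f -> computable X g ->
  computable X (fun a => f a && g a).
Proof. by move=> hf hg; exact: computable_if hf hg (computable_const _ false). Qed.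

Lemma computable_not X A {encA : enc A} (f : A -> bool) : computable X f -> computable X (fun a =>
  ~~ f a).
Proof. by move=> hf;
  exact: computable_if hf (computable_const _ false) (computable_const _ true). Qed.

Lemma computable_imp X A {encA : enc A} (f g : A -> bool) : computable X f -> computable X g ->
  computable X (fun a => f a ==> g a).
Proof. by move=> hf hg; exact: computable_if hf hg (computable_const _ true). Qed.

Lemma computable_add X A {encA : enc A} (f g : A -> nat) : computable X f -> computable X g ->
  computable X (fun a => f a + g a).
Proof.
move=> hf hg; apply: computable_ext (computable_iter hf (f := fun _ => succn) _ hg) => [a|].
  by rewrite iter_succn addnC.
by computable_tac.
Qed.

Lemma computable_mul X A {encA : enc A} (f g : A -> nat) : computable X f -> computable X g ->
  computable X (fun a => f a * g a).
Proof.
move=> hf hg; have h0 : computable X (fun _ : A => 0) by computable_tac.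
apply: computable_ext (computable_iter hf (f := fun a => addn (g a)) _ h0) => [a|].
  by rewrite iter_addn_0 mulnC.
by apply: computable_add; computable_tac.
Qed.

Lemma computable_exp2 X A {encA : enc A} (f : A -> nat) : computable X f -> computable X (fun a =>
  2 ^ f a).
Proof.
move=> hf; have h1 : computable X (fun _ : A => 1) by computable_tac.
apply: computable_ext (computable_iter hf (f := fun _ => muln 2) _ h1) => [a|].
  by rewrite iter_muln_1.
by apply: computable_mul; computable_tac.
Qed.

Lemma computable_double X A {encA : enc A} (f : A -> nat) : computable X f ->
  computable X (fun a => (f a).*2).
Proof.
by move=> hf; apply: computable_ext (computable_add hf hf) => a; rewrite addnn.
Qed.

Lemma computable_pred X A {encA : enc A} (f : A -> nat) : computable X f -> computable X (fun a =>
  (f a).-1).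
Proof.
move=> hf; have h : enumerable X (fun ab : A * nat => (f ab.1 = 0 /\ ab.2 = 0) \/ f ab.1 = ab.2.+1).
  by apply: enumerable_or; [apply: enumerable_and|]; apply: enumerable_eq; computable_tac.
by apply: enumerable_ext h => -[a b] /=; lia.
Qed.

Lemma computable_half X A {encA : enc A} (f : A -> nat) : computable X f -> computable X (fun a =>
  (f a)./2).
Proof.
move=> hf; have h : enumerable X (fun ab : A * nat => f ab.1 = ab.2.*2 \/ f ab.1 = ab.2.*2.+1).
  by apply: enumerable_or; apply: enumerable_eq; computable_tac; apply: computable_double;
    computable_tac.
by apply: enumerable_ext h => -[a b] /=; lia.
Qed.

Lemma computable_odd X A {encA : enc A} (f : A -> nat) : computable X f -> computable X (fun a =>
  odd (f a)).
Proof.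
move=> hf; have h0 : computable X (fun _ : A => false) by computable_tac.
apply: computable_ext (computable_iter hf (f := fun _ => negb) _ h0) => [a|].
  by elim: (f a) => //= n ->.
by apply: computable_not; computable_tac.
Qed.

Lemma computable_leq X A {encA : enc A} (f g : A -> nat) : computable X f -> computable X g ->
  computable X (fun a => f a <= g a).
Proof.
move=> hf hg; apply: computable_bool.
  have h : enumerable X (fun a => exists k, g a = f a + k).
    by apply: enumerable_ex; apply: enumerable_eq; computable_tac; apply: computable_add;
      computable_tac.
  apply: enumerable_ext h => a; split=> [[k ->]|le]; first exact: leq_addr.
  by exists (g a - f a); rewrite subnKC.
have h : enumerable X (fun a => exists k, f a = (g a + k).+1).
  by apply: enumerable_ex; apply: enumerable_eq; computable_tac; apply: computable_add;
    computable_tac.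
apply: enumerable_ext h => a; split=> [[k ->]|/negP]; first by apply/negP;
  rewrite -ltnNge ltnS leq_addr.
by rewrite -ltnNge => lt; exists (f a - g a).-1; lia.
Qed.

Lemma computable_eqn X A {encA : enc A} (f g : A -> nat) : computable X f -> computable X g ->
  computable X (fun a => f a == g a).
Proof.
move=> hf hg; apply: computable_ext (computable_and (computable_leq hf hg) (computable_leq hg hf))
  => a.
by rewrite eqn_leq.
Qed.

Lemma computable_comp2 X A B C D {encA : enc A} {encB : enc B} {encC : enc C} {encD : enc D}
    (f : A -> B -> C -> C) (g : D -> A) (h : D -> B) (k : D -> C) :
  computable X (fun abc : A * (B * C) => f abc.1 abc.2.1 abc.2.2) -> computable X g ->
    computable X h -> computable X k ->
  computable X (fun d => f (g d) (h d) (k d)).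
Proof.
by move=> hf hg hh hk; have := computable_comp hf (computable_pair hg (computable_pair hh hk)).
Qed.

Ltac computable_step ::= first
  [ eassumption | eapply computable_id | eapply computable_const | eapply computable_pair | eapply
    computable_proj1
  | eapply computable_proj2 | eapply computable_succ | eapply computable_cons
  | eapply computable_and | eapply computable_not | eapply computable_imp
  | eapply computable_add | eapply computable_mul | eapply computable_exp2 | eapply
    computable_double
  | eapply computable_half | eapply computable_pred | eapply computable_odd | eapply computable_leq
    | eapply computable_eqn
  | eapply computable_if
  | match goal with H : computable _ _ |- _ =>
      first [eapply (computable_comp2 H) | eapply (computable2 H) | eapply (computable_comp H)] end
        ].

Lemma computable_rev X A B {encA : enc A} {encB : enc B} (s : A -> seq B) :
  computable X s -> computable X (fun a => rev (s a)).
Proof.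
move=> hs; have h0 : computable X (fun _ : A => [::] : seq B) by computable_tac.
apply: computable_ext (computable_foldl (f := fun (_ : A) t x => x :: t) hs _ h0) => [a|];
  last by computable_tac.
by rewrite /rev; elim: (s a) [::] => //= x t IH u.
Qed.

Lemma computable_foldr X A B C {encA : enc A} {encB : enc B} {encC : enc C}
    (s : A -> seq B) (f : A -> B -> C -> C) (z : A -> C) :
  computable X s -> computable X (fun abc : A * (B * C) => f abc.1 abc.2.1 abc.2.2) ->
    computable X z ->
  computable X (fun a => foldr (f a) (z a) (s a)).
Proof.
move=> hs hf hz.
apply: computable_ext (computable_foldl (f := fun a c b => f a b c) (computable_rev hs) _ hz) =>
  [a|]; last by computable_tac.
by rewrite foldl_rev.
Qed.

Lemma computable_map X A B C {encA : enc A} {encB : enc B} {encC : enc C}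
    (s : A -> seq B) (f : A -> B -> C) :
  computable X s -> computable X (fun ab => f ab.1 ab.2) -> computable X (fun a =>
    [seq f a x | x <- s a]).
Proof.
move=> hs hf; have h0 : computable X (fun _ : A => [::] : seq C) by computable_tac.
apply: computable_ext (computable_foldr (f := fun a x t => f a x :: t) hs _ h0) => [a|];
  last by computable_tac.
by elim: (s a) => //= x t ->.
Qed.

Lemma computable_cat X A B {encA : enc A} {encB : enc B} (s t : A -> seq B) :
  computable X s -> computable X t -> computable X (fun a => s a ++ t a).
Proof.
move=> hs ht.
apply: computable_ext (computable_foldr (f := fun _ x u => x :: u) hs _ ht) => [a|];
  last by computable_tac.
by elim: (s a) => //= x u ->.
Qed.

Lemma computable_flatten X A B {encA : enc A} {encB : enc B} (s : A -> seq (seq B)) :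
  computable X s -> computable X (fun a => flatten (s a)).
Proof.
move=> hs; have h0 : computable X (fun _ : A => [::] : seq B) by computable_tac.
by apply: (computable_foldr (f := fun _ x u => x ++ u) hs _ h0); apply: computable_cat;
  computable_tac.
Qed.

Lemma computable_all X A B {encA : enc A} {encB : enc B} (s : A -> seq B) (p : A -> B -> bool) :
  computable X s -> computable X (fun ab => p ab.1 ab.2) -> computable X (fun a => all (p a) (s a)).
Proof.
move=> hs hp; have h0 : computable X (fun _ : A => true) by computable_tac.
apply: computable_ext (computable_foldr (f := fun a x b => p a x && b) hs _ h0) => [a|];
  last by computable_tac.
by elim: (s a) => //= x u ->.
Qed.

Lemma computable_find X A B {encA : enc A} {encB : enc B} (s : A -> seq B) (p : A -> B -> bool) :
  computable X s -> computable X (fun ab => p ab.1 ab.2) -> computable X (fun a =>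
    find (p a) (s a)).
Proof.
move=> hs hp; have h0 : computable X (fun _ : A => 0) by computable_tac.
apply: computable_ext (computable_foldr (f := fun a x n => if p a x then 0 else n.+1) hs _ h0) =>
  [a|]; last by computable_tac.
by elim: (s a) => //= x u ->.
Qed.

Lemma computable_size X A B {encA : enc A} {encB : enc B} (s : A -> seq B) :
  computable X s -> computable X (fun a => size (s a)).
Proof.
move=> hs; have h0 : computable X (fun _ : A => 0) by computable_tac.
apply: computable_ext (computable_foldr (f := fun _ _ n => n.+1) hs _ h0) => [a|];
  last by computable_tac.
by elim: (s a) => //= x u ->.
Qed.

Lemma computable_nseq X A B {encA : enc A} {encB : enc B} (n : A -> nat) (b : A -> B) :
  computable X n -> computable X b -> computable X (fun a => nseq (n a) (b a)).
Proof.
move=> hn hb; have h0 : computable X (fun _ : A => [::] : seq B) by computable_tac.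
by apply: (computable_iter (f := fun a s => b a :: s) hn _ h0); computable_tac.
Qed.

Lemma computable_iota X A {encA : enc A} (m n : A -> nat) :
  computable X m -> computable X n -> computable X (fun a => iota (m a) (n a)).
Proof.
move=> hm hn; have h0 : computable X (fun _ : A => [::] : seq nat) by computable_tac.
apply: computable_ext (computable_iter (f := fun a s => s ++ [:: m a + size s]) hn _ h0) => [a|].
  by elim: (n a) => // k IH; rewrite iterS IH size_iota -[k.+1]addn1 iotaD.
by apply: computable_cat; computable_tac; apply: computable_size; computable_tac.
Qed.

Lemma computable_behead X A B {encA : enc A} {encB : enc B} (s : A -> seq B) :
  computable X s -> computable X (fun a => behead (s a)).
Proof.
move=> hs.
have h : enumerable X (fun ab : A * seq B => (s ab.1 = [::] /\ ab.2 = [::]) \/ exists b,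
  s ab.1 = b :: ab.2).
  apply: enumerable_or; first by apply: enumerable_and; apply: enumerable_eq; computable_tac.
  by apply: enumerable_ex; apply: enumerable_eq; computable_tac.
apply: enumerable_ext h => -[a t] /=; case: (s a) => [|x u]; split=> //=.
- by case=> [[_ ->]|[b]].
- by move=> ->; left.
- by case=> [[]|[b [_ ->]]].
- by move=> ->; right; exists x.
Qed.

Lemma computable_head X A B {encA : enc A} {encB : enc B} (x0 : B) (s : A -> seq B) :
  computable X s -> computable X (fun a => head x0 (s a)).
Proof.
move=> hs.
have h0 : computable X (fun _ : A => x0) by computable_tac.
by apply: computable_ext (computable_foldr (f := fun _ x _ => x) hs _ h0) => [a|];
  [case: (s a) | computable_tac].
Qed.

Lemma computable_nth X A B {encA : enc A} {encB : enc B} (x0 : B) (s : A -> seq B) (n : A -> nat) :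
  computable X s -> computable X n -> computable X (fun a => nth x0 (s a) (n a)).
Proof.
move=> hs hn.
have h : computable X (fun a => iter (n a) behead (s a)).
  by apply: (computable_iter (f := fun _ => behead) hn _ hs); apply: computable_behead;
    computable_tac.
apply: computable_ext (computable_head x0 h) => a.
by elim: (n a) (s a) => [|k IH] u; rewrite ?nth0 // iterSr IH nth_behead.
Qed.

(** Universal quantification along a list is reachability of the empty list, where each step removes
    the head after [P] has been verified for it. [List.In] avoids asking for decidable equality on
    the type. *)
Lemma enumerable_all_seq X A B {encA : enc A} {encB : enc B} (s : A -> seq B) (P : A -> B -> Prop) :
  computable X s -> enumerable X (fun ab => P ab.1 ab.2) -> enumerable X (fun a => forall x,
    List.In x (s a) -> P a x).
Proof.
move=> hs hP; pose R a (t u : seq B) := exists b, t = b :: u /\ P a b.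
have h : enumerable X (fun q : A * (seq B * seq B) => star (R q.1) q.2.1 q.2.2).
  apply: enumerable_star; apply: enumerable_ex; apply: enumerable_and;
    first by apply: enumerable_eq; computable_tac.
  have hc : computable X (fun q : A * (seq B * seq B) * B => (q.1.1, q.2)) by computable_tac.
  exact: enumerable_comp hc hP.
have h2 : computable X (fun a : A => (a, (s a, [::] : seq B))) by computable_tac.
apply: enumerable_ext (enumerable_comp h2 h) => a /=; split.
  have gen t u : star (R a) t u -> u = [::] -> forall x, List.In x t -> P a x.
    elim=> [x ->//|x y z [b [-> Pb]] _ IH /IH{}IH c /= [<-//|]]; exact: IH.
  by move=> /gen; apply.
elim: (s a) => [|x t IH] H; first exact: rt1n_refl.
apply: rt1n_trans (IH _); first by exists x; split=> //; apply: H; left.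
by move=> y yt; apply: H; right.
Qed.

(** * Oracle machines are computable *)

(** Changes of presentation, such as from a record to a tuple, keep the code, so that on codes their
    graph lies on the diagonal. *)
Lemma computable_code_eq X A B {encA : enc A} {encB : enc B} (f : A -> B) :
  (forall a, code (f a) = code a) -> computable X f.
Proof.
move=> fE; have hA := @code_re A encA X.
apply: (@definable_ext X 1 (fun e => exists x, (exists a : A, code a = x) /\ head 0 e = cpair x x)).
  move=> e; split=> [[_ [[a <-] ->]]|[[a b] [<- /= ->]]].
    by exists (a, f a); rewrite /= fE.
  by exists (code a); split; [exists a | rewrite fE].
by definable_tac.
Qed.

Definition enc_bij A B (encB : enc B) (f : A -> B) (g : B -> A) :
  cancel f g -> cancel g f -> enc A.
Proof.
move=> fK gK; apply: (@Enc A (fun a => code (f a))) => [a b /(@code_inj B encB)|X];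
  first exact: (can_inj fK).
apply: definable_ext (@code_re B encB X) => e; split=> [[b <-]|[a <-]]; last by exists (f a).
by exists (g b); rewrite gK.
Defined.

Section Functions.
Variables (I : finType) (A : Type) (encA : enc A).

Definition fun_seq (f : I -> A) : seq A := [seq f i | i <- enum I].

Lemma fun_seq_inj : injective fun_seq.
Proof.
move=> f g e; apply: funext => i.
by apply: (eq_in_map f g (enum I)).2 e i (mem_enum _ _).
Qed.

Lemma fun_seq_onto s : size s = #|I| -> exists f, fun_seq f = s.
Proof.
case: (pickP (fun _ : I => true)) => [i0 _|I0] ss; last first.
  have en : enum I = [::].
    by case: (enum I) (mem_enum I) => // i u; have := I0 i.
  have s0 : s = [::] by apply: size0nil; rewrite ss cardE en.
  by exists (fun i => match Bool.diff_true_false (I0 i) with end); rewrite /fun_seq en s0.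
case: s ss => [/esym/card0_eq/(_ i0)//|x0 s] ss.
exists (fun i => nth x0 (x0 :: s) (enum_rank i)).
apply: (@eq_from_nth _ x0); first by rewrite size_map -cardE ss.
move=> k; rewrite size_map => lt; rewrite (nth_map i0) //.
congr nth; have lt' : k < #|I| by rewrite cardE.
by rewrite -[k]/(val (Ordinal lt')) -(enum_val_nth i0 (Ordinal lt')) enum_valK.
Qed.

Definition enc_fun : enc (I -> A).
Proof.
apply: (@Enc _ (fun f => code (fun_seq f))) => [f g /(@code_inj _ (enc_seq encA))/fun_seq_inj//|X].
have h : enumerable X (fun s : seq A => size s = #|I|) by apply: enumerable_eq; computable_tac;
  apply: computable_size; computable_tac.
apply: definable_ext h => e; split=> [[s [<- /fun_seq_onto[f <-]]]|[f <-]]; first by exists f.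
by exists (fun_seq f); rewrite size_map -cardE.
Defined.

End Functions.
#[local] Existing Instance enc_fun.

(** The value type may have no default element, so the value is recovered as the head of a tail of
    the list of values. *)
Lemma computable_fun_app X (I : finType) A B {encA : enc A} {encB : enc B} (f : A -> I -> B) i :
  computable X f -> computable X (fun a => f a i).
Proof.
move=> hf.
have hs : computable X (fun a => fun_seq (f a)).
  by apply: computable_comp hf; apply: computable_code_eq.
have h1 : computable X (fun a => iter (index i (enum I)) behead (fun_seq (f a))).
  have h0 : computable X (fun _ : A => index i (enum I)) by computable_tac.
  by apply: (computable_iter (f := fun _ => behead) h0 _ hs); apply: computable_behead;
    computable_tac.
have h : enumerable X (fun ab : A * B => exists t,
    iter (index i (enum I)) behead (fun_seq (f ab.1)) = ab.2 :: t).
  apply: enumerable_ex; apply: enumerable_eq; last by computable_tac.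
  have hp : computable X (fun q : A * B * seq B => q.1.1) by computable_tac.
  exact: computable_comp h1 hp.
apply: enumerable_ext h => -[a b] /=.
have iE : iter (index i (enum I)) behead (fun_seq (f a)) = drop (index i (enum I)) (fun_seq (f a)).
  by elim: (index _ _) => [|k IH]; rewrite ?drop0 //= IH -drop1 drop_drop.
have lt : index i (enum I) < size (fun_seq (f a)) by rewrite size_map index_mem mem_enum.
rewrite iE (drop_nth b lt) (nth_map i) ?index_mem ?mem_enum // nth_index ?mem_enum //.
by split=> [[t [->]]|->] //; eexists.
Qed.

Lemma computable_fun_mk X (I : finType) A B {encA : enc A} {encB : enc B} (f : A -> I -> B) :
  (forall i, computable X (fun a => f a i)) -> computable X f.
Proof.
move=> hf.
have h : enumerable X (fun q : A * (I -> B) => forall i, q.2 i = f q.1 i).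
  apply: enumerable_fin_all => i; apply: enumerable_eq; first by apply: computable_fun_app;
    computable_tac.
  by have := hf i; computable_tac => hi; apply: computable_comp hi _; computable_tac.
by apply: enumerable_ext h => -[a g] /=; split=> [e|-> //]; apply: funext.
Qed.

Section Simulation.
Variables (X : nat -> bool) (M : otm).

#[local] Instance enc_state : enc (option 'I_(otm_states M).+1) := enc_fin _.
#[local] Instance enc_sym : enc 'I_(otm_symbols M).+2 := enc_fin _.
#[local] Instance enc_tape : enc (tape M) :=
  enc_prod (enc_prod (enc_seq enc_sym) enc_sym) (enc_seq enc_sym).

Definition cfg_tuple (c : config M) := (cfg_state c, cfg_tapes c, cfg_oracle c).
Definition tuple_cfg (t : option 'I_(otm_states M).+1 * ('I_(otm_tapes M).+1 -> tape M) * nat) :=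
  Config t.1.1 t.1.2 t.2.
Lemma cfg_tupleK : cancel cfg_tuple tuple_cfg. Proof. by case. Qed.
Lemma tuple_cfgK : cancel tuple_cfg cfg_tuple. Proof. by case=> -[]. Qed.

#[local] Instance enc_config : enc (config M) :=
  enc_bij (enc_prod (enc_prod enc_state (enc_fun _ enc_tape)) enc_nat) cfg_tupleK tuple_cfgK.

Lemma computable_cfg_tuple : computable X cfg_tuple.
Proof. exact: computable_code_eq. Qed.

Lemma computable_tuple_cfg : computable X tuple_cfg.
Proof. by apply: computable_code_eq => -[[s t] o]. Qed.

Variables (A : Type) (encA : enc A).

Lemma computable_tape_move d (t : A -> tape M) : computable X t -> computable X (fun a =>
  tape_move d (t a)).
Proof.
move=> ht.
have h1 : computable X (fun a => (t a).1.1) by computable_tac.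
have h2 : computable X (fun a => (t a).2) by computable_tac.
have h3 := computable_behead h1; have h4 := computable_behead h2.
have h5 := computable_head ord0 h1; have h6 := computable_head ord0 h2.
have h7 : computable X (fun a => (t a).1.2) by computable_tac.
case: d => [[]|].
- have h : computable X (fun a => ((t a).1.2 :: (t a).1.1, head ord0 (t a).2,
  behead (t a).2)) by computable_tac.
  by apply: computable_ext h => a; case: (t a) => -[].
- have h : computable X (fun a => (behead (t a).1.1, head ord0 (t a).1.1,
  (t a).1.2 :: (t a).2)) by computable_tac.
  by apply: computable_ext h => a; case: (t a) => -[].
- by apply: computable_ext ht => a; case: (t a) => -[].
Qed.

Lemma computable_head_move d (p : A -> nat) : computable X p -> computable X (fun a =>
  head_move d (p a)).
Proof. by case: d => [[]|] hp; computable_tac. Qed.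

(** The instruction depends only on the state and the scanned symbols, a key in a finite type; once
    the key is fixed, the step is an explicit operation on tapes. The simulated oracle [O] varies
    with the argument, because the decoding runs machines on finite strings as oracles. *)
Lemma computable_step (O : A -> real) (c : A -> config M) :
  computable X (fun q : A * nat => O q.1 q.2) -> computable X c -> computable X (fun a =>
    step (O a) (c a)).
Proof.
move=> hO hc; have ht := computable_comp computable_cfg_tuple hc.
have hst : computable X (fun a =>
  cfg_state (c a)) by apply: (computable_proj1 (computable_proj1 ht)).
have htp : computable X (fun a =>
  cfg_tapes (c a)) by apply: (computable_proj2 (computable_proj1 ht)).
have hor : computable X (fun a => cfg_oracle (c a)) by apply: (computable_proj2 ht).
pose key a := (cfg_state (c a), scanned (c a)).
have hk : @computable X A _ encA (enc_fin _) key.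
  apply: computable_fin => -[s v].
  have h : enumerable X (fun a => cfg_state (c a) = s /\ forall i, (cfg_tapes (c a) i).1.2 = v i).
    apply: enumerable_and; first by apply: enumerable_eq; computable_tac.
    apply: enumerable_fin_all => i; apply: enumerable_eq; last by computable_tac.
    exact: (computable_proj2 (computable_proj1 (computable_fun_app i htp))).
  apply: enumerable_ext h => a; rewrite /key; split=> [[-> e]|[<- <-]].
    by congr pair; apply/ffunP => i; rewrite ffunE.
  by split=> // i; rewrite ffunE.
pose f (sv : option 'I_(otm_states M).+1 * {ffun 'I_(otm_tapes M).+1 -> 'I_(otm_symbols M).+2}) a :=
  match omap (fun p => otm_delta M (p, sv.2)) sv.1 with
  | None => c a
  | Some (inl (yes, no)) =>
      Config (if O a (cfg_oracle (c a)) then yes else no) (cfg_tapes (c a)) (cfg_oracle (c a))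
  | Some (inr (p, w, d)) =>
      Config p (fun i => tape_move (w i).2 (write (w i).1 (cfg_tapes (c a) i)))
             (head_move d (cfg_oracle (c a)))
  end.
apply: (computable_ext (f := fun a => f (key a) a)).
  by move=> a; rewrite /f /step /cur_instr /key /=; case: (cfg_state (c a)).
apply: computable_fin_case hk _ => -[[p|] v]; rewrite /f /=; last by [].
case: (otm_delta M (p, v)) => [[yes no]|[[q w] d]].
  have h : computable X (fun a => (if O a (cfg_oracle (c a)) then yes else no, cfg_tapes (c a),
    cfg_oracle (c a))).
    by computable_tac.
  exact: computable_comp computable_tuple_cfg h.
have h : computable X (fun a => (q, fun i => tape_move (w i).2 (write (w i).1 (cfg_tapes (c a) i)),
    head_move d (cfg_oracle (c a)))).
  apply: computable_pair; last exact: computable_head_move.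
  apply: computable_pair; first by computable_tac.
  apply: computable_fun_mk => i; apply: computable_tape_move; rewrite /write.
  have hi := computable_fun_app i htp.
  apply: computable_pair; last exact: (computable_proj2 hi).
  by apply: computable_pair; [exact: (computable_proj1 (computable_proj1 hi)) | computable_tac].
exact: computable_comp computable_tuple_cfg h.
Qed.

End Simulation.

Section Halting.
Variables (X : nat -> bool) (M : otm) (A : Type) (encA : enc A).
#[local] Existing Instances enc_state enc_sym enc_tape enc_config.

Lemma computable_init (j : A -> nat) : computable X j -> computable X (fun a => init M (j a)).
Proof.
move=> hj.
have h : computable X (fun a => (Some ord0 : option 'I_(otm_states M).+1,
   (fun i : 'I_(otm_tapes M).+1 => if (i == ord0) && (0 < j a)
      then ([::], inord 1, nseq (j a).-1 (inord 1)) else ([::], ord0, [::]) : tape M), 0)).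
  apply: computable_pair; last by computable_tac.
  apply: computable_pair; first by computable_tac.
  apply: computable_fun_mk => i; apply: computable_if; [by computable_tac | | by computable_tac].
  by apply: computable_pair; [computable_tac | apply: computable_nseq; computable_tac].
exact: computable_comp (computable_tuple_cfg X M) h.
Qed.

Lemma computable_halted (O : A -> real) (j s : A -> nat) :
  computable X (fun q : A * nat => O q.1 q.2) -> computable X j -> computable X s ->
  computable X (fun a => cfg_state (run M (O a) (j a) (s a)) == None).
Proof.
move=> hO hj hs.
have h : computable X (fun a => run M (O a) (j a) (s a)).
  apply: (computable_iter (f := fun a c => step (O a) c) hs _ (computable_init hj)).
  apply: computable_step; last by computable_tac.
  have h3 : computable X (fun q : A * config M * nat => (q.1.1, q.2)) by computable_tac.
  exact: computable_comp hO h3.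
have hst : computable X (fun a => cfg_state (run M (O a) (j a) (s a))).
  exact: computable_proj1 (computable_proj1 (computable_comp (computable_cfg_tuple X M) h)).
have h1 : enumerable X (fun s : option 'I_(otm_states M).+1 => s == None) by exact: enumerable_fin.
have h2 : enumerable X (fun s : option 'I_(otm_states M).+1 =>
  ~ (s == None)) by exact: enumerable_fin.
by apply: computable_bool; [exact: enumerable_comp hst h1 | exact: enumerable_comp hst h2].
Qed.

End Halting.

Lemma string_code_rcons s b : string_code (rcons s b) = (string_code s).*2 + b.
Proof. by rewrite /string_code foldl_rcons. Qed.

Lemma string_code_gt0 s : 0 < string_code s.
Proof. by elim/last_ind: s => // s b IH; rewrite string_code_rcons; lia. Qed.

Lemma string_code_inj : injective string_code.
Proof.
elim/last_ind => [|s b IH] t; case/lastP: t => [//|t c].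
- by rewrite string_code_rcons; have := string_code_gt0 t; rewrite /string_code /=; lia.
- by rewrite string_code_rcons; have := string_code_gt0 s; rewrite /string_code /=; lia.
rewrite !string_code_rcons => e; rewrite (IH t); last by lia.
by congr rcons; lia.
Qed.

Lemma computable_string_code X A {encA : enc A} (s : A -> seq bool) :
  computable X s -> computable X (fun a => string_code (s a)).
Proof.
move=> hs; have h1 : computable X (fun _ : A => 1) by computable_tac.
by apply: (computable_foldl (f := fun (_ : A) k (b : bool) => k.*2 + b) hs _ h1);
  apply: computable_add; computable_tac; apply: computable_ext (computable_if (f := fun=> 1) (g :=
    fun=> 0) _ _ _); computable_tac.
Qed.

Lemma computable_oracle (X : nat -> bool) A {encA : enc A} (f : A -> nat) :
  computable X f -> computable X (fun a => X (f a)).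
Proof.
move=> hf; apply: computable_bool; first exact: (enumerable_query true hf).
by apply: enumerable_ext (enumerable_query false hf) => a; case: (X _); split.
Qed.

(** The two simulations meet here: left to right a machine is run inside the calculus of enumerable
    predicates, right to left a program is turned into a machine by [definable1_halts]. Later
    enumerability proofs construct no machines. *)
Lemma ce_stringsP X (T : set (seq bool)) : ce_strings X T <-> enumerable X T.
Proof.
split=> [[e Te]|hT].
  have h : enumerable X (fun s => exists t, halts_within e X t (string_code s)).
    apply: enumerable_ex; apply: enumerable_bool.
    apply: (@computable_halted X (machine e) _ _ (fun=> X)); last by computable_tac.
      by apply: computable_oracle; computable_tac.
    by apply: computable_string_code; computable_tac.
  by apply: enumerable_ext h => s; rewrite Te.
have h : enumerable X (fun n => exists s : seq bool, string_code s = n /\ T s).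
  apply: enumerable_ex; apply: enumerable_and.
    by apply: enumerable_eq; [apply: computable_string_code|]; computable_tac.
  have hp : computable X (fun q : nat * seq bool => q.2) by computable_tac.
  exact: enumerable_comp hp hT.
have [e he] := @definable1_halts X (fun n => exists a, a = n /\ exists s, string_code s = a /\
  T s) h.
exists e => s; rewrite /W /= he; split=> [Ts|[_ [-> [t [/string_code_inj<-//]]]]].
by exists (string_code s); split=> //; exists s.
Qed.

(** * The dissipation function *)

Local Open Scope ring_scope.

Lemma measurable_cylinder s : measurable (cylinder s).
Proof.
elim/last_ind: s => [|s b IH].
  by rewrite (_ : cylinder [::] = setT) //; apply/seteqP; split.
rewrite (_ : cylinder (rcons s b) = cylinder s `&` [set x | x (size s) = b]); last first.
  apply/seteqP; split=> x /= => [h|[h e] i].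
    split=> [i si|].
      by have := h i; rewrite size_rcons nth_rcons si ltnS => ->//; exact: ltnW.
    by have := h (size s); rewrite size_rcons nth_rcons ltnn eqxx => ->.
  rewrite size_rcons ltnS nth_rcons; case: ltngtP => // [si _|-> _]; first exact: h.
  exact: e.
apply: measurableI => //; apply: sub_sigma_algebra.
rewrite -[X in open X]/((fun x : cantor_space => x (size s)) @^-1` [set b]).
apply: open_comp; last exact: discrete_open.
by move=> + _; exact: proj_continuous.
Qed.

Section Mass.
Variables (R : realType) (mu : probability borel_cantor R).

Definition mass (s : seq bool) : R := fine (mu (cylinder s)).

Lemma massE s : mu (cylinder s) = (mass s)%:E.
Proof. by rewrite /mass fineK // fin_num_measure //; exact: measurable_cylinder. Qed.

Lemma mass_ge0 s : 0 <= mass s.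
Proof. by rewrite -lee_fin -massE. Qed.

Lemma mass_nil : mass [::] = 1.
Proof.
by rewrite /mass (_ : cylinder [::] = setT) ?probability_setT //; apply/seteqP; split.
Qed.

Lemma cylinder_rconsP s b (x : borel_cantor) :
  cylinder (rcons s b) x <-> cylinder s x /\ x (size s) = b.
Proof.
split=> [h|[h e] i].
  split=> [i si|].
    by have := h i; rewrite size_rcons nth_rcons si ltnS => ->//; exact: ltnW.
  by have := h (size s); rewrite size_rcons nth_rcons ltnn eqxx => ->.
rewrite size_rcons ltnS nth_rcons; case: ltngtP => // [si _|-> _]; first exact: h.
exact: e.
Qed.

Lemma mass_split s : mass s = mass (rcons s false) + mass (rcons s true).
Proof.
apply: EFin_inj; rewrite EFinD -!massE -measureU; last first.
- apply/seteqP; split=> x // [/cylinder_rconsP[_ e] /cylinder_rconsP[_]].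
  by rewrite e.
- exact: measurable_cylinder.
- exact: measurable_cylinder.
congr (mu _); apply/seteqP; split=> x.
  by move=> sx; case e : (x (size s)); [right|left]; apply/cylinder_rconsP.
by case=> /cylinder_rconsP[].
Qed.

Lemma mass_rcons_le s b : mass (rcons s b) <= mass s.
Proof.
by rewrite (mass_split s); have := mass_ge0 (rcons s true); have := mass_ge0 (rcons s false);
  case: b; lra.
Qed.

Lemma mass_cat_le s t : mass (s ++ t) <= mass s.
Proof.
elim/last_ind: t => [|t b IH]; first by rewrite cats0.
by rewrite -rcons_cat; apply: le_trans (mass_rcons_le _ _) IH.
Qed.

Lemma mass_child s : exists b, mass s / 2 <= mass (rcons s b).
Proof.
have := mass_split s; case: (leP (mass s / 2) (mass (rcons s false))) => [h _|h e].
  by exists false.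
by exists true; lra.
Qed.

Lemma mass_large l : exists s, size s = l /\ 2 ^- l <= mass s.
Proof.
elim: l => [|l [s [sl ms]]]; first by exists [::]; rewrite mass_nil expr0 invr1.
have [b hb] := mass_child s; exists (rcons s b); rewrite size_rcons sl; split=> //.
by apply: le_trans hb; rewrite exprS invfM mulrC ler_wpM2r // invr_ge0.
Qed.

(* A finite-branching argument: strings of mass at least eps form a tree, and an infinite
   branch of it would be an atom. *)
Lemma mass_vanishes (eps : R) : continuous_measure mu -> 0 < eps ->
  exists l, forall s, size s = l -> mass s < eps.
Proof.
move=> mc e0; apply/not_existsP => big.
pose deep s := forall l, exists t, size t = l /\ eps <= mass (s ++ t).
have deep0 : deep [::].
  move=> l; have /existsNP[s /not_implyP[sl /negP]] := big l.
  by rewrite -leNgt => ms; exists s.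
have deepS s : deep s -> exists b, deep (rcons s b).
  move=> ds; apply/not_existsP => nd.
  have /existsNP[l0 h0] := nd false; have /existsNP[l1 h1] := nd true.
  (* If the children have no heavy extensions by lengths [l0] and [l1], a heavy extension longer
     than both contradicts one of these once it is truncated. *)
  have [t [st mt]] := ds (maxn l0 l1).+1.
  case: t st mt => // b t [st] mt.
  have gen l : (l <= maxn l0 l1)%N -> exists t', size t' = l /\ eps <= mass (rcons s b ++ t').
    move=> lm; exists (take l t); rewrite size_takel ?st //; split=> //.
    apply: le_trans mt _; rewrite cat_rcons -{1}(cat_take_drop l t).
    by rewrite -cat_cons catA; apply: mass_cat_le.
  case: b gen {mt} => gen.
    by apply: h1; apply: gen; rewrite leq_maxr.
  by apply: h0; apply: gen; rewrite leq_maxl.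
have [next nextP] := choice (fun s : {s | deep s} => deepS (sval s) (svalP s)).
pose branch := fix br n : {s | deep s} :=
  if n is n'.+1 then exist _ (rcons (sval (br n')) (next (br n'))) (nextP (br n'))
  else exist _ [::] deep0.
pose x : borel_cantor := fun n => next (branch n).
have size_branch n : size (sval (branch n)) = n.
  by elim: n => //= n IH; rewrite size_rcons IH.
have xb n : cylinder (sval (branch n)) x.
  elim: n => //= n IH; apply/cylinder_rconsP; split=> //.
  by rewrite size_branch.
have bm n : eps <= mass (sval (branch n)).
  by have [t [/size0nil -> ]] := svalP (branch n) 0%N; rewrite cats0.
have capE : \bigcap_n cylinder (sval (branch n)) = [set x].
  apply/seteqP; split=> y /= => [h|-> n _]; last exact: xb.
  apply: funext => n; have := h n.+1 I n; have := xb n.+1 n.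
  by rewrite size_branch => -> // ->.
(* Continuity from above along the branch: masses of at least [eps] converge to the mass of the
   single point [x], which is 0. *)
have cv : mu (cylinder (sval (branch n))) @[n --> \oo] -->
    mu (\bigcap_n cylinder (sval (branch n))).
  apply: nonincreasing_cvg_mu.
  - by change (mu (cylinder [::]) < +oo)%E; rewrite massE ltry.
  - by move=> n; exact: measurable_cylinder.
  - by apply: bigcapT_measurable => n; exact: measurable_cylinder.
  - apply/nonincreasing_seqP => n; apply/subsetPset => y /= /cylinder_rconsP[].
    by [].
rewrite capE mc in cv.
have : (eps%:E <= 0)%E.
  rewrite -(cvg_lim _ cv) //; apply: lime_ge; first by apply/cvg_ex; exists 0%E.
  by apply: nearW => n; rewrite massE lee_fin.
by rewrite lee_fin leNgt e0.
Qed.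

End Mass.

Lemma leastE (P : set nat) k : P k -> (forall m, P m -> (k <= m)%N) -> least P = k.
Proof.
move=> Pk mk; rewrite /least; case: xgetP => [x _ [Px mx]|/(_ k)]; last by case.
by apply/eqP; rewrite eqn_leq mx //= mk.
Qed.

Lemma leastP (P : set nat) k : P k -> P (least P) /\ (least P <= k)%N.
Proof.
move=> Pk; have ex : exists n, `[< P n >] by exists k; apply/asboolP.
have [m /asboolP Pm mm] := ex_minnP ex.
rewrite (@leastE P m) //; last by move=> n Pn; apply: mm; apply/asboolP.
by split=> //; apply: mm; apply/asboolP.
Qed.

Lemma greatestP (P : set nat) k b : P k -> (forall m, P m -> (m <= b)%N) ->
  P (greatest P) /\ forall m, P m -> (m <= greatest P)%N.
Proof.
move=> Pk Pb; have ex : exists n, `[< P n >] by exists k; apply/asboolP.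
have bd n : `[< P n >] -> (n <= b)%N by move/asboolP/Pb.
have [m /asboolP Pm mm] := ex_maxnP ex bd.
rewrite /greatest; case: xgetP => [x _ //|/(_ m)[]]; split=> // n Pn.
by apply: mm; apply/asboolP.
Qed.

Section Dissipation.
Variables (R : realType) (mu : probability borel_cantor R).
Local Notation h := (dissipation mu).
Local Notation mass := (mass mu).

Lemma pow2V_lt (m n : nat) : ((2 ^- m : R) < 2 ^- n) = (n < m)%N.
Proof. by rewrite -!exprVn ltr_iXn2l // ?invr_gt0 // invf_lt1 // ltr1n. Qed.

Lemma pow2VS (n : nat) : (2 ^- n.+1 : R) * 2 = 2 ^- n.
Proof. by rewrite exprS invfM mulrAC mulVf ?mul1r ?pnatr_eq0. Qed.

(** The set defining h(l) contains 0, since no mass exceeds 1, and is bounded by l, since some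
    string of length l has mass at least 2^-l; so [greatest] returns a true maximum. *)
Lemma dissipationP l : (forall s, size s = l -> mass s < 2 ^- h l * 2) /\
  forall n, (forall s, size s = l -> mass s < 2 ^- n * 2) -> (n <= h l)%N.
Proof.
have [] := @greatestP [set n | forall s : seq bool, size s = l ->
                      (mu (cylinder s) < (2 ^- n * 2)%:E)%E] 0%N l.
- move=> s _; rewrite massE lte_fin expr0 invr1 mul1r.
  by have := mass_cat_le mu [::] s; rewrite mass_nil /=; lra.
- move=> n /= hn; have [s [sl ms]] := mass_large mu l.
  have := hn s sl; rewrite massE lte_fin => lt; rewrite -ltnS -pow2V_lt.
  by rewrite -(ltr_pM2r (_ : 0 < 2 :> R)) // pow2VS; apply: le_lt_trans lt; rewrite //.
move=> h1 h2; split=> [s sl|n hn]; first by have := h1 s sl; rewrite massE lte_fin.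
by apply: h2 => s sl; rewrite massE lte_fin; exact: hn.
Qed.

Lemma dissipation_lt s : mass s < 2 ^- h (size s) * 2.
Proof. by have [+ _] := dissipationP (size s); apply. Qed.

Lemma dissipation_attained l : exists s, size s = l /\ 2 ^- h l <= mass s.
Proof.
apply/not_existsP => no; have [_ /(_ (h l).+1)] := dissipationP l.
suff /[swap]/[apply] : forall s, size s = l -> mass s < 2 ^- (h l).+1 * 2 by rewrite ltnn.
move=> s sl; rewrite pow2VS ltNge; apply/negP => ms.
by apply: (no s).
Qed.

Lemma dissipation_le l : (h l <= l)%N.
Proof.
have [s [sl ms]] := mass_large mu l; have := dissipation_lt s; rewrite sl => lt.
rewrite -ltnS -pow2V_lt -(ltr_pM2r (_ : 0 < 2 :> R)) // pow2VS.
exact: le_lt_trans lt.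
Qed.

Lemma dissipation_mono : {homo h : l m / (l <= m)%N}.
Proof.
move=> l m lm; have [_] := dissipationP m; apply => s sm.
apply: le_lt_trans (_ : mass (take l s) < _); first by rewrite -{1}(cat_take_drop l s) mass_cat_le.
have {2}-> : l = size (take l s) by rewrite size_takel // sm.
exact: dissipation_lt.
Qed.

(** A string of mass at least 2^-h(l) has a child with at least half of that mass. This Lipschitz
    property keeps errors from being amplified when h is iterated. *)
Lemma dissipation_succ l : (h l.+1 <= (h l).+1)%N.
Proof.
have [s [sl ms]] := dissipation_attained l; have [b mb] := mass_child mu s.
have := dissipation_lt (rcons s b); rewrite size_rcons sl => lt.
have : (2 ^- (h l).+1 : R) < 2 ^- h l.+1 * 2.
  apply: le_lt_trans lt; apply: le_trans mb.
  by rewrite ler_pdivlMr // pow2VS.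
case: (h l.+1) => // k; rewrite pow2VS pow2V_lt; lia.
Qed.

Lemma dissipation_add l d : (h (l + d) <= h l + d)%N.
Proof.
elim: d => [|d IH]; first by rewrite !addn0.
by rewrite !addnS; apply: leq_trans (dissipation_succ _) _.
Qed.

Lemma dissipation_unbounded n : continuous_measure mu ->
  exists l0, forall l, (l0 <= l)%N -> (n <= h l)%N.
Proof.
move=> mc; have [|l hl] := @mass_vanishes _ mu (2 ^- n) mc; first by rewrite invr_gt0 exprn_gt0.
exists l => m lm; apply: leq_trans (dissipation_mono lm).
have [_] := dissipationP l; apply => s /hl lt; apply: lt_le_trans lt _.
by rewrite ler_peMr ?ler1n // invr_ge0 exprn_ge0.
Qed.

Lemma iter_dissipation_le k l : (iter k h l <= l)%N.
Proof. by elim: k => //= k IH; apply: leq_trans (dissipation_le _) IH. Qed.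

Lemma iter_dissipation_mono k : {homo iter k h : l m / (l <= m)%N}.
Proof. by elim: k => //= k IH l m /IH; apply: dissipation_mono. Qed.

Lemma iter_dissipation_add k l d : (iter k h (l + d) <= iter k h l + d)%N.
Proof.
elim: k => //= k IH; apply: leq_trans (dissipation_add _ _).
exact: dissipation_mono.
Qed.

Lemma iter_dissipation_unbounded k n : continuous_measure mu ->
  exists l0, forall l, (l0 <= l)%N -> (n <= iter k h l)%N.
Proof.
move=> mc; elim: k n => [|k IH] n; first by exists n.
have [l1 h1] := dissipation_unbounded n mc; have [l0 h0] := IH l1.
by exists l0 => l /h0/h1.
Qed.

(* An approximation to [g = h l] by conditions that are open in the measure, so that,
   unlike the graph of h, it can be enumerated from every representation. *)
Definition near_dissipation (l g : nat) : Prop :=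
  [/\ (0 < l)%N, forall s, size s = l -> mass s < 2 ^- g * 2 &
      exists s, size s = l /\ 2 ^- g / 2 < mass s].

Lemma near_dissipation_bounds l g : near_dissipation l g -> (g <= h l <= g.+1)%N.
Proof.
case=> _ up [s [sl lo]]; apply/andP; split; first by have [_] := dissipationP l; apply.
have := dissipation_lt s; rewrite sl => /(lt_trans lo).
rewrite ltr_pdivrMr // -mulrA => lt.
have : (2 ^- g.+2 : R) < 2 ^- h l.
  rewrite -(ltr_pM2r (_ : 0 < 2 * 2 :> R)) ?mulr_gt0 // mulrA !pow2VS.
  exact: lt.
by rewrite pow2V_lt; lia.
Qed.

Lemma near_dissipation_self l : (0 < l)%N -> near_dissipation l (h l).
Proof.
move=> l0; split=> [//|s <-|]; first exact: dissipation_lt.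
have [s [sl ms]] := dissipation_attained l; exists s; split=> //.
apply: lt_le_trans ms; rewrite ltr_pdivrMr // ltr_pMr ?ltr1n // invr_gt0 exprn_gt0.
Qed.

Fixpoint near_iter (k l L : nat) : Prop :=
  if k is k'.+1 then exists L', near_iter k' l L' /\ near_dissipation L' L else L = l.

(** Each application loses at most one, and an earlier error d remains at most d because h(L + d) <=
    h(L) + d; hence the errors only add up. *)
Lemma near_iter_bounds k l L : near_iter k l L -> (L <= iter k h l <= L + k)%N.
Proof.
elim: k L => [|k IH] L /=; first by move=> ->; rewrite addn0 leqnn.
move=> [L' [/IH/andP[l1 l2] /near_dissipation_bounds/andP[l3 l4]]].
have := dissipation_mono l1; have := dissipation_mono l2; have := dissipation_add L' k; lia.
Qed.

(** The exact iterate is among the approximations, so passing to all of them loses no candidate.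
    Positivity of the last iterate yields that of the earlier ones, as h(l) <= l. *)
Lemma near_iter_self k l : (0 < iter k h l)%N -> near_iter k l (iter k h l).
Proof.
elim: k => //= k IH hk.
have hk' : (0 < iter k h l)%N by apply: leq_trans hk (dissipation_le _).
by exists (iter k h l); split; [exact: IH | exact: near_dissipation_self].
Qed.

End Dissipation.

(** * Enumerating the measure from a representation *)

(** The state is the quotient still to be read and the agreement so far; the form of a fold gives
    computability by [computable_foldl]. *)
Definition dyadic_in (s : seq bool) (k : nat) : bool :=
  (foldl (fun (st : nat * bool) b => (st.1./2, st.2 && (odd st.1 == b))) (k, true) s).2.

Lemma dyadic_inP s k : reflect (cylinder s (dyadic_point k)) (dyadic_in s k).
Proof.
suff E s' k' b : (foldl (fun (st : nat * bool) b => (st.1./2, st.2 && (odd st.1 == b))) (k',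
  b) s').2
    <-> b /\ forall i, (i < size s')%N -> odd (k' %/ 2 ^ i) = nth false s' i.
  apply: (iffP idP) => [/E[]//|h]; exact/E.
elim: s' k' b => [|c t IH] k' b /=; first by split=> [->|[]].
rewrite IH; split=> [[/andP[-> /eqP oc] h]|[-> h]].
  split=> // -[_|i it]; first by rewrite expn0 divn1.
  by rewrite expnS divnMA divn2 h.
have := h 0%N isT; rewrite expn0 divn1 /= => ->; rewrite eqxx; split=> // i it.
by have := h i.+1 it; rewrite expnS divnMA divn2.
Qed.

Definition dense_weight (q : nat) (s : seq bool) : nat :=
  (foldl (fun (st : nat * nat) w => (st.1.+1, st.2 + (if dyadic_in s st.1 then w else 0)))%N
     (0, 0)%N (dense_weights q)).2.

Lemma dense_weightE q s : dense_weight q s =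
  (\sum_(k < size (dense_weights q)) nth 0 (dense_weights q) k * dyadic_in s k)%N.
Proof.
suff E w a b : ((foldl (fun (st : nat * nat) w => (st.1.+1,
  st.2 + (if dyadic_in s st.1 then w else 0)))
     (a, b) w).2 = b + \sum_(k < size w) nth 0 w k * dyadic_in s (a + k))%N.
  by rewrite /dense_weight E add0n; apply: eq_bigr => k _; rewrite add0n.
elim: w a b => [|c w IH] a b /=; first by rewrite big_ord0 addn0.
rewrite IH big_ord_recl /= addn0 -addnA; congr (_ + (_ + _))%N.
  by case: dyadic_in; rewrite ?muln1 ?muln0.
by apply: eq_bigr => k _; rewrite addSnnS.
Qed.

Section Approximation.
Variables (R : realType) (mu : probability borel_cantor R).
Local Notation mass := (mass mu).

Definition dense_mass (q : nat) (s : seq bool) : R :=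
  (dense_weight q s)%:R / (sumn (dense_weights q))%:R.

Lemma dense_massE q s : dense_measure R q (cylinder s) = (dense_mass q s)%:E.
Proof.
rewrite /dense_measure /dense_mass dense_weightE natr_sum mulr_suml -sumEFin.
apply: eq_bigr => k _; rewrite diracE -EFinM natrM [in RHS]mulrAC; congr (_ * _%:R)%:E.
by rewrite (_ : (_ \in _) = dyadic_in s k) //; apply/idP/idP =>
  [/set_mem/dyadic_inP|/dyadic_inP/mem_set].
Qed.

(** Only the summand of the distance for the length of [s] is kept, and in it only [s]. The distance
    starts at length 1 and says nothing about the empty string; this is the origin of the condition
    0 < l in [near_dissipation]. *)
Lemma dense_mass_close q i s : (0 < size s)%N ->
  (measure_dist (@dense_measure R q) mu <= (2 ^- i)%:E)%E ->
  `|dense_mass q s - mass s| <= 2 ^+ (size s).+1 / 2 ^+ i.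
Proof.
move=> s0 hd.
set u := fun l : nat => ((2 ^- l)%:E * ((2^-1)%:E *
   \sum_(s : l.-tuple bool) `|dense_measure R q (cylinder s) - mu (cylinder s)|))%E.
have u0 l : (0 <= u l)%E.
  apply: mule_ge0; first by rewrite lee_fin invr_ge0 exprn_ge0.
  by apply: mule_ge0; [rewrite lee_fin invr_ge0 | apply: sume_ge0].
have : (u (size s) <= (2 ^- i)%:E)%E.
  apply: le_trans hd; apply: (le_trans _ (nneseries_lim_ge (size s).+1 _)); last by move=> l _ _;
    exact: u0.
  rewrite big_nat_recr //= leeDr //; apply: sume_ge0 => *; exact: u0.
rewrite /u (bigD1 (in_tuple s)) //= dense_massE massE -EFinB abse_EFin.
set d := (dense_mass q s - mass s) => hs.
have : ((2 ^- size s * (2^-1 * `|d|))%:E <= (2 ^- i)%:E)%E.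
  apply: le_trans hs; rewrite !EFinM; do 2!(apply: lee_wpmul2l;
    first by rewrite lee_fin invr_ge0 ?exprn_ge0).
  by rewrite leeDl //; apply: sume_ge0.
rewrite lee_fin mulrA -invfM -exprSr mulrC ler_pdivrMr ?exprn_gt0 //.
by rewrite mulrC.
Qed.

End Approximation.

Section Enumeration.
Variables (R : realType) (mu : probability borel_cantor R).
Local Notation mass := (mass mu).

(* The inequalities [dense_mass q s + e < 2 / 2 ^ g] and [dense_mass q s - e > 1 / (2 2 ^ g)]
   for [e = 2 ^ (size s + 1) / 2 ^ i], with denominators cleared. *)
Definition below_cond (i q : nat) (s : seq bool) (g : nat) : bool :=
  ((dense_weight q s * 2 ^ i + 2 ^ (size s).+1 * sumn (dense_weights q)) * 2 ^ g
     < 2 * sumn (dense_weights q) * 2 ^ i)%N.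

Definition above_cond (i q : nat) (s : seq bool) (g : nat) : bool :=
  (sumn (dense_weights q) * 2 ^ i + 2 ^ (size s).+1 * sumn (dense_weights q) * (2 * 2 ^ g)
     < dense_weight q s * 2 ^ i * (2 * 2 ^ g))%N.

Lemma below_condE i q s g : dense_index q ->
  below_cond i q s g = (dense_mass R q s + 2 ^+ (size s).+1 / 2 ^+ i < 2 ^- g * 2).
Proof.
rewrite /dense_index /below_cond /dense_mass; set W := sumn _ => W0.
rewrite -(ltr_nat R) !natrM natrD !natrM !natrX.
have W0' : 0 < W%:R :> R by rewrite ltr0n.
have i0 : 0 < (2 ^+ i : R) by rewrite exprn_gt0.
have g0 : 0 < (2 ^+ g : R) by rewrite exprn_gt0.
have P0 : 0 < W%:R * 2 ^+ i * 2 ^+ g :> R by rewrite !mulr_gt0.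
rewrite -[RHS](ltr_pM2r P0); congr (_ < _); field; rewrite ?gt_eqF //.
Qed.

Lemma above_condE i q s g : dense_index q ->
  above_cond i q s g = (2 ^- g / 2 < dense_mass R q s - 2 ^+ (size s).+1 / 2 ^+ i).
Proof.
rewrite /dense_index /above_cond /dense_mass; set W := sumn _ => W0.
rewrite -(ltr_nat R) !(natrM, natrD, natrX).
have W0' : 0 < W%:R :> R by rewrite ltr0n.
have i0 : 0 < (2 ^+ i : R) by rewrite exprn_gt0.
have g0 : 0 < (2 ^+ g : R) by rewrite exprn_gt0.
have P0 : 0 < W%:R * 2 ^+ i * (2 * 2 ^+ g) :> R by rewrite !mulr_gt0.
rewrite -[RHS](ltr_pM2r P0) -[LHS](ltrBrDr); congr (_ < _); field; rewrite ?gt_eqF //.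
Qed.

Lemma pow2_archimedean (a c : R) : 0 < c -> exists i, a / 2 ^+ i < c.
Proof.
move=> c0; exists (Num.bound (a / c)).
have := upper_nthrootP (leqnn (Num.bound (a / c))).
by rewrite ltr_pdivrMr // ltr_pdivrMr ?exprn_gt0 // mulrC.
Qed.

Section Represented.
Variables (X : real) (q : nat -> nat).
Hypothesis qX : forall i k, X (pair_code i k) = (k == q i).
Hypothesis q_close : forall i, dense_index (q i) /\
  (measure_dist (@dense_measure R (q i)) mu <= (2 ^- i)%:E)%E.

(** A strict inequality survives a good enough approximation. The gap has to exceed twice the error,
    which enters once in passing from mu to the approximation and once in [below_cond] itself. *)
Lemma below_condP s g : (0 < size s)%N ->
  mass s < 2 ^- g * 2 <-> exists i, below_cond i (q i) s g.
Proof.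
move=> s0; split=> [lt|[i]].
  have [|i hi] := @pow2_archimedean (2 * 2 ^+ (size s).+1) (2 ^- g * 2 - mass s).
    by rewrite subr_gt0.
  exists i; have [di /(dense_mass_close s0)] := q_close i.
  rewrite below_condE // ler_distl => /andP[l1 l2].
  by move: hi; rewrite -mulrA; lra.
have [di /(dense_mass_close s0)] := q_close i.
by rewrite below_condE // ler_distl => /andP[l1 l2]; lra.
Qed.

Lemma above_condP s g : (0 < size s)%N ->
  2 ^- g / 2 < mass s <-> exists i, above_cond i (q i) s g.
Proof.
move=> s0; split=> [lt|[i]].
  have [|i hi] := @pow2_archimedean (2 * 2 ^+ (size s).+1) (mass s - 2 ^- g / 2).
    by rewrite subr_gt0.
  exists i; have [di /(dense_mass_close s0)] := q_close i.
  rewrite above_condE // ler_distl => /andP[l1 l2].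
  by move: hi; rewrite -mulrA; lra.
have [di /(dense_mass_close s0)] := q_close i.
by rewrite above_condE // ler_distl => /andP[l1 l2]; lra.
Qed.

End Represented.
End Enumeration.

Local Close Scope ring_scope.

Definition all_strings (l : nat) : seq (seq bool) :=
  iter l (fun S => [seq true :: s | s <- S] ++ [seq false :: s | s <- S]) [:: [::]].

Lemma all_stringsP l s : List.In s (all_strings l) <-> size s = l.
Proof.
elim: l s => [|l IH] s /=; first by split=> [[<-|]//|/size0nil->]; left.
rewrite List.in_app_iff !List.in_map_iff; split.
  by case=> -[t [<- /IH <-]].
by case: s => // -[] s [/IH h]; [left|right]; exists s.
Qed.

Lemma computable_all_strings X A {encA : enc A} (l : A -> nat) :
  computable X l -> computable X (fun a => all_strings (l a)).
Proof.
move=> hl; have h0 : computable X (fun _ : A => [:: [::]] : seq (seq bool)) by computable_tac.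
apply: (computable_iter (f := fun _ S =>
  [seq true :: s | s <- S] ++ [seq false :: s | s <- S]) hl _ h0).
have h1 b : computable X (fun q : A * seq (seq bool) => [seq b :: s | s <- q.2]).
  by apply: (computable_map (f := fun _ s => b :: s)); computable_tac.
exact: computable_cat (h1 true) (h1 false).
Qed.

Lemma computable_dyadic_in X A {encA : enc A} (s : A -> seq bool) (k : A -> nat) :
  computable X s -> computable X k -> computable X (fun a => dyadic_in (s a) (k a)).
Proof.
move=> hs hk; rewrite /dyadic_in; apply: computable_proj2.
have h0 : computable X (fun a => (k a, true)) by computable_tac.
apply: (computable_foldl (f := fun _ (st : nat * bool) b => (st.1./2,
  st.2 && (odd st.1 == b))) hs _ h0).
apply: computable_pair; first by computable_tac.
apply: computable_and; first by computable_tac.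
have h1 : computable X (fun abc : A * (nat * bool * bool) => odd abc.2.1.1) by computable_tac.
have h2 : computable X (fun abc : A * (nat * bool * bool) => abc.2.2) by computable_tac.
apply: computable_ext (computable_if h1 h2 (computable_not h2)) => a.
by case: (odd _) (a.2.2) => -[].
Qed.

(** The decoder is computed through the graph of [CodeSeq.code], an arithmetic fold over the
    list. *)
Lemma computable_dense_weights X A {encA : enc A} (q : A -> nat) :
  computable X q -> computable X (fun a => dense_weights (q a)).
Proof.
move=> hq.
have h : enumerable X (fun ab : A * seq nat => CodeSeq.code ab.2 = q ab.1).
  apply: enumerable_eq; last by computable_tac.
  have h0 : computable X (fun _ : A * seq nat => 0) by computable_tac.
  apply: (computable_foldr (f := fun _ n m => 2 ^ n * m.*2.+1) _ _ h0); by computable_tac.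
apply: enumerable_ext h => -[a w] /=; split=> [<-|->];
  first by rewrite /dense_weights CodeSeq.codeK.
by rewrite /dense_weights CodeSeq.decodeK.
Qed.

Lemma computable_sumn X A {encA : enc A} (s : A -> seq nat) : computable X s ->
  computable X (fun a => sumn (s a)).
Proof.
move=> hs; have h0 : computable X (fun _ : A => 0) by computable_tac.
by apply: (computable_foldr (f := fun _ n m => n + m) hs _ h0); computable_tac.
Qed.

Lemma computable_dense_weight X A {encA : enc A} (q : A -> nat) (s : A -> seq bool) :
  computable X q -> computable X s -> computable X (fun a => dense_weight (q a) (s a)).
Proof.
move=> hq hs; rewrite /dense_weight; apply: computable_proj2.
have h0 : computable X (fun _ : A => (0, 0)) by computable_tac.
apply: (computable_foldl (f := fun a (st : nat * nat) w => (st.1.+1,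
  st.2 + (if dyadic_in (s a) st.1 then w else 0)))
  (computable_dense_weights hq) _ h0).
apply: computable_pair; first by computable_tac.
apply: computable_add; first by computable_tac.
apply: computable_if; [|by computable_tac|by computable_tac].
by apply: computable_dyadic_in; computable_tac.
Qed.

Lemma computable_pair_code X A {encA : enc A} (i k : A -> nat) :
  computable X i -> computable X k -> computable X (fun a => pair_code (i a) (k a)).
Proof. by move=> hi hk; rewrite /pair_code; computable_tac. Qed.

(** The sequence of indices is computable from the representation by queries. The quantifier over
    all strings of a given length runs over a computable finite list, so enumerability is kept. *)
Lemma enumerable_near_dissipation (R : realType) (mu : probability borel_cantor R) X :
  representation mu X -> enumerable X (fun lg : nat * nat => near_dissipation mu lg.1 lg.2).
Proof.
move=> [q [qX qc]].
have hq : computable X q.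
  have h : enumerable X (fun ik : nat * nat => X (pair_code ik.1 ik.2) = true).
    by apply: enumerable_query; apply: computable_pair_code; computable_tac.
  by apply: enumerable_ext h => -[i k] /=; rewrite qX; split=> [/eqP//|->]; exact: eqxx.
have hqi : computable X (fun z : nat * nat * seq bool * nat => q z.2) by computable_tac.
have hsz : computable X (fun z : nat * nat * seq bool * nat =>
  size z.1.2) by apply: computable_size; computable_tac.
have hs : computable X (fun z : nat * nat * seq bool * nat => z.1.2) by computable_tac.
have hW : computable X (fun z : nat * nat * seq bool * nat => sumn (dense_weights (q z.2))).
  by apply: computable_sumn; apply: computable_dense_weights.
have hw := computable_dense_weight hqi hs.
have hb : enumerable X (fun z : nat * nat * seq bool => exists i, below_cond i (q i) z.2 z.1.2).
  by apply: enumerable_ex; apply: enumerable_bool; rewrite /below_cond; computable_tac.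
have ha : enumerable X (fun z : nat * nat * seq bool => exists i, above_cond i (q i) z.2 z.1.2).
  by apply: enumerable_ex; apply: enumerable_bool; rewrite /above_cond; computable_tac.
have hpos : enumerable X (fun lg : nat * nat => 0 < lg.1) by apply: enumerable_bool; computable_tac.
have hall : enumerable X (fun lg : nat * nat => forall s, List.In s (all_strings lg.1) ->
    exists i, below_cond i (q i) s lg.2).
  by apply: (enumerable_all_seq (P := fun lg s => exists i, below_cond i (q i) s lg.2)) => //;
    apply: computable_all_strings; computable_tac.
have hex : enumerable X (fun lg : nat * nat => exists s, size s = lg.1 /\
    exists i, above_cond i (q i) s lg.2).
  apply: enumerable_ex; apply: enumerable_and; last exact: ha.
  by apply: enumerable_eq; [apply: computable_size|]; computable_tac.
apply: enumerable_ext (enumerable_and hpos (enumerable_and hall hex)) => -[l g] /=; split.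
  move=> [l0 [h1 [s [sl h2]]]]; split=> // [t tl|].
    by apply/(below_condP qc); rewrite ?tl //; apply: h1; apply/all_stringsP.
  by exists s; split=> //; apply/(above_condP qc); rewrite ?sl.
move=> [l0 h1 [s [sl h2]]]; split=> //; split=> [t /all_stringsP tl|].
  by apply/(below_condP qc); rewrite ?tl //; apply: h1.
by exists s; split=> //; apply/(above_condP qc); rewrite ?sl.
Qed.

Lemma enumerable_near_iter (R : realType) (mu : probability borel_cantor R) X k :
  representation mu X -> enumerable X (fun lL : nat * nat => near_iter mu k lL.1 lL.2).
Proof.
move=> /enumerable_near_dissipation hn; elim: k => [|k IH] /=; first by apply: enumerable_eq;
  computable_tac.
apply: enumerable_ex; apply: enumerable_and.
  have hc : computable X (fun z : nat * nat * nat => (z.1.1, z.2)) by computable_tac.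
  exact: enumerable_comp hc IH.
have hc : computable X (fun z : nat * nat * nat => (z.2, z.1.2)) by computable_tac.
exact: enumerable_comp hc hn.
Qed.

(** * Decoding *)

Lemma cylinder_cat s t X : cylinder (s ++ t) X -> cylinder s X.
Proof.
by move=> h i si; have := h i; rewrite size_cat nth_cat si => -> //; apply: ltn_addr.
Qed.

Lemma halts_within_mono e X s t j : s <= t -> halts_within e X s j -> halts_within e X t j.
Proof.
rewrite /halts_within /Phi_run /run => /subnK <- /eqP h; elim: (t - s) => [|k IH]; first exact/eqP.
by rewrite addSn iterS /step /cur_instr (eqP IH).
Qed.

(** The oracle head starts at 0 and moves at most one cell per step; the induction carries this
    bound on its position along. *)
Lemma run_use (M : otm) X Y j s : (forall i, i < s -> X i = Y i) -> run M X j s = run M Y j s.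
Proof.
move=> XY; suff [] : run M X j s = run M Y j s /\ cfg_oracle (run M X j s) <= s by [].
elim: s XY => [//|s IH] XY; have [i si|e o] := IH; first by apply: XY; apply: ltnW.
rewrite /run !iterS -!/(run M _ j s) -e; move: (run M X j s) o => c o; rewrite /step.
case: (cur_instr c) => [[[yes no]|[[p w] d]]|] /=; last by split=> //; apply: ltnW.
  by rewrite XY //; split=> //; apply: leqW.
by split=> //; case: d => [[]|] /=; lia.
Qed.

(* The finite string sigma, as an oracle; computations are always cut off at size sigma steps,
   so the bits beyond are never queried. *)
Definition string_real (sg : seq bool) : real := nth false sg.

Lemma halts_within_prefix e X l s j : s <= l ->
  halts_within e (string_real (mkseq X l)) s j = halts_within e X s j.
Proof.
move=> sl; rewrite /halts_within /Phi_run (@run_use _ _ X) // => i si.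
by rewrite /string_real nth_mkseq //; apply: leq_trans sl.
Qed.

Section FiniteDecoding.
Variables (e : nat) (sg : seq bool).

Definition fin_halts (j : nat) : bool := halts_within e (string_real sg) (size sg) j.

(** The search stops at [i]. If [i] is a candidate and j < i, it succeeds with a result that stays
    the same for larger [i]; this is what makes the candidate prefixes a chain. *)
Definition fin_next (i j : nat) : nat := j.+1 + find fin_halts (iota j.+1 (i - j)).

Definition fin_settling (i j : nat) : nat :=
  find (fun s => all (fun k => fin_halts k ==> halts_within e (string_real sg) s k)
                     (iota 0 (fin_next i j).+1)) (iota 0 (size sg).+1).

Definition fin_block (i j : nat) : seq bool :=
  if fin_halts j then nseq (fin_settling i j) true else [:: false].

Definition fin_prefix (i : nat) : seq bool :=
  flatten [seq fin_block i j ++ [:: false] | j <- iota 0 i].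

Lemma fin_next_stable i i' j : fin_halts i -> j < i -> i <= i' -> fin_next i j = fin_next i' j.
Proof.
move=> hi ji ii'; rewrite /fin_next -(subnKC (leq_sub2r j ii')) iotaD find_cat ifT //.
by apply/hasP; exists i => //; rewrite mem_iota; lia.
Qed.

Lemma fin_prefix_stable i i' : fin_halts i -> i <= i' ->
  exists t, fin_prefix i' = fin_prefix i ++ t.
Proof.
move=> hi ii'; rewrite /fin_prefix -(subnKC ii') iotaD map_cat flatten_cat; eexists.
congr (flatten _ ++ _); apply/eq_in_map => j; rewrite mem_iota /= => ji.
by rewrite subnKC // /fin_block /fin_settling (fin_next_stable hi ji ii').
Qed.

(** In a chain, candidates of equal length coincide; the outputs of the test can therefore be
    counted by their lengths. *)
Lemma fin_prefix_take i i' p : fin_halts i -> fin_halts i' ->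
  p <= size (fin_prefix i) -> p <= size (fin_prefix i') ->
  take p (fin_prefix i) = take p (fin_prefix i').
Proof.
wlog ii' : i i' / i <= i'.
  move=> H hi hi' pi pi'; case: (leqP i i') => [le|/ltnW le]; first exact: H.
  by symmetry; apply: H.
by move=> hi _ pi _; have [t ->] := fin_prefix_stable hi ii'; rewrite takel_cat.
Qed.

End FiniteDecoding.

Section TrueDecoding.
Variables (e : nat) (A B : real).
Hypotheses (B_eq : [set j | B j] = W e A) (B_inf : infinite_set [set j | B j]) (B_0 : B 0).

Definition true_prefix (i : nat) : seq bool :=
  flatten [seq nseq (settling e A B j) (B j) ++ [:: false] | j <- iota 0 i].

Lemma true_prefixS i : true_prefix i.+1 =
  true_prefix i ++ nseq (settling e A B i) (B i) ++ [:: false].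
Proof. by rewrite /true_prefix -addn1 iotaD map_cat flatten_cat /= cats0 add0n. Qed.

Lemma C_stringE i : C_string e A B i = true_prefix i ++ nseq (settling e A B i) (B i).
Proof. by elim: i => //= i ->; rewrite true_prefixS -!catA. Qed.

Lemma size_true_prefix i : i <= size (true_prefix i).
Proof. by elim: i => // i IH; rewrite true_prefixS !size_cat /=; lia. Qed.

Lemma haltsE j : halts e A j <-> B j.
Proof. by have := congr1 (fun S : set nat => S j) B_eq; rewrite /= /W /= => ->. Qed.

Lemma B_above i : exists2 j, i < j & B j.
Proof.
apply: contrapT => no; apply: B_inf; apply: (@sub_finite_set _ _ `I_i.+1); last exact: finite_II.
by move=> j /= Bj; rewrite ltnS leqNgt; apply/negP => ij; apply: no; exists j.
Qed.

Lemma next_haltingP i : [/\ i < next_halting e A i, B (next_halting e A i) &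
  forall j, i < j -> B j -> next_halting e A i <= j].
Proof.
have [j ij Bj] := B_above i.
have P : [set j | i < j /\ halts e A j] j by split=> //; apply/haltsE.
have [[h1 /haltsE h2] _] := leastP P; split=> // k ik Bk.
by have [] := @leastP [set j | i < j /\ halts e A j] k; first by split=> //; apply/haltsE.
Qed.

(** Only finitely many computations have to settle, so a stage exists and [least] is a true
    minimum. *)
Lemma settlingP i : B i ->
  (forall j, j <= next_halting e A i -> B j -> halts_within e A (settling e A B i) j) /\
  forall s, (forall j, j <= next_halting e A i -> B j -> halts_within e A s j) ->
    settling e A B i <= s.
Proof.
move=> Bi; set P := [set s | forall j, j <= next_halting e A i ->
                     halts e A j -> halts_within e A s j].
have sE : settling e A B i = least P by rewrite /settling Bi.
have [s Ps] : exists s, P s.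
  rewrite /P /=; elim: (next_halting e A i) => [|m [s hs]].
    have /haltsE[s hs] := B_0; exists s => j; rewrite leqn0 => /eqP-> _; exact: hs.
  case: (pselect (halts e A m.+1)) => [[t ht]|nh].
    exists (maxn s t) => j; rewrite leq_eqVlt => /orP[/eqP-> _|jm hj].
      exact: halts_within_mono (leq_maxr _ _) ht.
    by apply: halts_within_mono (leq_maxl _ _) (hs j jm hj).
  by exists s => j; rewrite leq_eqVlt => /orP[/eqP->//|]; exact: hs.
rewrite sE; split.
  have [h _] := leastP Ps; move=> j jm /haltsE; exact: h.
move=> t ht; have [|_] := @leastP P t; last by [].
by move=> j jm /haltsE; exact: ht.
Qed.

Section Agreement.
Variables (l i : nat).
Hypotheses (i_gt0 : 0 < i) (Bi : B i) (settled : forall j, j < i -> B j -> settling e A B j <= l).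
Local Notation sg := (mkseq A l).

(** For the largest element j of B below i, m_j = i, so f(j) <= l bounds the halting times of all
    elements of B up to i; such a j exists because 0 is in B and 0 < i. Conversely, halting within l
    steps on the first l bits of A is true halting. *)
Lemma fin_halts_agree k : k <= i -> fin_halts e sg k = B k.
Proof.
move=> ki; rewrite /fin_halts size_mkseq halts_within_prefix //.
apply/idP/idP => [h|Bk]; first by apply/haltsE; exists l.
have ex : exists j, (j < i) && B j by exists 0; rewrite i_gt0 B_0.
have bd j : (j < i) && B j -> j <= i by move=> /andP[/ltnW].
have [j /andP[ji Bj] jm] := ex_maxnP ex bd.
have [h1 h2 h3] := next_haltingP j; have nji : next_halting e A j = i.
  apply/eqP; rewrite eqn_leq h3 //= leqNgt; apply/negP => lt.
  by have := jm _ (_ : (next_halting e A j < i) && B (next_halting e A j)); rewrite lt h2 =>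
    /(_ isT); lia.
have [hs _] := settlingP Bj; apply: halts_within_mono (settled ji Bj) _.
by apply: hs; rewrite ?nji.
Qed.

Lemma fin_next_agree j : j < i -> fin_next e sg i j = next_halting e A j.
Proof.
move=> ji; have [h1 h2 h3] := next_haltingP j.
have ni : next_halting e A j <= i by apply: h3.
rewrite /fin_next -(subnKC h1); congr addn.
have E : iota j.+1 (i - j) = iota j.+1 (next_halting e A j - j.+1) ++
    next_halting e A j :: iota (next_halting e A j).+1 (i - next_halting e A j).
  by rewrite -[_ :: _]/(iota _ _.+1) -{2}(subnKC h1) -iotaD; congr iota; lia.
rewrite E find_cat ifF.
  by rewrite size_iota /= fin_halts_agree // h2 addn0.
apply/negbTE/hasPn => k; rewrite mem_iota subnKC // => /andP[jk kn].
rewrite fin_halts_agree; last by lia.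
by apply/negP => Bk; have := h3 k jk Bk; lia.
Qed.

Lemma find_iota0 (p : pred nat) s n : p s -> s < n -> (forall t, p t -> s <= t) ->
  find p (iota 0 n) = s.
Proof.
move=> ps sn ms.
have E : iota 0 n = iota 0 s ++ s :: iota s.+1 (n - s.+1).
  by rewrite -[_ :: _]/(iota _ _.+1) -{2}[s]add0n -iotaD; congr iota; lia.
rewrite E find_cat ifF; first by rewrite /= ps size_iota addn0.
apply/negbTE/hasPn => k; rewrite mem_iota add0n /= => ks.
by apply/negP => /ms; lia.
Qed.

Lemma fin_settling_agree j : j < i -> B j -> fin_settling e sg i j = settling e A B j.
Proof.
move=> ji Bj; rewrite /fin_settling fin_next_agree // size_mkseq.
have [hs ms] := settlingP Bj; have sl := settled ji Bj.
have [h1 h2 h3] := next_haltingP j.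
have ni : next_halting e A j <= i by apply: h3.
rewrite (@eq_in_find _ _ (fun s => all (fun k => B k ==> halts_within e A s k)
                     (iota 0 (next_halting e A j).+1))); last first.
  move=> s; rewrite mem_iota ltnS => /andP[_ sl']; cbv beta; apply: eq_in_all => k;
    rewrite mem_iota ltnS /= => kn.
  by rewrite fin_halts_agree ?halts_within_prefix //; apply: leq_trans ni.
apply: find_iota0; rewrite ?ltnS //.
  by apply/allP => k; rewrite mem_iota ltnS /= => kn; apply/implyP; exact: hs.
move=> t /allP ht; apply: ms => k kn Bk; have := ht k; rewrite mem_iota ltnS /= kn Bk.
exact.
Qed.

Lemma fin_prefix_agree : fin_prefix e sg i = true_prefix i.
Proof.
rewrite /fin_prefix /true_prefix; congr flatten; apply/eq_in_map => j; rewrite mem_iota /= => ji.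
rewrite /fin_block fin_halts_agree ?(ltnW ji) //; case: ifP => [Bj|nB].
  by rewrite fin_settling_agree.
by rewrite /settling nB.
Qed.

End Agreement.

Variables (C : real) (C_lim : is_limit_C e A B C).

Lemma true_prefix_C i : cylinder (true_prefix i) C.
Proof. by have := @C_lim i; rewrite C_stringE => /cylinder_cat. Qed.

Lemma decoding l L : settling e A B 0 <= l ->
  exists i, fin_halts e (mkseq A l) i /\
    (L <= size (fin_prefix e (mkseq A l) i) /\ cylinder (take L (fin_prefix e (mkseq A l) i)) C \/
     cylinder (fin_prefix e (mkseq A l) i ++ nseq l true) C).
Proof.
move=> s0.
case: (pselect (exists i, B i && (l < settling e A B i))) => [ex|nex].
  have [i /andP[Bi li] im] := ex_minnP ex.
  (* The bound on f(0) excludes i = 0, below which there is no element of B to rely on. *)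
  have i0 : 0 < i by case: i Bi li {im} => // _; lia.
  have st j : j < i -> B j -> settling e A B j <= l.
    by move=> ji Bj; rewrite leqNgt; apply/negP => lj; have := im j; rewrite Bj lj; lia.
  exists i; rewrite (fin_halts_agree i0 Bi st) // (fin_prefix_agree i0 Bi st); split=> //; right.
  apply: (@cylinder_cat _ (nseq (settling e A B i - l) true)).
  rewrite -catA cat_nseq /ncons -iterD subnKC; last exact: ltnW.
  by have := @C_lim i; rewrite C_stringE Bi.
have st j : B j -> settling e A B j <= l.
  by move=> Bj; rewrite leqNgt; apply/negP => lj; apply: nex; exists j; rewrite Bj.
(* Everything in B has settled within l steps, so any element i of B beyond L serves: its prefix has
   length at least i. *)
have [i Li Bi] := B_above L; have i0 : 0 < i by lia.
have st' j : j < i -> B j -> settling e A B j <= l by move=> _; exact: st.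
exists i; rewrite (fin_halts_agree i0 Bi st') // (fin_prefix_agree i0 Bi st'); split=> //; left.
split; first by apply: leq_trans (size_true_prefix i); apply: ltnW.
by apply: (@cylinder_cat _ (drop L (true_prefix i))); rewrite cat_take_drop; apply: true_prefix_C.
Qed.

End TrueDecoding.

(** * Computability of the decoding *)

Section FinComp.
Variables (X : nat -> bool) (e : nat).

Lemma computable_halts_string A {encA : enc A} (sg : A -> seq bool) (s j : A -> nat) :
  computable X sg -> computable X s -> computable X j ->
  computable X (fun a => halts_within e (string_real (sg a)) (s a) (j a)).
Proof.
move=> hg hs hj; apply: (@computable_halted X (machine e) A encA (fun a => string_real (sg a))) =>
  //.
by rewrite /string_real; apply: computable_nth; computable_tac.
Qed.

Lemma computable_fin_halts A {encA : enc A} (sg : A -> seq bool) (j : A -> nat) :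
  computable X sg -> computable X j -> computable X (fun a => fin_halts e (sg a) (j a)).
Proof. by move=> hg hj; apply: computable_halts_string => //; apply: computable_size. Qed.

Lemma computable_sub A {encA : enc A} (f g : A -> nat) : computable X f -> computable X g ->
  computable X (fun a => f a - g a).
Proof.
move=> hf hg; apply: computable_ext (computable_iter hg (f := fun _ => predn) _ hf) => [a|].
  by rewrite iter_predn.
by computable_tac.
Qed.

Lemma computable_fin_next A {encA : enc A} (sg : A -> seq bool) (i j : A -> nat) :
  computable X sg -> computable X i -> computable X j -> computable X (fun a =>
    fin_next e (sg a) (i a) (j a)).
Proof.
move=> hg hi hj; apply: computable_add; first by computable_tac.
apply: (computable_find (p := fun a => fin_halts e (sg a))).
  by apply: computable_iota; [computable_tac | apply: computable_sub].
by apply: computable_fin_halts; computable_tac.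
Qed.

Lemma computable_fin_settling A {encA : enc A} (sg : A -> seq bool) (i j : A -> nat) :
  computable X sg -> computable X i -> computable X j -> computable X (fun a =>
    fin_settling e (sg a) (i a) (j a)).
Proof.
move=> hg hi hj; rewrite /fin_settling.
have hn := computable_fin_next hg hi hj.
apply: (computable_find (p := fun a s => all (fun k => fin_halts e (sg a) k ==>
   halts_within e (string_real (sg a)) s k) (iota 0 (fin_next e (sg a) (i a) (j a)).+1))).
  by apply: computable_iota; [computable_tac | apply: computable_succ; apply: computable_size].
apply: (computable_all (p := fun (q : A * nat) k => fin_halts e (sg q.1) k ==>
   halts_within e (string_real (sg q.1)) q.2 k)).
  apply: computable_iota; first by computable_tac.
  by apply: computable_succ; apply: (computable_comp hn); computable_tac.
by apply: computable_imp; [apply: computable_fin_halts | apply: computable_halts_string];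
  computable_tac.
Qed.

Lemma computable_fin_prefix A {encA : enc A} (sg : A -> seq bool) (i : A -> nat) :
  computable X sg -> computable X i -> computable X (fun a => fin_prefix e (sg a) (i a)).
Proof.
move=> hg hi; apply: computable_flatten.
apply: (computable_map (f := fun a j => fin_block e (sg a) (i a) j ++ [:: false])).
  by apply: computable_iota; computable_tac.
apply: computable_cat; last by computable_tac.
apply: computable_if; [by apply: computable_fin_halts; computable_tac | | by computable_tac].
by apply: computable_nseq; [apply: computable_fin_settling|]; computable_tac.
Qed.

End FinComp.

(** * The test for C *)

Section Test.
Variables (R : realType) (mu : probability borel_cantor R) (n e : nat).
Local Notation h := (dissipation mu).

(** Every approximation L of the iterate contributes; by [fin_prefix_take] each yields at most one
    string, whichever candidate i it comes from. *)
Definition short_outputs (sg : seq bool) : set (seq bool) :=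
  [set t | exists L i, [/\ near_iter mu n (size sg) L, fin_halts e sg i,
     L <= size (fin_prefix e sg i) & t = take L (fin_prefix e sg i)]].

Definition long_outputs (sg : seq bool) : set (seq bool) :=
  [set t | exists L i, [/\ near_iter mu n (size sg) L, fin_halts e sg i,
     size (fin_prefix e sg i) < L & t = fin_prefix e sg i ++ nseq (size sg) true]].

Definition decoded_test (T : set (seq bool)) (l0 : nat) : set (seq bool) :=
  [set t | exists sg, [/\ T sg, l0 <= size sg & (short_outputs sg `|` long_outputs sg) t]].

(** Membership is an existential statement over sigma, L and i with an enumerable matrix. The set
    itself mentions no representation, so all representations enumerate the same set. *)
Lemma mu_ce_decoded_test T l0 : mu_ce mu T -> mu_ce mu (decoded_test T l0).
Proof.
move=> hT X rX; apply/ce_stringsP; have /ce_stringsP rT := hT X rX.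
have rn := enumerable_near_iter n rX.
have hs : computable X (fun z : seq bool * seq bool * nat * nat => z.1.1.2) by computable_tac.
have hi : computable X (fun z : seq bool * seq bool * nat * nat => z.2) by computable_tac.
have hL : computable X (fun z : seq bool * seq bool * nat * nat => z.1.2) by computable_tac.
have ht : computable X (fun z : seq bool * seq bool * nat * nat => z.1.1.1) by computable_tac.
have hp := computable_fin_prefix e hs hi.
have hz := computable_size hs.
have hh := computable_fin_halts e hs hi.
have r1 : enumerable X (fun z : seq bool * seq bool * nat * nat =>
  near_iter mu n (size z.1.1.2) z.1.2).
  have hc : computable X (fun z : seq bool * seq bool * nat * nat => (size z.1.1.2,
    z.1.2)) by computable_tac.
  exact: enumerable_comp hc rn.
have r2 := enumerable_and r1 (enumerable_bool hh).
have rshort : enumerable X (fun ts : seq bool * seq bool => short_outputs ts.2 ts.1).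
  (* Truncation at L is expressed by the existence of a remainder [u]. *)
  have r3 : enumerable X (fun z : seq bool * seq bool * nat * nat =>
      size z.1.1.1 = z.1.2 /\ exists u, fin_prefix e z.1.1.2 z.2 = z.1.1.1 ++ u).
    apply: enumerable_and; first by apply: enumerable_eq; [apply: computable_size | exact: hL].
    apply: enumerable_ex; apply: enumerable_eq; first by apply: (computable_comp hp);
      computable_tac.
    by apply: computable_cat; computable_tac.
  have r5 : enumerable X (fun ts : seq bool * seq bool => exists L i,
    (near_iter mu n (size ts.2) L /\
      fin_halts e ts.2 i) /\ (size ts.1 = L /\ exists u, fin_prefix e ts.2 i = ts.1 ++ u)).
    by do 2!apply: enumerable_ex; exact: enumerable_and r2 r3.
  apply: enumerable_ext r5 => -[t sg] /=; split=> -[L [i]].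
    move=> [[nl fh] [tL [u pE]]]; exists L, i; split=> //; rewrite pE ?size_cat -tL ?leq_addr //.
    by rewrite take_size_cat.
  move=> [nl fh Ls ->]; exists L, i; split=> //; split; first by rewrite size_takel.
  by exists (drop L (fin_prefix e sg i)); rewrite cat_take_drop.
have rlong : enumerable X (fun ts : seq bool * seq bool => long_outputs ts.2 ts.1).
  have r3 : enumerable X (fun z : seq bool * seq bool * nat * nat =>
      size (fin_prefix e z.1.1.2 z.2) < z.1.2 /\
      z.1.1.1 = fin_prefix e z.1.1.2 z.2 ++ nseq (size z.1.1.2) true).
    apply: enumerable_and; first by apply: enumerable_bool; apply: computable_leq;
      [apply: computable_succ; apply: computable_size | exact: hL].
    apply: enumerable_eq; first exact: ht.
    by apply: computable_cat => //; apply: computable_nseq; computable_tac.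
  have r5 : enumerable X (fun ts : seq bool * seq bool => exists L i,
    (near_iter mu n (size ts.2) L /\
      fin_halts e ts.2 i) /\ (size (fin_prefix e ts.2 i) < L /\
        ts.1 = fin_prefix e ts.2 i ++ nseq (size ts.2) true)).
    by do 2!apply: enumerable_ex; exact: enumerable_and r2 r3.
  apply: enumerable_ext r5 => -[t sg] /=; split=> -[L [i]].
    by move=> [[nl fh] [sL tE]]; exists L, i.
  by move=> [nl fh sL tE]; exists L, i.
have r4 : enumerable X (fun ts : seq bool * seq bool => T ts.2 /\ (l0 <= size ts.2 /\
    (short_outputs ts.2 ts.1 \/ long_outputs ts.2 ts.1))).
  apply: enumerable_and; first by apply: enumerable_comp rT; computable_tac.
  apply: enumerable_and; last exact: enumerable_or.
  by apply: enumerable_bool; apply: computable_leq; [computable_tac | apply: computable_size;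
    computable_tac].
have r5 : enumerable X (fun t => exists sg, T sg /\ (l0 <= size sg /\
    (short_outputs sg t \/ long_outputs sg t))) by apply: enumerable_ex r4.
apply: enumerable_ext r5 => t /=.
by split=> -[sg []]; [move=> Ts [ls o] | move=> Ts ls o]; exists sg.
Qed.

End Test.

(** * Sums over the test *)

Local Open Scope ring_scope.

Section Weights.
Variable R : realType.

Definition weight (c : R) (d : nat) : R := powR d%:R c * 2 ^- d.

Lemma weight_ge0 c d : 0 <= weight c d.
Proof. by rewrite mulr_ge0 ?powR_ge0 // invr_ge0 exprn_ge0. Qed.

(** From 1 + x <= e^x comes t + 1 <= k e^(t/k) for k >= 1; raised to the power c, the right side is
    at most k^c 2^t as soon as c <= k ln 2, which explains the choice of [k]. *)
Lemma powR_le_pow2 (c : R) : 0 <= c ->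
  exists K : R, forall t, powR (t.+1)%:R c <= K * 2 ^+ t.
Proof.
move=> c0; have ln2 : 0 < ln 2 :> R by rewrite ln_gt0 // ltr1n.
pose k : R := 1 + c / ln 2.
have k1 : 1 <= k by rewrite lerDl divr_ge0 // ltW.
have k0 : 0 < k by apply: lt_le_trans k1.
have ck : c <= k * ln 2 by rewrite mulrDl divfK ?gt_eqF // mul1r lerDr ltW.
exists (powR k c) => t.
have le1 : (t.+1)%:R <= k * expR (t%:R / k).
  apply: le_trans (_ : k * (1 + t%:R / k) <= _); last by rewrite ler_pM2l // expR_ge1Dx.
  by rewrite mulrDr mulr1 mulrCA divff ?gt_eqF // mulr1 -natr1 addrC lerD2r.
apply: le_trans (ge0_ler_powR c0 _ _ le1) _; rewrite ?nnegrE //.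
  by rewrite mulr_ge0 ?expR_ge0 // ltW.
rewrite powRM; [|exact: ltW|exact: expR_ge0]; rewrite ler_pM2l ?powR_gt0 // -expRM.
rewrite -[X in _ <= X ^+ t](lnK (_ : 2 \is Num.pos)) ?posrE // -expRM_natl ler_expR.
by rewrite -mulrA ler_wpM2l // mulrC ler_pdivrMr // mulrC.
Qed.

(** For a >= 1 one has a + t <= a (t + 1), so over t steps the power grows at most by the factor (t
    + 1)^c <= K 2^t, and 2^-t absorbs all of it but K. *)
Lemma weight_decreasing (c : R) : 0 <= c ->
  exists K, forall a d, (0 < a)%N -> (a <= d)%N -> weight c d <= K * weight c a.
Proof.
move=> c0; have [K hK] := powR_le_pow2 c0; exists K => a d a0 /subnKC <-.
move: (d - a)%N => t; rewrite /weight.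
have le1 : powR (a + t)%:R c <= powR a%:R c * (K * 2 ^+ t) :> R.
  apply: le_trans (_ : powR (a%:R * t.+1%:R) c <= _).
    apply: ge0_ler_powR => //; rewrite ?nnegrE ?ler0n // -?natrM ?ler0n //.
    by rewrite ler_nat mulnS leq_add2l leq_pmull.
  by rewrite powRM // ler_wpM2l ?powR_ge0.
rewrite exprD invfM [leLHS]mulrA ler_pdivrMr ?exprn_gt0 //.
apply: le_trans (_ : powR a%:R c * (K * 2 ^+ t) / 2 ^+ a <= _).
  by rewrite ler_wpM2r // invr_ge0 exprn_ge0.
by rewrite le_eqVlt; apply/orP; left; apply/eqP; ring.
Qed.

(** Where the level doubles: d strings of weight d^c 2^-d cost one unit in the exponent. *)
Lemma weightS c d : (0 < d)%N -> d%:R * weight c d = weight (1 + c) d.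
Proof.
move=> d0; rewrite /weight mulrA powRD ?powRr1 //.
by apply/implyP => _; rewrite pnatr_eq0 -lt0n.
Qed.

Lemma log2_ge0 (n : nat) : (1 <= n)%N -> 0 <= log2 (n%:R : R).
Proof.
move=> n1; rewrite /log2 divr_ge0 // ln_ge0 // ?ler1n //.
Qed.

Lemma log2_double (n : nat) : (1 <= n)%N -> log2 ((2 * n)%:R : R) = 1 + log2 (n%:R : R).
Proof.
move=> n1; rewrite /log2 natrM lnM ?posrE ?ltr0n // mulrDl divff //.
by rewrite gt_eqF // ln_gt0 // ltr1n.
Qed.

End Weights.

Section Sums.
Variables (R : realType).
Local Open Scope ereal_scope.

Lemma esum_subset (T : choiceType) (I J : set T) (f : T -> \bar R) : I `<=` J ->
  \esum_(i in I) f i <= \esum_(i in J) f i.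
Proof.
move=> IJ; apply: ereal_sup_le => _ [F [finF FI] <-]; exists F => //.
by split=> //; apply: subset_trans IJ.
Qed.

Lemma esum_le_scale (T : choiceType) (I : set T) (f g : T -> \bar R) (K : R) :
  (0 <= K)%R -> (forall i, I i -> 0 <= g i) -> (forall i, I i -> f i <= K%:E * g i) ->
  \esum_(i in I) f i <= K%:E * \esum_(i in I) g i.
Proof.
move=> K0 g0 fg; apply: ge_ereal_sup => _ [F [finF FI] <-].
apply: (@le_trans _ _ (K%:E * \sum_(i \in F) g i)).
  rewrite !fsbig_finite //= !big_seq.
  have mF (i : T) : i \in fset_set F -> I i by rewrite in_fset_set // => /set_mem/FI.
  rewrite ge0_sume_distrr; last by move=> i /mF; exact: g0.
  by apply: lee_sum => i /mF; exact: fg.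
by apply: lee_wpmul2l; [rewrite lee_fin | apply: esum_ge; exists F].
Qed.

(** The finite partial sums are bounded through the injective label [k] with values in [s], so
    finiteness of [I] need not be known beforehand. *)
Lemma esum_le_count (T : choiceType) (I : set T) (f : T -> \bar R) (k : T -> nat)
    (s : seq nat) (c : R) : (0 <= c)%R ->
  (forall i, I i -> k i \in s) -> {in I &, injective k} -> (forall i, I i -> f i <= c%:E) ->
  \esum_(i in I) f i <= ((size s)%:R * c)%:E.
Proof.
move=> c0 ks kinj fc; apply: ge_ereal_sup => _ [F [finF FI] <-].
rewrite fsbig_finite //=.
have mF (i : T) : i \in fset_set F -> I i by rewrite in_fset_set // => /set_mem/FI.
apply: (@le_trans _ _ (\sum_(i <- fset_set F) c%:E)).
  by rewrite !big_seq; apply: lee_sum => i /mF; exact: fc.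
rewrite sumEFin big_const_seq count_predT lee_fin iter_addr_0 -[leLHS]mulr_natl ler_wpM2r //
  ler_nat.
rewrite -(size_map k); apply: uniq_leq_size.
  rewrite map_inj_in_uniq ?fset_uniq // => i j /mF Ii /mF Ij; apply: kinj; exact: mem_set.
by move=> _ /mapP[i /mF Ii ->]; exact: ks.
Qed.

(** Choosing for each t in the union one index of a set containing it embeds the union in the
    disjoint sum; [s0] is the arbitrary choice outside the union. *)
Lemma esum_bigcup_le (S T : choiceType) (s0 : S) (J : set S) (F : S -> set T) (f : T -> \bar R) :
  (forall t, 0 <= f t) ->
  \esum_(t in [set t | exists2 s, J s & F s t]) f t <= \esum_(s in J) \esum_(t in F s) f t.
Proof.
move=> f0; rewrite esum_esum //; set U := [set t | _].
have /choice[g gP] : forall t, exists s, U t -> J s /\ F s t.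
  move=> t; case: (pselect (U t)) => [[s Js Fs]|nU]; first by exists s.
  by exists s0.
rewrite -(@esum_image _ _ _ U (fun t => (g t, t)) (fun st => f st.2)); last by move=> s t _ _ [].
by apply: esum_subset => _ [t /gP[Jg Fg] <-].
Qed.

End Sums.

Section TestWeight.
Variables (R : realType) (mu : probability borel_cantor R) (n e l0 : nat).
Hypotheses (n_ge1 : (1 <= n)%N)
  (l0P : forall l, (l0 <= l)%N -> (n < iter (2 * n) (dissipation mu) l)%N).
Local Notation h := (dissipation mu).
Local Notation c := (log2 (n%:R : R)).

Lemma test_weightE k s : test_weight mu k s = weight (log2 k%:R) (iter k h (size s)).
Proof. by []. Qed.

Section OneString.
Variable sg : seq bool.
Hypothesis sg_size : (l0 <= size sg)%N.
Local Notation b := (iter n h (size sg)).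
Local Notation a := (iter (2 * n) h (size sg)).

Let aE : a = iter n h b. Proof. by rewrite mul2n -addnn iterD. Qed.

(** Labelled by length: L takes at most n + 1 values, from b - n to b. For each of them h^(n)(L)
    lies between a - n and a, which costs the factor 2^n; a >= 1 allows a^c to be replaced by a^(1 +
    c). *)
Lemma short_outputs_weight :
  (\esum_(t in short_outputs mu n e sg) (test_weight mu n t)%:E <=
    ((n.+1)%:R * (2 ^+ n * weight (1 + c) a))%:E)%E.
Proof.
have na := l0P sg_size.
rewrite -[n.+1](size_iota (b - n)).
apply: (esum_le_count (k := size)).
- by rewrite mulr_ge0 ?weight_ge0 ?exprn_ge0.
- move=> _ [L [i [/near_iter_bounds/andP[h1 h2] _ Ls ->]]].
  by rewrite size_takel // mem_iota; lia.
- move=> _ _ /set_mem[L [i [_ fi Li ->]]] /set_mem[L' [i' [_ fi' Li' ->]]].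
  rewrite !size_takel // => e1; rewrite -e1 in Li' *; exact: fin_prefix_take.
- move=> _ [L [i [/near_iter_bounds/andP[h1 h2] _ Ls ->]]].
  rewrite test_weightE lee_fin size_takel //; set d := iter n h L.
  have da : (d <= a)%N by rewrite aE; apply: iter_dissipation_mono.
  have ad : (a <= d + n)%N.
    rewrite aE; apply: leq_trans (iter_dissipation_mono _ _ h2) _.
    exact: iter_dissipation_add.
  have a0 : (0 < a)%N by lia.
  rewrite -weightS // /weight.
  have p1 : powR d%:R c <= powR a%:R c.
    by apply: ge0_ler_powR; rewrite ?nnegrE ?ler_nat ?log2_ge0.
  have p2 : 2 ^- d <= 2 ^+ n * 2 ^- a :> R.
    rewrite ler_pdivlMr ?exprn_gt0 // mulrC ler_pdivrMr ?exprn_gt0 // -exprD.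
    by rewrite ler_eXn2l ?ltr1n // addnC.
  apply: le_trans (_ : powR a%:R c * (2 ^+ n * 2 ^- a) <= _).
    by apply: ler_pM => //; rewrite ?powR_ge0 ?invr_ge0 ?exprn_ge0.
  by rewrite mulrCA ler_wpM2l ?exprn_ge0 // ler_peMl ?ler1n //.
Qed.

(** Labelled by |E| < L <= b, so there are at most b strings. Each is at least as long as sigma,
    hence weighs at most K times the weight at b; the factor b raises the exponent by one, and a
    second comparison of weights passes from b down to a <= b. *)
Lemma long_outputs_weight (K : R) :
  (forall a d, (0 < a)%N -> (a <= d)%N -> weight (1 + c) d <= K * weight (1 + c) a) ->
  (forall a d, (0 < a)%N -> (a <= d)%N -> weight c d <= K * weight c a) ->
  (\esum_(t in long_outputs mu n e sg) (test_weight mu n t)%:E <=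
    (K * (K * weight (1 + c) a))%:E)%E.
Proof.
move=> hK hK'; have na := l0P sg_size.
have a0 : (0 < a)%N by lia.
have ab : (a <= b)%N by rewrite aE; apply: iter_dissipation_le.
have b0 : (0 < b)%N by lia.
have K0 : 0 <= K.
  (* The instance a = d = 1 forces 1 <= K. *)
  have := hK' 1%N 1%N isT isT; rewrite -[leLHS]mul1r ler_pM2r; first by apply: le_trans.
  by rewrite mulr_gt0 ?powR_gt0 // invr_gt0.
apply: (@le_trans _ _ ((size (iota 0 b))%:R * (K * weight c b))%:E%E).
  apply: (esum_le_count (k := fun t => (size t - size sg)%N)).
  - by rewrite mulr_ge0 ?weight_ge0.
  - move=> _ [L [i [/near_iter_bounds/andP[h1 h2] _ Ls ->]]].
    by rewrite size_cat size_nseq addnK mem_iota /=; lia.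
  - move=> _ _ /set_mem[L [i [_ fi Li ->]]] /set_mem[L' [i' [_ fi' Li' ->]]].
    rewrite !size_cat !size_nseq !addnK => e1; congr (_ ++ _).
    have := fin_prefix_take fi fi' (leqnn _); rewrite -e1 => /(_ (leqnn _)).
    by rewrite take_size e1 take_size.
  - move=> _ [L [i [_ _ _ ->]]]; rewrite lee_fin test_weightE; apply: hK' => //.
    by apply: iter_dissipation_mono; rewrite size_cat size_nseq leq_addl.
rewrite lee_fin size_iota mulrCA weightS // ler_wpM2l //; exact: hK.
Qed.

End OneString.

Lemma decoded_test_summable T :
  (\esum_(s in T) (test_weight mu (2 * n) s)%:E < +oo ->
  \esum_(t in decoded_test mu n e T l0) (test_weight mu n t)%:E < +oo)%E.
Proof.
move=> fin.
have c0 : 0 <= c by exact: log2_ge0.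
have c1 : 0 <= 1 + c by rewrite addr_ge0.
have [K1 hK1] := weight_decreasing c0; have [K2 hK2] := weight_decreasing c1.
pose K := Num.max K1 K2.
have w0 k s : (0 <= (test_weight mu k s)%:E)%E by rewrite lee_fin test_weightE weight_ge0.
have hK a d : (0 < a)%N -> (a <= d)%N -> weight (1 + c) d <= K * weight (1 + c) a.
  move=> a0 ad; apply: le_trans (hK2 a d a0 ad) _.
  by rewrite ler_wpM2r ?weight_ge0 // /K le_max lexx orbT.
have hK' a d : (0 < a)%N -> (a <= d)%N -> weight c d <= K * weight c a.
  move=> a0 ad; apply: le_trans (hK1 a d a0 ad) _.
  by rewrite ler_wpM2r ?weight_ge0 // /K le_max lexx.
(* The two summands bound the short and the long outputs of a single sigma. *)
pose D := (n.+1)%:R * 2 ^+ n + K * K : R.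
have D0 : 0 <= D.
  by apply: addr_ge0; [rewrite mulr_ge0 ?exprn_ge0 | rewrite -expr2 sqr_ge0].
pose J := [set sg | T sg /\ (l0 <= size sg)%N].
have one sg : J sg -> (\esum_(t in short_outputs mu n e sg `|` long_outputs mu n e sg)
    (test_weight mu n t)%:E <= D%:E * (test_weight mu (2 * n) sg)%:E)%E.
  move=> [_ ls]; rewrite test_weightE log2_double //.
  have h1 := short_outputs_weight ls; have h2 := long_outputs_weight ls hK hK'.
  set S1 := short_outputs _ _ _ _; set S2 := long_outputs _ _ _ _.
  rewrite (esumID S1) //; rewrite /D -EFinM mulrDl EFinD; apply: leeD.
    rewrite -mulrA; apply: le_trans h1; apply: esum_subset; exact: subIsetr.
  rewrite -mulrA; apply: le_trans h2; apply: esum_subset => t [[//|//] _].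
apply: (@le_lt_trans _ _ (D%:E * \esum_(s in J) (test_weight mu (2 * n) s)%:E)%E); last first.
  apply: lte_mul_pinfty => //.
  by apply: le_lt_trans fin; apply: esum_subset => s [].
apply: le_trans (esum_le_scale D0 _ one) => //.
rewrite (_ : decoded_test _ _ _ _ _ =
  [set t | exists2 sg, J sg & (short_outputs mu n e sg `|` long_outputs mu n e sg) t]).
  exact: (esum_bigcup_le [::]).
apply/seteqP; split=> t /= [sg].
  by move=> [Ts ls o]; exists sg.
by move=> [Ts ls] o; exists sg.
Qed.

End TestWeight.

Local Close Scope ring_scope.

(** * Failing the new test *)

Lemma cylinder_mkseq s X : cylinder s X -> s = mkseq X (size s).
Proof.
move=> h; apply: (@eq_from_nth _ false); rewrite ?size_mkseq // => i si.
by rewrite nth_mkseq // h.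
Qed.

(** A real has only one initial segment of each length, so infinitely many of them in [T] include
    arbitrarily long ones. *)
Lemma fails_test_long X T N : fails_test X T -> exists s, [/\ T s, cylinder s X & N <= size s].
Proof.
move=> inf; apply: contrapT => no; apply: inf.
apply: (@sub_finite_set _ _ ((fun l => mkseq X l) @` `I_N)); last exact/finite_image/finite_II.
move=> s [Ts cs]; exists (size s); last by rewrite -cylinder_mkseq.
by rewrite /= ltnNge; apply/negP => Ns; apply: no; exists s.
Qed.

Lemma long_fails_test X T : (forall N, exists s, [/\ T s, cylinder s X & N <= size s]) ->
  fails_test X T.
Proof.
move=> long; rewrite /fails_test; set S := (S in infinite_set S) => finS.
have [s [Ts cs]] := long (\max_(s <- fset_set S) size s).+1.
rewrite ltnNge => /negP; apply.
apply: (@leq_bigmax_seq _ _ xpredT (fun s : seq bool => size s)) => //.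
by rewrite in_fset_set //; apply/mem_set.
Qed.

Section Main.
Variables (R : realType) (mu : probability borel_cantor R).
Hypothesis mu_cont : continuous_measure mu.
Local Notation h := (dissipation mu).

Lemma C_fails_decoded_test n (A B : real) e C T l0 :
  fails_test A T -> [set j | B j] = W e A -> infinite_set [set j | B j] -> B 0 ->
  is_limit_C e A B C -> fails_test C (decoded_test mu n e T l0).
Proof.
move=> fA BE Binf B0 Cl; apply: long_fails_test => N.
(* The 1 makes the exact iterate L positive, as [near_iter_self] demands; the [N] makes the output
   long. *)
have [l1 hl1] := iter_dissipation_unbounded n (maxn 1 N) mu_cont.
have [sg [Tsg cA ls]] := fails_test_long (maxn (maxn l0 l1) (settling e A B 0)) fA.
have sgE := cylinder_mkseq cA; set l := size sg in ls sgE.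
have [l0l l1l s0l] : [/\ l0 <= l, l1 <= l & settling e A B 0 <= l] by split; lia.
have := hl1 l l1l; set L := iter n h l => NL.
have nL : near_iter mu n l L by apply: near_iter_self; rewrite -/L; lia.
have Ll : L <= l by apply: iter_dissipation_le.
have [i [fi dec]] := decoding BE Binf B0 Cl L s0l.
(* If L <= |E|, both alternatives of [decoding] give the prefix of length L; otherwise only the
   second one is possible. *)
rewrite -sgE in fi dec; case: (leqP L (size (fin_prefix e sg i))) dec => [Ls|sL] dec.
  exists (take L (fin_prefix e sg i)); split.
  - by exists sg; split=> //; left; exists L, i.
  - case: dec => [[]//|]; rewrite -{1}(cat_take_drop L (fin_prefix e sg i)) -catA.
    exact: cylinder_cat.
  - by rewrite size_takel //; lia.
exists (fin_prefix e sg i ++ nseq l true); split.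
- by exists sg; split=> //; right; exists L, i.
- by case: dec => [[]|//]; lia.
- by rewrite size_cat size_nseq; lia.
Qed.

End Main.

Theorem theorem3p2 (R : realType) (mu : probability borel_cantor R)
    (mu_cont : continuous_measure mu)
    (n : nat) (n_ge1 : (1 <= n)%N)
    (A B : real) (A_nonrandom : non_random mu (2 * n)%N A)
    (B_rea : rea B A) (e : nat) (B_eq : [set j | B j] = W e A)
    (B_infinite : infinite_set [set j | B j]) (B_0 : B 0%N)
    (one_step : halts_within e A 1 0) (no_query : ~ makes_query e A 0)
    (C : real) (C_lim : is_limit_C e A B C) :
  non_random mu n C.
Proof.
have [T [[T_ce T_fin] A_fails]] := A_nonrandom.
(* With h^(2n)(l) > n the iterate remains positive even when lowered by the maximal error n. *)
have [l0 hl0] := iter_dissipation_unbounded (2 * n) n.+1 mu_cont.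
exists (decoded_test mu n e T l0); split; last exact: C_fails_decoded_test A_fails _ _ _ C_lim.
split; first exact: mu_ce_decoded_test.
exact: decoded_test_summable.
Qed.
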